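(* Let $h>0$ and let $\ell\ge 1$ be an integer. The centre manifold model of $u_t=\mathcal A u+\epsilon\mathcal B u$ on the grid $x_j=jh$, constructed with the amplitude condition $u_j=v_j(x_j,t)$ and the internal boundary conditions $v_j(x_{j\pm1},t)=(1-\gamma)v_j(x_j,t)+\gamma v_{j\pm1}(x_{j\pm1},t)$ and to errors $O(\gamma^\ell,\epsilon^2)$, forms (when evaluated at $\gamma=1$) a finite difference approximation to the PDE $u_t=\mathcal A u+\epsilon\mathcal B u$ consistent to $O(\partial_x^{2\ell}+\epsilon\,\partial_x^{2\ell-1},\ \epsilon^2)$, where $\mathcal A$ is any even operator (dissipative for all modes except constants) and $\mathcal B$ is any odd operator.
   Context: Even operator: a linear differential operator with constant coefficients containing only even order derivatives in $x$, $\mathcal A=\sum_{m=1}^{M}c_m\partial_x^{2m}$. Dissipative for all modes except constants: $\sum_{m=1}^{M}c_m(-\alpha^2)^m<0$ for all real $\alpha\ne0$. Odd operator: a linear differential operator with constant coefficients containing only odd order derivatives in $x$, $\mathcal B=\sum_{m=1}^{N}d_m\partial_x^{2m-1}$. Grid: $x_j=jh$, $j\in\mathbb Z$; $u_j(t)=u(x_j,t)$ are the grid values and $\vec u$ is the set of them. $v_j$ denotes the field $u$ in the neighbourhood of $x_j$, extended at least out to the adjacent grid points $x_{j\pm1}$. $E$ is the shift $Eu_j=u_{j+1}$; a difference operator is a linear combination of powers of $E$. Centre manifold model to errors $O(\gamma^\ell,\epsilon^2)$: the parameter $\gamma$ couples neighbouring elements, and $\dot\gamma=\dot\epsilon=0$.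 At $\gamma=\epsilon=0$ the elements are decoupled and each has the neutral mode $v_j=u_j$, constant in $x$. The centre manifold based on these neutral modes is parametrised by the grid values $\vec u$, and it and the evolution on it are expanded as $$u=v_j(\vec u,x)=\sum_{k=0}^{\ell-1}\gamma^k v_j^k(\vec u,x)+\epsilon\sum_{k=0}^{\ell-1}\gamma^k w_j^k(\vec u,x),\qquad \dot u_j=\sum_{k=0}^{\ell-1}\gamma^k g^k u_j+\epsilon\sum_{k=0}^{\ell-1}\gamma^k f^k u_j,$$ with $v_j^0=u_j$, with $g^k,f^k$ difference operators, and with the same expressions in every element apart from the shift of the index $j$. The model is constructed by requiring, for all $j$ and $\vec u$, and at each of the orders $\gamma^k$ and $\epsilon\gamma^k$, $0\le k<\ell$: (i) the PDE $\partial_t v_j=\mathcal A v_j+\epsilon\mathcal B v_j$, where $\partial_t v_j$ is obtained by the chain rule from the evolution $\dot u_i$; (ii) the amplitude condition $v_j(\vec u,x_j)=u_j$; (iii) the internal boundary conditions $v_j(\vec u,x_{j\pm1})=(1-\gamma)v_j(\vec u,x_j)+\gamma v_{j\pm1}(\vec u,x_{j\pm1})$. The finite difference model is the evolution evaluated at $\gamma=1$, namely $\dot u_j=\sum_{k=0}^{\ell-1}g^k u_j+\epsilon\sum_{k=0}^{\ell-1}f^k u_j$. Consistency: a finite difference model $\dot u_j=G(E)u_j+\epsilon F(E)u_j$ is consistent with $u_t=\mathcal A u+\epsilon\mathcal B u$ to $O(\partial_x^{p}+\epsilon\partial_x^{q},\epsilon^2)$ if, on substituting $E=\exp(h\partial_x)$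 and expanding formally in powers of $\partial_x$, $G(e^{h\partial_x})-\mathcal A$ contains only powers $\partial_x^{s}$ with $s\ge p$, and $F(e^{h\partial_x})-\mathcal B$ contains only powers $\partial_x^{s}$ with $s\ge q$; terms of order $\epsilon^2$ are neglected.
   Formalization: For A of order 2n>2, conditions (i)-(iii) do not determine the model and the claim fails (A=∂_x^2-∂_x^4, ℓ=2 allows g^1=0); the model is therefore also required to satisfy (iii) for the even derivatives ∂_x^{2i}v_j, 1≤i<n. Nothing is added for second order A. *)

(* Defs.v *)
(* Stdlib real numbers with Coquelicot's total derivatives. *)
From Stdlib Require Export Reals ZArith List.
From Coquelicot Require Export Coquelicot.
Export ListNotations.
Open Scope R_scope.

Definition list_Rsum (l : list R) : R := fold_right Rplus 0 l.

(** * The differential operators *)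

Definition even_op (M : nat) (c : nat -> R) (f : R -> R) (x : R) : R :=
  sum_n_m (fun m => c m * Derive_n f (2 * m) x) 1 M.

Definition odd_op (N : nat) (d : nat -> R) (f : R -> R) (x : R) : R :=
  sum_n_m (fun m => d m * Derive_n f (2 * m - 1) x) 1 N.

Definition dissipative (M : nat) (c : nat -> R) : Prop :=
  forall alpha : R, alpha <> 0 ->
    sum_n_m (fun m => c m * (- (alpha ^ 2)) ^ m) 1 M < 0.

(** * Grid fields and difference operators *)

Definition grid := Z -> R.

Definition gridpoint (h : R) (j : Z) : R := IZR j * h.

Definition shift (j : Z) (u : grid) : grid := fun i => u (i + j)%Z.

(* The list of pairs (a, n) stands for the sum of the a E^n. *)
Definition diffop := list (R * Z).

Definition diffop_apply (G : diffop) (u : grid) (j : Z) : R :=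
  list_Rsum (map (fun t => fst t * u (j + snd t)%Z) G).

(* g 0 + ... + g (l - 1), as an operator. *)
Definition diffop_sum (g : nat -> diffop) (l : nat) : diffop :=
  concat (map g (seq 0 l)).

(** * Functions of finitely many grid values and the chain rule *)

Definition stencil (r : nat) (j : Z) : list Z :=
  map (fun n => (j - Z.of_nat r + Z.of_nat n)%Z) (seq 0 (2 * r + 1)).

Definition grid_update (u : grid) (i : Z) (s : R) : grid :=
  fun k => if Z.eqb k i then s else u k.

Definition grid_partial (phi : grid -> R) (u : grid) (i : Z) : R :=
  Derive (fun s => phi (grid_update u i s)) (u i).

(* Frechet differentiability with respect to u_{j-r}, ..., u_{j+r}.  Since the
   perturbation U is unrestricted off the stencil, this also forces phi to
   depend on these grid values only. *)
Definition grid_differentiable (r : nat) (j : Z) (phi : grid -> R) : Prop :=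
  forall (u : grid) (eps : R), 0 < eps ->
  exists del : R, 0 < del /\
    forall U : grid,
      (forall i : Z, In i (stencil r j) -> Rabs (U i) < del) ->
      Rabs (phi (fun i => u i + U i) - phi u
            - list_Rsum (map (fun i => grid_partial phi u i * U i) (stencil r j)))
      <= eps * list_Rsum (map (fun i => Rabs (U i)) (stencil r j)).

(* The time derivative of phi(u) when du_i/dt = G u_i for all i. *)
Definition chain_rule (r : nat) (j : Z) (phi : grid -> R) (G : diffop)
    (u : grid) : R :=
  list_Rsum (map (fun i => grid_partial phi u i * diffop_apply G u i)
                 (stencil r j)).

(** * The centre manifold model *)

(* The coefficient families are indexed by the power of gamma:
     v_j   = sum_k gamma^k vfield k j + epsilon sum_k gamma^k wfield k j,
     u_j'  = sum_k gamma^k gop k u_j  + epsilon sum_k gamma^k fop k u_j.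
   Only the indices k < l matter.  The radius bounds the dependence of the
   fields on the neighbouring grid values. *)
Record expansion := Expansion {
  radius : nat;
  vfield : nat -> Z -> grid -> R -> R;
  wfield : nat -> Z -> grid -> R -> R;
  gop : nat -> diffop;
  fop : nat -> diffop
}.

(* Domain of the field of element j. *)
Definition in_element (h : R) (j : Z) (x : R) : Prop :=
  Rabs (x - gridpoint h j) <= h.

Definition regular_family (h : R) (l r : nat)
    (y : nat -> Z -> grid -> R -> R) : Prop :=
  forall k : nat, (k < l)%nat ->
    (forall (j : Z) (u : grid) (x : R), in_element h j x ->
       forall n : nat, ex_derive_n (y k j u) n x) /\
    (forall (j : Z) (x : R), in_element h j x ->
       grid_differentiable r j (fun u => y k j u x)) /\
    (forall (j : Z) (u : grid) (x : R),
       y k j u x = y k 0%Z (shift j u) (x - gridpoint h j)).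

Definition pde_order_gamma (h : R) (l M : nat) (c : nat -> R)
    (E : expansion) : Prop :=
  forall (k : nat) (j : Z) (u : grid) (x : R),
    (k < l)%nat -> in_element h j x ->
    sum_n (fun p => chain_rule (radius E) j (fun u' => vfield E p j u' x)
                      (gop E (k - p)) u) k
    = even_op M c (vfield E k j u) x.

Definition pde_order_eps_gamma (h : R) (l M : nat) (c : nat -> R)
    (N : nat) (d : nat -> R) (E : expansion) : Prop :=
  forall (k : nat) (j : Z) (u : grid) (x : R),
    (k < l)%nat -> in_element h j x ->
    sum_n (fun p => chain_rule (radius E) j (fun u' => vfield E p j u' x)
                      (fop E (k - p)) u
                    + chain_rule (radius E) j (fun u' => wfield E p j u' x)
                        (gop E (k - p)) u) k
    = even_op M c (wfield E k j u) x + odd_op N d (vfield E k j u) x.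

Definition amplitude_condition (h : R) (l : nat) (E : expansion) : Prop :=
  forall (k : nat) (j : Z) (u : grid), (k < l)%nat ->
    vfield E k j u (gridpoint h j) = (if Nat.eqb k 0 then u j else 0) /\
    wfield E k j u (gridpoint h j) = 0.

(* Coefficient of gamma^k in gamma * (sum_k gamma^k a k). *)
Definition gamma_times (a : nat -> R) (k : nat) : R :=
  match k with O => 0 | S k' => a k' end.

(* The order gamma^k part of
     y_j(x_{j+s}) = (1 - gamma) y_j(x_j) + gamma y_{j+s}(x_{j+s}),  s = 1, -1,
   for the n-th x-derivative of the family y. *)
Definition internal_bc (h : R) (l : nat) (y : nat -> Z -> grid -> R -> R)
    (n : nat) : Prop :=
  forall (k : nat) (j s : Z) (u : grid),
    (k < l)%nat -> (s = 1%Z \/ s = (-1)%Z) ->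
    let D := fun (k' : nat) (i : Z) (x : R) => Derive_n (y k' i u) n x in
    D k j (gridpoint h (j + s))
    = D k j (gridpoint h j)
      - gamma_times (fun k' => D k' j (gridpoint h j)) k
      + gamma_times (fun k' => D k' (j + s)%Z (gridpoint h (j + s))) k.

(* 2 * i is smaller than the actual order of the even operator. *)
Definition below_order (M : nat) (c : nat -> R) (i : nat) : Prop :=
  exists m : nat, (i < m <= M)%nat /\ c m <> 0.

(* For a second order operator the condition at x_{j+1}, x_{j-1} is the only
   boundary condition, and [closure] is void.  For an operator of order
   2n > 2 that condition leaves the fields, and even the evolution,
   undetermined: with partial_x^2 - partial_x^4, adding multiples of
   cosh (x - x_j) - 1 to the field v^1 makes g^1 arbitrary.  The even
   derivatives of order less than 2n are then coupled between the elements in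
   the same way as the field.  On decoupled elements the modes are then those
   of partial_x^2, namely the exp (i alpha x) with alpha h a multiple of 2 pi
   and the sin (alpha (x - x_j)) with alpha h a multiple of pi; by
   dissipativity the constants are the only neutral ones. *)
Definition closure (h : R) (l M : nat) (c : nat -> R) (E : expansion) : Prop :=
  forall i : nat, (1 <= i)%nat -> below_order M c i ->
    internal_bc h l (vfield E) (2 * i) /\ internal_bc h l (wfield E) (2 * i).

Record centre_manifold_model (h : R) (l M : nat) (c : nat -> R)
    (N : nat) (d : nat -> R) (E : expansion) : Prop := {
  cmm_regular_v : regular_family h l (radius E) (vfield E);
  cmm_regular_w : regular_family h l (radius E) (wfield E);
  cmm_neutral : forall (j : Z) (u : grid) (x : R),
    in_element h j x -> vfield E 0 j u x = u j;
  cmm_pde_gamma : pde_order_gamma h l M c E;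
  cmm_pde_eps_gamma : pde_order_eps_gamma h l M c N d E;
  cmm_amplitude : amplitude_condition h l E;
  cmm_internal_v : internal_bc h l (vfield E) 0;
  cmm_internal_w : internal_bc h l (wfield E) 0;
  cmm_closure : closure h l M c E
}.

(** * Consistency *)

(* Coefficients of partial_x^s; for a difference operator, after substituting
   E = exp (h partial_x). *)
Definition diffop_symbol (h : R) (G : diffop) (s : nat) : R :=
  list_Rsum (map (fun t => fst t * ((IZR (snd t) * h) ^ s / INR (fact s))) G).

Definition even_symbol (M : nat) (c : nat -> R) (s : nat) : R :=
  sum_n_m (fun m => if Nat.eqb s (2 * m) then c m else 0) 1 M.

Definition odd_symbol (N : nat) (d : nat -> R) (s : nat) : R :=
  sum_n_m (fun m => if Nat.eqb s (2 * m - 1) then d m else 0) 1 N.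

(* The difference model u_j' = G u_j + epsilon F u_j is consistent to
   O(partial_x^p + epsilon partial_x^q, epsilon^2). *)
Definition consistent (h : R) (M : nat) (c : nat -> R) (N : nat) (d : nat -> R)
    (G F : diffop) (p q : nat) : Prop :=
  (forall s : nat, (s < p)%nat -> diffop_symbol h G s - even_symbol M c s = 0) /\
  (forall s : nat, (s < q)%nat -> diffop_symbol h F s - odd_symbol N d s = 0).

(* Main.v *)
Require Import Defs.
From Stdlib Require Import Lra Lia FunctionalExtensionality FinFun.
From mathcomp Require all_boot all_order all_algebra complex Rstruct ring.

(** Write D for the operator with 4 sinh^2 (h D / 2) = gamma delta^2.  The field
    v = cosh (y D) u_j + gamma mu delta (sinh (y D) / sinh (h D)) u_j, y = x - x_j,
    satisfies the amplitude and internal boundary conditions, and its evolution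
    is A(D) u_j.  Its expansion in gamma has coefficients polynomial in y: they
    are the polynomials of Stirling's interpolation formula.  The order epsilon
    evolution is gamma mu delta (B(D) / sinh (h D)) u_j, with a field that is odd
    in y and vanishes at the three grid points.  At each order in gamma any two
    models differ by a solution f of A f = constant with homogeneous boundary
    conditions.  Over the reals A factors into z - a, with a >= 0 by
    dissipativity, and (z - a)^2 + b^2, where z is the second derivative; an
    energy identity for each factor gives f = 0.  The same uniqueness makes the
    boundary value problem for the epsilon field solvable.  Consistency holds
    because Stirling interpolation is exact on monomials of low degree. *)

(** * Factors of real polynomials and square linear systems *)

(** At gamma = 1 the relation defining D gives D = d/dx and mu delta = sinh (h D), so the two
    evolutions formally become A u and B u; truncation at gamma^l discards delta^(2l) and mu
    delta^(2l-1), whence the two orders of consistency. D is only a formal series in gamma delta^2,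
    so no identity in D is used as such: a generating function in z is replaced by its coefficient
    polynomials, whose index is lowered by a central difference, and identities follow from
    uniqueness for that difference equation. A model is not assumed linear in the grid values;
    comparison with one explicit linear model provides this, which is why existence is proved before
    consistency. The epsilon field need not be polynomial, because conditions on several even
    derivatives call for exponential solutions of A f = 0; only its existence matters, since it does
    not enter the evolution. The factorisation takes the place of an expansion in sines, on which A
    acts by the negative values of its symbol. *)

Fixpoint rsum (f : nat -> R) (n : nat) : R :=
  match n with O => 0 | S m => rsum f m + f m end.

Module RealPoly.
Import all_boot all_order all_algebra complex Rstruct ring.
Import Order.TTheory GRing.Theory Num.Theory.
Local Open Scope ring_scope.

(** A root a + i b exists over the complex numbers. If b is not 0, the remainder of [p] modulo (X -
    a)^2 + b^2 has degree at most one and vanishes at a + i b; its imaginary part and then its real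
    part give zero coefficients. *)
Lemma linear_or_quadratic_factor (p : {poly R}) : (1 < size p)%N ->
  exists q : {poly R},
    (exists a : R, p = q * ('X - a%:P)) \/
    (exists a b : R, b != 0 /\ p = q * (('X - a%:P) ^+ 2 + (b ^+ 2)%:P)).
Proof.
move=> sp.
have sp' : size (map_poly (real_complex R) p) != 1%N.
  by rewrite size_map_poly; case: (size p) sp => [|[|]].
have /closed_rootP [[a b] rz] := sp'.
case: (eqVneq b 0) => [b0|b0].
  have ra : root p a.
    move: rz; rewrite b0 -[Complex a 0]/(real_complex R a).
    by rewrite fmorph_root.
  have /factor_theorem [q ->] := ra.
  by exists q; left; exists a.
pose d := ('X - a%:P) ^+ 2 + (b ^+ 2)%:P : {poly R}.
have sX2 : size (('X - a%:P) ^+ 2) = 3%N.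
  by rewrite -['X - _](@divp1) divp1 size_exp_XsubC.
have sd : size d = 3%N.
  rewrite /d size_polyDl // sX2; apply: leq_ltn_trans (size_polyC_leq1 _) _ => //.
exists (divp p d); right; exists a, b; split => //.
suff r0 : modp p d = 0 by rewrite {1}(divp_eq p d) r0 addr0.
have sr : (size (modp p d) <= 2)%N by rewrite -ltnS -sd ltn_modp -size_poly_eq0 sd.
set r := modp p d in sr *.
have rd : (map_poly (real_complex R) d).[Complex a b] = 0.
  rewrite /d rmorphD rmorphXn rmorphB /= map_polyX !map_polyC /= !hornerE.
  apply/eqP; rewrite eq_complex; apply/andP; split; apply/eqP => /=; rewrite ?expr2 /=.
    by rewrite subrr subr0 mul0r sub0r addNr.
  by rewrite subrr subr0 mul0r mulr0 !addr0.
have rr : (map_poly (real_complex R) r).[Complex a b] = 0.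
  move/rootP: rz; rewrite {1}(divp_eq p d) rmorphD rmorphM /= hornerD hornerM rd mulr0 add0r.
  by [].
have rE : r = r`_1 *: 'X + (r`_0)%:P.
  apply/polyP => -[|[|i]]; rewrite !coefE /= ?mulr0 ?mulr1 ?add0r ?addr0 //.
  by rewrite nth_default // (leq_trans sr).
move: rr; rewrite {1}rE rmorphD /= map_polyZ map_polyX map_polyC /= !hornerE.
move/eqP; rewrite eq_complex => /andP [/eqP r0 /eqP]; move: r0 => /= r0.
rewrite mul0r !addr0 => /eqP; rewrite mulf_eq0 (negbTE b0) orbF => /eqP r1.
move: r0; rewrite r1 !mul0r subrr add0r => r0.
by rewrite rE r1 r0 scale0r addr0.
Qed.

(** Multiplication by X shifts a coefficient sequence, which is [gamma_times]; both kinds of factor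
    thus become relations between [c] and the quotient [c'], free of polynomials. *)
Lemma poly_coef_factor (n : nat) (c : nat -> R) :
  c n.+1 <> 0 -> (forall i, (n.+1 < i)%N -> c i = 0) ->
  exists (m : nat) (c' : nat -> R),
    c' m <> 0 /\ (forall i, (m < i)%N -> c' i = 0) /\
    ((n = m /\ exists a : R,
        forall i, c i = (gamma_times c' i - a * c' i)%R) \/
     (n = m.+1 /\ exists a b : R, b <> 0 /\
        forall i, c i = (gamma_times (gamma_times c') i
          - (a + a) * gamma_times c' i + (a * a + b * b) * c' i)%R)).
Proof.
move=> c0 cn.
pose p := \poly_(i < n.+2) c i : {poly R}.
have pE i : p`_i = c i.
  by rewrite coef_poly; case: ltnP => // /cn.
have sp : size p = n.+2 by rewrite size_poly_eq //; apply/eqP.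
have gE (q : {poly R}) i : (q * 'X)`_i = gamma_times (fun i => q`_i) i.
  by rewrite coefMX; case: i.
have [|q Hq] := @linear_or_quadratic_factor p; first by rewrite sp.
exists (size q).-1, (fun i => q`_i).
have q0 : q != 0.
  by case: (eqVneq q 0) Hq sp => // -> [[a]|[a [b [_]]]] ->; rewrite mul0r size_poly0.
have sq : size q = (size q).-1.+1 by rewrite prednK // size_poly_gt0.
split; first by apply/eqP; rewrite -/(lead_coef q) lead_coef_eq0.
split; first by move=> i; rewrite -ltnS -sq; exact: nth_default.
case: Hq => [[a Hp]|[a [b [b0 Hp]]]]; [left|right].
- split.
    by move: sp; rewrite Hp size_Mmonic ?monicXsubC // size_XsubC addn2 /= {1}sq => -[].
  exists a => i; rewrite -pE Hp mulrBr coefB gE mulrC mul_polyC coefZ.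
  by [].
- have sX2 : size (('X - a%:P) ^+ 2) = 3%N by rewrite size_exp_XsubC.
  have lt23 : (size (b ^+ 2)%:P < size (('X - a%:P) ^+ 2)%R)%N.
    by rewrite sX2; apply: leq_ltn_trans (size_polyC_leq1 _) _.
  have sd : size (('X - a%:P) ^+ 2 + (b ^+ 2)%:P) = 3%N by rewrite size_polyDl.
  have d0 : ('X - a%:P) ^+ 2 + (b ^+ 2)%:P != 0 by rewrite -size_poly_eq0 sd.
  split.
    by move: sp; rewrite Hp size_mul // sd addn3 /= {1}sq => -[].
  exists a, b; split; first exact/eqP.
  move=> i; rewrite -pE Hp.
  have -> : q * (('X - a%:P) ^+ 2 + (b ^+ 2)%:P) =
     q * 'X * 'X - (a + a)%:P * (q * 'X) + (a * a + b * b)%:P * q.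
    rewrite !(polyCD, polyCM) !expr2. ring.
  rewrite coefD coefB !mul_polyC !coefZ gE.
  have -> : gamma_times (fun i => (q * 'X)`_i) i = gamma_times (gamma_times (fun i => q`_i)) i.
    by case: i => //= i; rewrite gE.
  by rewrite gE.
Qed.

Lemma rsumE (f : nat -> R) n : rsum f n = \sum_(i < n) f i.
Proof. by elim: n => [|n IH] /=; rewrite ?big_ord0 // big_ord_recr IH. Qed.

(** A matrix with trivial left kernel is row free, hence invertible. Row vectors are extended by
    zero to functions on [nat]. *)
Lemma square_system (n : nat) (M : nat -> nat -> R) :
  (forall x : nat -> R,
     (forall j, (j < n)%N -> rsum (fun i => x i * M i j) n = 0) ->
     forall i, (i < n)%N -> x i = 0) ->
  forall b : nat -> R, exists x : nat -> R,
    forall j, (j < n)%N -> rsum (fun i => x i * M i j) n = b j.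
Proof.
move=> inj b.
pose A := \matrix_(i < n, j < n) M i j : 'M[R]_n.
pose ext (v : 'rV[R]_n) (i : nat) : R := if insub i is Some k then v 0 k else 0.
have extE v (j : 'I_n) : rsum (fun i => ext v i * M i j) n = (v *m A) 0 j.
  rewrite mxE rsumE; apply: eq_bigr => i _; rewrite !mxE /ext.
  by rewrite valK.
have uA : A \in unitmx.
  rewrite -row_free_unit; apply: inj_row_free => v vA.
  have vE (k : 'I_n) : ext v k = v 0 k by rewrite /ext valK.
  apply/rowP => k; rewrite mxE -vE; apply: inj (ltn_ord k) => j jn.
  by rewrite (extE _ (Ordinal jn)) vA mxE.
exists (ext (\row_j b j *m invmx A)) => j jn.
by rewrite (extE _ (Ordinal jn)) mulmxKV // mxE.
Qed.
End RealPoly.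

Lemma real_poly_factor (n : nat) (c : nat -> R) :
  c (S n) <> 0 -> (forall i, (S n < i)%nat -> c i = 0) ->
  exists (m : nat) (c' : nat -> R),
    c' m <> 0 /\ (forall i, (m < i)%nat -> c' i = 0) /\
    ((n = m /\ exists a : R,
        forall i, c i = gamma_times c' i - a * c' i) \/
     (n = S m /\ exists a b : R, b <> 0 /\
        forall i, c i = gamma_times (gamma_times c') i
          - (a + a) * gamma_times c' i + (a * a + b * b) * c' i)).
Proof.
intros c0 cn.
apply RealPoly.poly_coef_factor in c0.
- destruct c0 as (m & c' & Hm & Hc' & Hf).
  exists m, c'; split; [exact Hm|split].
  + intros i Hi; apply Hc'; now apply (ssrbool.introT ssrnat.ltP).
  + destruct Hf as [[E [a Ha]]|[E [a [b [Hb Hab]]]]]; [left|right]; (split; [exact E|]).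
    * exists a; exact Ha.
    * exists a, b; split; [exact Hb|exact Hab].
- intros i Hi; apply cn; now apply (ssrbool.elimT ssrnat.ltP).
Qed.

Lemma square_system_surjective (n : nat) (M : nat -> nat -> R) :
  (forall x : nat -> R,
     (forall j, (j < n)%nat -> rsum (fun i => x i * M i j) n = 0) ->
     forall i, (i < n)%nat -> x i = 0) ->
  forall b : nat -> R, exists x : nat -> R,
    forall j, (j < n)%nat -> rsum (fun i => x i * M i j) n = b j.
Proof.
intros inj b.
destruct (RealPoly.square_system n M) with (b := b) as [x Hx].
- intros x Hx i Hi; apply inj.
  + intros j Hj; apply Hx; now apply (ssrbool.introT ssrnat.ltP).
  + now apply (ssrbool.elimT ssrnat.ltP).
- exists x; intros j Hj; apply Hx; now apply (ssrbool.introT ssrnat.ltP).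
Qed.

(** * Finite sums and derivatives on an interval *)

Lemma rsum_ext (f g : nat -> R) (n : nat) :
  (forall i, (i < n)%nat -> f i = g i) -> rsum f n = rsum g n.
Proof.
induction n as [|n IH]; simpl; intros H; [reflexivity|].
rewrite IH, (H n); auto.
Qed.

Lemma rsum_plus (f g : nat -> R) (n : nat) :
  rsum (fun i => f i + g i) n = rsum f n + rsum g n.
Proof. induction n as [|n IH]; simpl; [|rewrite IH]; ring. Qed.

Lemma rsum_minus (f g : nat -> R) (n : nat) :
  rsum (fun i => f i - g i) n = rsum f n - rsum g n.
Proof. induction n as [|n IH]; simpl; [|rewrite IH]; ring. Qed.

Lemma rsum_scal (a : R) (f : nat -> R) (n : nat) :
  rsum (fun i => a * f i) n = a * rsum f n.
Proof. induction n as [|n IH]; simpl; [|rewrite IH]; ring. Qed.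

Lemma rsum_eq0 (f : nat -> R) (n : nat) :
  (forall i, (i < n)%nat -> f i = 0) -> rsum f n = 0.
Proof.
intros H; induction n as [|n IH]; simpl; [reflexivity|].
rewrite IH, (H n); auto; ring.
Qed.

Lemma rsum_head (f : nat -> R) (n : nat) :
  rsum f (S n) = f O + rsum (fun i => f (S i)) n.
Proof.
induction n as [|n IH]; [simpl; ring|].
change (rsum f (S n) + f (S n) = f O + (rsum (fun i => f (S i)) n + f (S n))).
rewrite IH; ring.
Qed.

Lemma rsum_swap (f : nat -> nat -> R) (m n : nat) :
  rsum (fun i => rsum (f i) n) m = rsum (fun j => rsum (fun i => f i j) m) n.
Proof.
induction m as [|m IH]; simpl.
- symmetry; now apply rsum_eq0.
- now rewrite IH, <- rsum_plus.
Qed.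

Lemma rsum_gamma_times (c f : nat -> R) (n : nat) :
  rsum (fun i => gamma_times c i * f i) (S n) = rsum (fun i => c i * f (S i)) n.
Proof. rewrite rsum_head; simpl; ring. Qed.

Lemma sum_n_rsum (f : nat -> R) (n : nat) : sum_n f n = rsum f (S n).
Proof.
induction n as [|n IH].
- rewrite sum_O; simpl; ring.
- rewrite sum_Sn, IH; reflexivity.
Qed.

Lemma sum_n_m_rsum (f : nat -> R) (n : nat) :
  sum_n_m f 1 n = rsum (fun i => f (S i)) n.
Proof.
induction n as [|n IH].
- rewrite sum_n_m_zero; [reflexivity|lia].
- rewrite sum_n_Sm, IH; [reflexivity|lia].
Qed.

Lemma is_derive_eq (f : R -> R) (x l l' : R) :
  is_derive f x l -> l = l' -> is_derive f x l'.
Proof. now intros H <-. Qed.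

Lemma is_derive_rsum (f f' : nat -> R -> R) (n : nat) (x : R) :
  (forall i, (i < n)%nat -> is_derive (f i) x (f' i x)) ->
  is_derive (fun y => rsum (fun i => f i y) n) x (rsum (fun i => f' i x) n).
Proof.
intros H; induction n as [|n IH]; simpl.
- apply (is_derive_const 0).
- apply (is_derive_plus (V := R_NormedModule)); auto.
Qed.

(** The derivative is two-sided, so it may be tested on increments that point into the interval;
    this includes the end points. *)
Lemma is_derive_zero_on (f : R -> R) (a b x l : R) :
  a < b -> a <= x <= b -> (forall y, a <= y <= b -> f y = 0) ->
  is_derive f x l -> l = 0.
Proof.
intros ab Hx f0 Hd; apply is_derive_Reals in Hd.
apply cond_eq; intros eps He.
destruct (Hd eps He) as [del Hdel].
assert (Hp := cond_pos del).
assert (exists t, t <> 0 /\ Rabs t < del /\ a <= x + t <= b) as (t & t0 & td & tab).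
{ set (m := Rmin (del / 2) ((b - a) / 2)).
  assert (m <= del / 2) by apply Rmin_l.
  assert (m <= (b - a) / 2) by apply Rmin_r.
  assert (0 < m) by (apply Rmin_glb_lt; lra).
  destruct (Rle_dec x ((a + b) / 2)).
  - exists m; rewrite Rabs_pos_eq; repeat split; lra.
  - exists (- m); rewrite Rabs_Ropp, Rabs_pos_eq; repeat split; lra. }
specialize (Hdel t t0 td).
rewrite f0, f0 in Hdel by lra.
replace ((0 - 0) / t - l) with (- (l - 0)) in Hdel by (field; auto).
now rewrite Rabs_Ropp in Hdel.
Qed.

(** [E] is monotone with equal end values, hence constant. An energy identity thereby gives a
    pointwise conclusion without any integration. *)
Lemma derive_nonneg_eq_ends (E dE : R -> R) (a b : R) :
  a < b -> (forall x, a <= x <= b -> is_derive E x (dE x)) ->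
  (forall x, a <= x <= b -> 0 <= dE x) -> E a = E b ->
  forall x, a <= x <= b -> dE x = 0.
Proof.
intros ab Hd Hpos Hab.
assert (mono : forall x y, a <= x -> x <= y -> y <= b -> E x <= E y).
{ intros x y ax xy yb.
  destruct (MVT_gen E x y dE) as (z & Hz & Ez).
  - intros z Hz; rewrite Rmin_left, Rmax_right in Hz by lra; apply Hd; lra.
  - intros z Hz; rewrite Rmin_left, Rmax_right in Hz by lra.
    apply derivable_continuous_pt; exists (dE z).
    apply is_derive_Reals, Hd; lra.
  - rewrite Rmin_left, Rmax_right in Hz by lra.
    assert (0 <= dE z * (y - x)) by (apply Rmult_le_pos; [apply Hpos|]; lra).
    lra. }
intros x Hx.
apply (is_derive_zero_on (fun y => E y - E a) a b x); auto.
- intros y Hy.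
  assert (E a <= E y) by (apply mono; lra).
  assert (E y <= E b) by (apply mono; lra).
  lra.
- apply is_derive_eq with (dE x - 0); [|ring].
  apply (is_derive_minus (V := R_NormedModule)); [apply Hd; lra|apply (is_derive_const (E a))].
Qed.

Lemma derive_zero_const (f f' : R -> R) (a b : R) :
  (forall x, a <= x <= b -> is_derive f x (f' x)) ->
  (forall x, a <= x <= b -> f' x = 0) ->
  forall x, a <= x <= b -> f x = f a.
Proof.
intros Hd H0 x Hx.
destruct (MVT_gen f a x f') as (z & Hz & Ez).
- intros z Hz; rewrite Rmin_left, Rmax_right in Hz by lra; apply Hd; lra.
- intros z Hz; rewrite Rmin_left, Rmax_right in Hz by lra.
  apply derivable_continuous_pt; exists (f' z).
  apply is_derive_Reals, Hd; lra.
- rewrite Rmin_left, Rmax_right in Hz by lra.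
  rewrite H0 in Ez by lra; lra.
Qed.

(** * Towers of derivatives *)

(* Derive_n only sees the values of a function in a full neighbourhood, which
   is useless at the end points of an interval; a tower lists the derivatives. *)
Definition tower (D : R -> Prop) (phi : nat -> R -> R) : Prop :=
  forall (i : nat) (x : R), D x -> is_derive (phi i) x (phi (S i) x).

Definition between (a b x : R) : Prop := a <= x <= b.

Lemma tower_comb (D : R -> Prop) (a b : R) (phi psi : nat -> R -> R) :
  tower D phi -> tower D psi ->
  tower D (fun i x => a * phi i x + b * psi i x).
Proof.
intros Hf Hg i x Hx.
apply (is_derive_plus (V := R_NormedModule)); apply is_derive_scal; auto.
Qed.

Lemma tower_drop (D : R -> Prop) (k : nat) (phi : nat -> R -> R) :
  tower D phi -> tower D (fun i x => phi (i + k)%nat x).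
Proof. intros Hf i x Hx; apply (Hf (i + k)%nat x Hx). Qed.

Lemma is_derive_affine (f : R -> R) (a b x l : R) :
  is_derive f (a * x + b) l -> is_derive (fun y => f (a * y + b)) x (a * l).
Proof.
intros H.
apply is_derive_eq with (scal a l); [|reflexivity].
apply (is_derive_comp f (fun y => a * y + b)); [exact H|].
auto_derive; [auto|ring].
Qed.

Lemma tower_affine (D D' : R -> Prop) (a b : R) (phi : nat -> R -> R) :
  tower D phi -> (forall x, D' x -> D (a * x + b)) ->
  tower D' (fun i x => a ^ i * phi i (a * x + b)).
Proof.
intros H DD i x Hx.
apply is_derive_eq with (a ^ i * (a * phi (S i) (a * x + b))); [|simpl; ring].
apply is_derive_scal, is_derive_affine, H, DD, Hx.
Qed.

Lemma tower_zero_on (a b : R) (phi : nat -> R -> R) :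
  a < b -> tower (between a b) phi ->
  (forall x, between a b x -> phi O x = 0) ->
  forall i x, between a b x -> phi i x = 0.
Proof.
intros ab Ht H0; induction i as [|i IH]; [exact H0|intros x Hx].
apply (is_derive_zero_on (phi i) a b x); auto.
Qed.

(** * Boundary value problems on one element *)

Definition even_comb (n : nat) (c : nat -> R) (phi : nat -> R -> R) (x : R) : R :=
  rsum (fun m => c m * phi (2 * m)%nat x) n.

(* Energy: (phi phi')' = phi'^2 + a phi^2, and phi phi' vanishes at both ends. *)
Lemma dirichlet_linear_factor (h a : R) (phi : nat -> R -> R) :
  0 < h -> 0 <= a -> tower (between 0 h) phi -> phi O 0 = 0 -> phi O h = 0 ->
  (forall x, between 0 h x -> phi 2%nat x = a * phi O x) ->
  forall x, between 0 h x -> phi O x = 0.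
Proof.
intros hp ap Ht H0 Hh Heq.
assert (D1 : forall x, 0 <= x <= h -> phi 1%nat x * phi 1%nat x + a * (phi O x * phi O x) = 0).
{ apply (derive_nonneg_eq_ends (fun x => phi O x * phi 1%nat x)); auto.
  - intros x Hx.
    apply is_derive_eq with (phi 1%nat x * phi 1%nat x + phi O x * phi 2%nat x).
    + apply (is_derive_mult (phi O) (phi 1%nat)); [apply Ht; auto|apply Ht; auto|].
      intros; apply Rmult_comm.
    + rewrite Heq by exact Hx; ring.
  - intros x Hx; apply Rplus_le_le_0_compat; [apply Rle_0_sqr|].
    apply Rmult_le_pos; [auto|apply Rle_0_sqr].
  - rewrite H0, Hh; ring. }
intros x Hx; rewrite <- H0.
apply (derive_zero_const (phi O) (phi 1%nat) 0 h); [intros; apply Ht; auto| |exact Hx].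
intros y Hy; specialize (D1 y Hy).
assert (0 <= a * (phi O y * phi O y)) by (apply Rmult_le_pos; [auto|apply Rle_0_sqr]).
nra.
Qed.

(* Energy: with chi = phi'' - a phi, (phi' chi - phi chi')' = b^2 phi^2 + chi^2. *)
Lemma dirichlet_quadratic_factor (h a b : R) (phi : nat -> R -> R) :
  0 < h -> b <> 0 -> tower (between 0 h) phi ->
  phi O 0 = 0 -> phi O h = 0 -> phi 2%nat 0 = 0 -> phi 2%nat h = 0 ->
  (forall x, between 0 h x ->
     phi 4%nat x - (a + a) * phi 2%nat x + (a * a + b * b) * phi O x = 0) ->
  forall x, between 0 h x -> phi O x = 0.
Proof.
intros hp bn Ht H0 Hh H20 H2h Heq.
set (chi := fun i x => 1 * phi (i + 2)%nat x + (- a) * phi i x).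
assert (Hc : tower (between 0 h) chi).
{ apply tower_comb; [apply tower_drop|]; exact Ht. }
assert (D : forall x, 0 <= x <= h ->
   (b * phi O x) * (b * phi O x) + chi O x * chi O x = 0).
{ apply (derive_nonneg_eq_ends
    (fun x => phi 1%nat x * chi O x - phi O x * chi 1%nat x)); auto.
  - intros x Hx.
    apply is_derive_eq with
      ((phi 2%nat x * chi O x + phi 1%nat x * chi 1%nat x)
       - (phi 1%nat x * chi 1%nat x + phi O x * chi 2%nat x)).
    + apply (is_derive_minus (V := R_NormedModule)).
      * apply (is_derive_mult (phi 1%nat) (chi O)); [apply Ht|apply Hc|]; auto.
        intros; apply Rmult_comm.
      * apply (is_derive_mult (phi O) (chi 1%nat)); [apply Ht|apply Hc|]; auto.
        intros; apply Rmult_comm.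
    + specialize (Heq x Hx); unfold chi; simpl.
      replace (phi 4%nat x) with
        ((a + a) * phi 2%nat x - (a * a + b * b) * phi O x) by lra.
      ring.
  - intros x Hx; apply Rplus_le_le_0_compat; apply Rle_0_sqr.
  - unfold chi; simpl; rewrite H0, Hh, H20, H2h; ring. }
intros x Hx; specialize (D x Hx).
assert (b * phi O x = 0) by nra.
destruct (Rmult_integral _ _ H); [contradiction|assumption].
Qed.

(** Navier conditions prescribe the even derivatives at both ends, so they survive the application
    of one factor. The image [psi] of [phi] under that factor solves the problem for the quotient
    [c'] and is 0 by induction; the energy lemma of the factor then gives [phi] = 0. The absence of
    negative roots passes to the quotient and forces a >= 0 in a linear factor. *)
Lemma navier_unique (h : R) : 0 < h -> forall (n : nat) (c : nat -> R),
  c n <> 0 -> (forall i, (n < i)%nat -> c i = 0) ->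
  (forall a, a < 0 -> rsum (fun i => c i * a ^ i) (S n) <> 0) ->
  forall phi, tower (between 0 h) phi ->
  (forall i, (i < n)%nat -> phi (2 * i)%nat 0 = 0 /\ phi (2 * i)%nat h = 0) ->
  (forall x, between 0 h x -> even_comb (S n) c phi x = 0) ->
  forall x, between 0 h x -> phi O x = 0.
Proof.
intros hp n; induction n as [n IH] using (well_founded_induction Wf_nat.lt_wf).
intros c cn c0 croot phi Ht Hbc Heq.
destruct n as [|n].
{ intros x Hx; specialize (Heq x Hx); unfold even_comb in Heq; simpl in Heq.
  rewrite Rplus_0_l in Heq.
  destruct (Rmult_integral _ _ Heq); [contradiction|assumption]. }
destruct (real_poly_factor n c cn c0) as (m & c' & c'm & c'0 & [[-> [a Ha]]|[-> [a [b [bn Hab]]]]]).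
(* Stated for any sequence [f]: powers of a number give the factored polynomial, the even
   derivatives of [phi] give the factored operator. *)
- assert (split : forall f : nat -> R, rsum (fun i => c i * f i) (S (S m))
             = rsum (fun i => c' i * (f (S i) - a * f i)) (S m)).
  { intros f.
    rewrite (rsum_ext _ (fun i => gamma_times c' i * f i - a * (c' i * f i)))
      by (intros; rewrite Ha; ring).
    rewrite rsum_minus, rsum_gamma_times, rsum_scal.
    change (rsum (fun i => c' i * f i) (S (S m))) with
      (rsum (fun i => c' i * f i) (S m) + c' (S m) * f (S m)).
    rewrite (c'0 (S m)) by lia.
    rewrite (rsum_ext (fun i => c' i * (f (S i) - a * f i))
               (fun i => c' i * f (S i) - a * (c' i * f i))) by (intros; ring).
    rewrite rsum_minus, rsum_scal; ring. }
  assert (a0 : 0 <= a).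
  { apply Rnot_lt_le; intros an; apply (croot a an).
    rewrite split; apply rsum_eq0; intros; simpl; ring. }
  set (psi := fun i x => 1 * phi (i + 2)%nat x + (- a) * phi i x).
  assert (Hp : tower (between 0 h) psi).
  { apply tower_comb; [apply tower_drop|]; exact Ht. }
  assert (psi0 : forall x, between 0 h x -> psi O x = 0).
  { apply (IH m ltac:(lia) c' c'm c'0); auto.
    - intros al Hal Z; apply (croot al Hal); rewrite split.
      rewrite (rsum_ext _ (fun i => (al - a) * (c' i * al ^ i)))
        by (intros; simpl; ring).
      rewrite rsum_scal, Z; ring.
    - intros i Hi; unfold psi.
      destruct (Hbc i ltac:(lia)) as [-> ->].
      replace (2 * i + 2)%nat with (2 * S i)%nat by lia.
      destruct (Hbc (S i) ltac:(lia)) as [-> ->]; lra.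
    - intros x Hx; rewrite <- (Heq x Hx); unfold even_comb.
      rewrite (split (fun i => phi (2 * i)%nat x)).
      apply rsum_ext; intros i _; unfold psi.
      replace (2 * i + 2)%nat with (2 * S i)%nat by lia; ring. }
  destruct (Hbc O ltac:(lia)) as [H0 Hh]; simpl in H0, Hh.
  apply (dirichlet_linear_factor h a); auto.
  intros x Hx; specialize (psi0 x Hx); unfold psi in psi0; simpl in psi0; lra.
- assert (split : forall f : nat -> R, rsum (fun i => c i * f i) (S (S (S m)))
     = rsum (fun i => c' i * (f (S (S i)) - (a + a) * f (S i)
                               + (a * a + b * b) * f i)) (S m)).
  { intros f.
    rewrite (rsum_ext _ (fun i => gamma_times (gamma_times c') i * f i
       - (a + a) * (gamma_times c' i * f i) + (a * a + b * b) * (c' i * f i)))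
      by (intros; rewrite Hab; ring).
    rewrite rsum_plus, rsum_minus, !rsum_scal, !rsum_gamma_times.
    change (rsum (fun i => c' i * f i) (S (S (S m)))) with
      (rsum (fun i => c' i * f i) (S m) + c' (S m) * f (S m)
         + c' (S (S m)) * f (S (S m))).
    change (rsum (fun i => c' i * f (S i)) (S (S m))) with
      (rsum (fun i => c' i * f (S i)) (S m) + c' (S m) * f (S (S m))).
    rewrite (c'0 (S m)), (c'0 (S (S m))) by lia.
    rewrite (rsum_ext (fun i => c' i * (f (S (S i)) - (a + a) * f (S i)
                               + (a * a + b * b) * f i))
               (fun i => c' i * f (S (S i)) - (a + a) * (c' i * f (S i))
                  + (a * a + b * b) * (c' i * f i))) by (intros; ring).
    rewrite rsum_plus, rsum_minus, !rsum_scal; ring. }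
  set (psi := fun i x => 1 * (1 * phi (i + 4)%nat x + (- (a + a)) * phi (i + 2)%nat x)
                 + (a * a + b * b) * phi i x).
  assert (Hp : tower (between 0 h) psi).
  { apply (tower_comb _ 1 _ (fun i x => 1 * phi (i + 4)%nat x + (- (a + a)) * phi (i + 2)%nat x));
      [apply tower_comb; apply tower_drop|]; exact Ht. }
  assert (psi0 : forall x, between 0 h x -> psi O x = 0).
  { apply (IH m ltac:(lia) c' c'm c'0); auto.
    - intros al Hal Z; apply (croot al Hal); rewrite split.
      rewrite (rsum_ext _ (fun i => (al * al - (a + a) * al + (a * a + b * b)) * (c' i * al ^ i)))
        by (intros; simpl; ring).
      rewrite rsum_scal, Z; ring.
    - intros i Hi; unfold psi.
      destruct (Hbc i ltac:(lia)) as [-> ->].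
      replace (2 * i + 2)%nat with (2 * S i)%nat by lia.
      replace (2 * i + 4)%nat with (2 * S (S i))%nat by lia.
      destruct (Hbc (S i) ltac:(lia)) as [-> ->].
      destruct (Hbc (S (S i)) ltac:(lia)) as [-> ->]; lra.
    - intros x Hx; rewrite <- (Heq x Hx); unfold even_comb.
      rewrite (split (fun i => phi (2 * i)%nat x)).
      apply rsum_ext; intros i _; unfold psi.
      replace (2 * i + 2)%nat with (2 * S i)%nat by lia.
      replace (2 * i + 4)%nat with (2 * S (S i))%nat by lia; ring. }
  destruct (Hbc O ltac:(lia)) as [H0 Hh]; simpl in H0, Hh.
  destruct (Hbc 1%nat ltac:(lia)) as [H20 H2h]; simpl in H20, H2h.
  apply (dirichlet_quadratic_factor h a b); auto.
  intros x Hx; specialize (psi0 x Hx); unfold psi in psi0; simpl in psi0; lra.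
Qed.

Lemma even_comb_lin (n : nat) (c : nat -> R) (a b : R) (phi psi : nat -> R -> R) (x y : R) :
  rsum (fun m => c m * (a * phi (2 * m)%nat x + b * psi (2 * m)%nat y)) n
  = a * even_comb n c phi x + b * even_comb n c psi y.
Proof.
unfold even_comb; rewrite <- !rsum_scal, <- rsum_plus.
apply rsum_ext; intros; ring.
Qed.

(* The odd part of phi vanishes by [navier_unique].  So does e x - e (h - x) for
   the even part e; then the odd derivatives of e vanish at 0 and at h, and
   [navier_unique] applies to e'. *)
Lemma element_unique (h : R) (n : nat) (c : nat -> R) (phi : nat -> R -> R) (g : R) :
  0 < h -> c n <> 0 -> (forall i, (n < i)%nat -> c i = 0) ->
  (forall a, a < 0 -> rsum (fun i => c i * a ^ i) (S n) <> 0) ->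
  tower (between (- h) h) phi -> phi O 0 = 0 ->
  (forall i, (i < n)%nat ->
     phi (2 * i)%nat h = phi (2 * i)%nat 0 /\ phi (2 * i)%nat (- h) = phi (2 * i)%nat 0) ->
  (forall x, between (- h) h x -> even_comb (S n) c phi x = g) ->
  (forall i x, between (- h) h x -> phi i x = 0) /\ g = 0.
Proof.
intros hp cn c0 croot Ht H0 Hbc Heq.
assert (Hneg : tower (between (- h) h) (fun i x => (-1) ^ i * phi i (-1 * x + 0))).
{ apply (tower_affine (between (- h) h)); [exact Ht|unfold between; intros; lra]. }
assert (sub : forall x, between 0 h x -> between (- h) h x) by (unfold between; intros; lra).
assert (negE : forall x, -1 * x + 0 = - x) by (intros; ring).
set (o := fun i x => 1 * phi i x + (-1) * ((-1) ^ i * phi i (-1 * x + 0))).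
set (e := fun i x => 1 * phi i x + 1 * ((-1) ^ i * phi i (-1 * x + 0))).
assert (Ho : tower (between (- h) h) o) by (apply tower_comb; assumption).
assert (He : tower (between (- h) h) e) by (apply tower_comb; assumption).
assert (oE : forall m x, o (2 * m)%nat x = 1 * phi (2 * m)%nat x + (-1) * phi (2 * m)%nat (- x)).
{ intros m x; unfold o; rewrite pow_1_even, negE; ring. }
assert (eE : forall m x, e (2 * m)%nat x = 1 * phi (2 * m)%nat x + 1 * phi (2 * m)%nat (- x)).
{ intros m x; unfold e; rewrite pow_1_even, negE; ring. }
assert (eh : forall i, (i < n)%nat -> e (2 * i)%nat h = e (2 * i)%nat 0).
{ intros i Hi; rewrite !eE, Ropp_0; destruct (Hbc i Hi) as [-> ->]; ring. }
assert (Ae : forall x, between (- h) h x -> even_comb (S n) c e x = 2 * g).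
{ intros x Hx; unfold even_comb.
  rewrite (rsum_ext _ _ _ (fun m _ => f_equal (Rmult (c m)) (eE m x))).
  rewrite even_comb_lin, !Heq by (unfold between in *; lra); ring. }
assert (o0 : forall x, between 0 h x -> o O x = 0).
{ apply (navier_unique h hp n c cn c0 croot).
  - intros i x Hx; apply Ho, sub, Hx.
  - intros i Hi; rewrite !oE, Ropp_0; destruct (Hbc i Hi) as [-> ->]; lra.
  - intros x Hx; unfold even_comb.
    rewrite (rsum_ext _ _ _ (fun m _ => f_equal (Rmult (c m)) (oE m x))).
    rewrite even_comb_lin, !Heq by (unfold between in *; lra); ring. }
set (q := fun i x => 1 * e i x + (-1) * ((-1) ^ i * e i (-1 * x + h))).
assert (Hq : tower (between 0 h) q).
{ apply tower_comb; [intros i x Hx; apply He, sub, Hx|].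
  apply (tower_affine (between (- h) h)); [exact He|unfold between; intros; lra]. }
assert (qE : forall m x, q (2 * m)%nat x = 1 * e (2 * m)%nat x + (-1) * e (2 * m)%nat (-1 * x + h)).
{ intros m x; unfold q; rewrite pow_1_even; ring. }
assert (q0 : forall x, between 0 h x -> q O x = 0).
{ apply (navier_unique h hp n c cn c0 croot); [exact Hq| |].
  - intros i Hi; rewrite !qE.
    replace (-1 * 0 + h) with h by ring; replace (-1 * h + h) with 0 by ring.
    rewrite (eh i Hi); lra.
  - intros x Hx; unfold even_comb.
    rewrite (rsum_ext _ _ _ (fun m _ => f_equal (Rmult (c m)) (qE m x))).
    rewrite even_comb_lin, !Ae by (unfold between in *; lra); ring. }
assert (eodd : forall i, e (2 * i + 1)%nat 0 = 0 /\ e (2 * i + 1)%nat h = 0).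
{ intros i.
  assert (E0 : e (2 * i + 1)%nat 0 = 0).
  { unfold e; rewrite pow_add, pow_1_even; replace (-1 * 0 + 0) with 0 by ring; ring. }
  split; [exact E0|].
  assert (Q := tower_zero_on 0 h q hp Hq q0 (2 * i + 1)%nat 0 ltac:(unfold between; lra)).
  unfold q in Q; rewrite pow_add, pow_1_even, E0 in Q.
  replace (-1 * 0 + h) with h in Q by ring; lra. }
(* Differentiation removes the unknown constant [g], at the price of turning even derivatives at the
   ends into odd ones. *)
assert (e1 : forall x, between 0 h x -> e 1%nat x = 0).
{ apply (navier_unique h hp n c cn c0 croot (fun i x => e (i + 1)%nat x)).
  - intros i x Hx; apply He, sub, Hx.
  - intros i _; apply eodd.
  - intros x Hx; unfold even_comb.
    assert (D := is_derive_rsum (fun m y => c m * e (2 * m)%nat y)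
                   (fun m y => c m * e (2 * m + 1)%nat y) (S n) x).
    apply (is_derive_zero_on (fun y => even_comb (S n) c e y - 2 * g) 0 h x); auto.
    + intros y Hy; rewrite Ae by auto; ring.
    + eapply is_derive_eq.
      * apply (is_derive_minus (V := R_NormedModule)); [|apply is_derive_const].
        apply D; intros m _; apply is_derive_scal.
        replace (2 * m + 1)%nat with (S (2 * m)) by lia; apply He; auto.
      * unfold minus, plus, opp, zero; simpl; ring. }
assert (e0 : forall x, between 0 h x -> e O x = 0).
{ intros x Hx.
  rewrite (derive_zero_const (e O) (e 1%nat) 0 h); auto.
  - unfold e; replace (-1 * 0 + 0) with 0 by ring; rewrite H0; ring. }
assert (p0 : forall x, between (- h) h x -> phi O x = 0).
{ intros x Hx.
  destruct (Rle_dec 0 x) as [xp|xn].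
  - assert (X : between 0 h x) by (unfold between in *; lra).
    specialize (o0 x X); specialize (e0 x X); unfold o, e in *; simpl in *; lra.
  - assert (X : between 0 h (- x)) by (unfold between in *; lra).
    specialize (o0 _ X); specialize (e0 _ X); unfold o, e in *; simpl in *.
    replace (-1 * - x + 0) with x in * by ring; lra. }
assert (pall := tower_zero_on (- h) h phi ltac:(lra) Ht p0).
split; [exact pall|].
rewrite <- (Heq 0) by (unfold between; lra).
apply rsum_eq0; intros; rewrite pall by (unfold between; lra); ring.
Qed.

(** * Exponential power series *)

(** Geometric growth makes [egf] entire. With [1 <= K] the bounds increase with the index, so that
    entries of different indices can be compared. *)
Definition exp_bounded (w : nat -> R) : Prop :=
  exists C K : R, 0 <= C /\ 1 <= K /\ forall n, Rabs (w n) <= C * K ^ n.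

(** The exponential generating function of [w], differentiated [i] times; differentiation is a shift
    of the sequence. *)
Definition egf (w : nat -> R) (i : nat) (x : R) : R :=
  PSeries (fun n => w (n + i)%nat / INR (fact n)) x.

Lemma exp_bounded_comb (a b : R) (w w' : nat -> R) :
  exp_bounded w -> exp_bounded w' -> exp_bounded (fun n => a * w n + b * w' n).
Proof.
intros (C & K & C0 & K1 & H) (C' & K' & C0' & K1' & H').
exists (Rabs a * C + Rabs b * C'), (Rmax K K').
assert (Ra := Rabs_pos a); assert (Rb := Rabs_pos b).
assert (KM := Rmax_l K K'); assert (KM' := Rmax_r K K').
split; [nra|split; [lra|intros n]].
assert (P1 : K ^ n <= Rmax K K' ^ n) by (apply pow_incr; lra).
assert (P2 : K' ^ n <= Rmax K K' ^ n) by (apply pow_incr; lra).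
assert (Q1 : 0 <= K ^ n) by (apply pow_le; lra).
assert (Q2 : 0 <= K' ^ n) by (apply pow_le; lra).
eapply Rle_trans; [apply Rabs_triang|]; rewrite !Rabs_mult.
specialize (H n); specialize (H' n).
assert (Rabs (w n) <= C * Rmax K K' ^ n) by nra.
assert (Rabs (w' n) <= C' * Rmax K K' ^ n) by nra.
nra.
Qed.

Lemma exp_bounded_drop (k : nat) (w : nat -> R) :
  exp_bounded w -> exp_bounded (fun n => w (n + k)%nat).
Proof.
intros (C & K & C0 & K1 & H); exists (C * K ^ k), K.
assert (0 <= K ^ k) by (apply pow_le; lra).
split; [nra|split; [lra|intros n]].
eapply Rle_trans; [apply H|]; rewrite pow_add; lra.
Qed.

Lemma exp_bounded_rsum (w : nat -> nat -> R) (c : nat -> R) (n : nat) :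
  (forall k, (k < n)%nat -> exp_bounded (w k)) ->
  exp_bounded (fun i => rsum (fun k => c k * w k i) n).
Proof.
induction n as [|n IH]; simpl; intros H.
- exists 0, 1; split; [lra|split; [lra|]]; intros; rewrite Rabs_R0, Rmult_0_l; lra.
- destruct (exp_bounded_comb 1 (c n) (fun i => rsum (fun k => c k * w k i) n) (w n))
    as (C & K & C0 & K1 & HH); auto.
  exists C, K; repeat split; auto; intros i.
  specialize (HH i); now rewrite Rmult_1_l in HH.
Qed.

(** At radius r the n-th term is at most C (K r)^n / n!, one term of the series of C exp (K r);
    every radius is therefore admissible. *)
Lemma CV_radius_egf (w : nat -> R) :
  exp_bounded w -> CV_radius (fun n => w n / INR (fact n)) = p_infty.
Proof.
intros (C & K & C0 & K1 & H).
destruct (CV_radius_bounded (fun n => w n / INR (fact n))) as [ub _].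
assert (B : forall r, 0 <= r -> Rbar_le r (CV_radius (fun n => w n / INR (fact n)))).
{ intros r r0; apply ub; exists (C * exp (K * r)); intros n.
  assert (fp := INR_fact_lt_0 n).
  assert (Kr : 0 <= K * r) by nra.
  assert (E := exp_ge_taylor (K * r) n Kr).
  assert (T : (K * r) ^ n / INR (fact n) <= exp (K * r)).
  { eapply Rle_trans; [|exact E].
    destruct n as [|n]; [simpl; lra|rewrite tech5].
    assert (0 <= sum_f_R0 (fun k => (K * r) ^ k / INR (fact k)) n); [|lra].
    apply cond_pos_sum; intros m; apply Rdiv_le_0_compat;
      [apply pow_le; lra|apply INR_fact_lt_0]. }
  rewrite Rabs_mult; unfold Rdiv; rewrite Rabs_mult.
  rewrite (Rabs_pos_eq (/ _)) by (left; apply Rinv_0_lt_compat; auto).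
  rewrite (Rabs_pos_eq (r ^ n)) by (apply pow_le; auto).
  apply Rle_trans with (C * ((K * r) ^ n / INR (fact n))); [|apply Rmult_le_compat_l; auto].
  rewrite Rpow_mult_distr.
  assert (0 <= r ^ n) by (apply pow_le; auto).
  assert (0 <= / INR (fact n)) by (left; apply Rinv_0_lt_compat; auto).
  replace (C * (K ^ n * r ^ n / INR (fact n)))
    with (C * K ^ n * / INR (fact n) * r ^ n) by (unfold Rdiv; ring).
  apply Rmult_le_compat_r; [auto|]; apply Rmult_le_compat_r; auto. }
destruct (CV_radius _) as [r| |]; [|reflexivity|].
- specialize (B (Rabs r + 1)); simpl in B.
  assert (Rabs r + 1 <= r) by (apply B; assert (Q := Rabs_pos r); lra).
  assert (Q := Rle_abs r); lra.
- specialize (B 0); simpl in B; exfalso; apply B; lra.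
Qed.

Lemma ex_pseries_egf (w : nat -> R) (x : R) :
  exp_bounded w -> ex_pseries (fun n => w n / INR (fact n)) x.
Proof. intros H; apply CV_radius_inside; rewrite CV_radius_egf; simpl; auto. Qed.

Lemma tower_egf (w : nat -> R) : exp_bounded w -> tower (fun _ => True) (egf w).
Proof.
intros H i x _.
eapply is_derive_eq.
- apply is_derive_PSeries.
  rewrite (CV_radius_egf (fun n => w (n + i)%nat)); [exact I|now apply exp_bounded_drop].
- unfold egf; apply PSeries_ext; intros n; unfold PS_derive.
  replace (n + S i)%nat with (S n + i)%nat by lia.
  rewrite fact_simpl, mult_INR; field; split; [apply INR_fact_neq_0|].
  apply not_0_INR; lia.
Qed.

Lemma egf_at_0 (w : nat -> R) (i : nat) : egf w i 0 = w i.
Proof. unfold egf; rewrite PSeries_0; simpl; field. Qed.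

Lemma egf_comb (a b : R) (w w' : nat -> R) (i : nat) (x : R) :
  exp_bounded w -> exp_bounded w' ->
  egf (fun n => a * w n + b * w' n) i x = a * egf w i x + b * egf w' i x.
Proof.
intros H H'.
apply (exp_bounded_drop i) in H, H'.
unfold egf; rewrite <- !PSeries_scal, <- PSeries_plus.
- apply PSeries_ext; intros n; unfold PS_plus, PS_scal, scal, plus; simpl.
  unfold mult; simpl; unfold Rdiv; ring.
- apply ex_pseries_scal; [apply Rmult_comm|now apply ex_pseries_egf].
- apply ex_pseries_scal; [apply Rmult_comm|now apply ex_pseries_egf].
Qed.

Lemma egf_rsum (w : nat -> nat -> R) (c : nat -> R) (n i : nat) (x : R) :
  (forall k, (k < n)%nat -> exp_bounded (w k)) ->
  egf (fun m => rsum (fun k => c k * w k m) n) i x = rsum (fun k => c k * egf (w k) i x) n.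
Proof.
induction n as [|n IH]; simpl; intros H.
- unfold egf; transitivity (PSeries (fun _ => 0) x); [|apply PSeries_const_0].
  apply PSeries_ext; intros; unfold Rdiv; ring.
- rewrite <- IH by auto.
  rewrite <- (Rmult_1_l (egf (fun m => rsum (fun k => c k * w k m) n) i x)).
  rewrite <- egf_comb; [|now apply exp_bounded_rsum; auto|now auto].
  unfold egf; apply PSeries_ext; intros; unfold Rdiv; ring.
Qed.

Lemma egf_drop (w : nat -> R) (k i : nat) (x : R) :
  egf (fun n => w (n + k)%nat) i x = egf w (i + k)%nat x.
Proof. unfold egf; apply PSeries_ext; intros; do 2 f_equal; lia. Qed.

(** * Odd power series solutions of the field equation *)

Definition odd_seq (w : nat -> R) : Prop := forall i, w (2 * i)%nat = 0.

Lemma egf_odd (w : nat -> R) (i : nat) (x : R) :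
  odd_seq w -> egf w (2 * i)%nat (- x) = - egf w (2 * i)%nat x.
Proof.
intros H; unfold egf, PSeries; rewrite <- Series_opp; apply Series_ext; intros n.
destruct (Nat.Even_or_Odd n) as [[k ->]|[k ->]].
- replace (2 * k + 2 * i)%nat with (2 * (k + i))%nat by lia.
  rewrite H; unfold Rdiv; ring.
- replace ((- x) ^ (2 * k + 1)) with (- x ^ (2 * k + 1)); [ring|].
  rewrite !pow_add, !pow_mult; replace ((- x) ^ 2) with (x ^ 2) by ring; ring.
Qed.

Lemma even_comb_egf (n : nat) (c : nat -> R) (w q : nat -> R) (x : R) :
  exp_bounded w ->
  (forall i, rsum (fun m => c m * w (i + 2 * m)%nat) n = q i) ->
  even_comb n c (egf w) x = egf q 0 x.
Proof.
intros H Hq; unfold even_comb.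
rewrite (rsum_ext _ (fun m => c m * egf (fun i => w (i + 2 * m)%nat) 0 x))
  by (intros; now rewrite egf_drop).
rewrite <- egf_rsum by (intros; now apply exp_bounded_drop).
unfold egf; apply PSeries_ext; intros; now rewrite Hq.
Qed.

(* The values e i, ..., e (i + n - 1) of the solution e of
   c_0 e i + ... + c_n e (i + n) = q i with e j = x j for j < n. *)
Fixpoint recur_state (n : nat) (c q x : nat -> R) (i : nat) : nat -> R :=
  match i with
  | O => x
  | S i' => fun j =>
      if Nat.eqb (S j) n
      then (q i' - rsum (fun m => c m * recur_state n c q x i' m) n) / c n
      else recur_state n c q x i' (S j)
  end.

Definition recur_sol (n : nat) (c q x : nat -> R) (i : nat) : R :=
  recur_state n c q x i 0.

Lemma recur_sol_state (n : nat) (c q x : nat -> R) (j : nat) :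
  (j < n)%nat -> forall i, recur_sol n c q x (i + j) = recur_state n c q x i j.
Proof.
induction j as [|j IH]; intros Hj i; [now rewrite Nat.add_0_r|].
replace (i + S j)%nat with (S i + j)%nat by lia.
rewrite IH by lia; cbn [recur_state].
replace (Nat.eqb (S j) n) with false; [reflexivity|].
symmetry; apply Nat.eqb_neq; lia.
Qed.

Lemma recur_sol_init (n : nat) (c q x : nat -> R) (j : nat) :
  (j < n)%nat -> recur_sol n c q x j = x j.
Proof. intros Hj; exact (recur_sol_state n c q x j Hj 0). Qed.

Lemma recur_sol_step (n : nat) (c q x : nat -> R) (i : nat) : (0 < n)%nat ->
  recur_sol n c q x (i + n)
  = (q i - rsum (fun m => c m * recur_sol n c q x (i + m)) n) / c n.
Proof.
intros Hn; replace (i + n)%nat with (S i + (n - 1))%nat by lia.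
rewrite recur_sol_state by lia; cbn [recur_state].
replace (Nat.eqb (S (n - 1)) n) with true by (symmetry; apply Nat.eqb_eq; lia).
do 2 f_equal; apply rsum_ext; intros m Hm.
now rewrite recur_sol_state.
Qed.

Lemma recur_sol_eq (n : nat) (c q x : nat -> R) (i : nat) : (0 < n)%nat -> c n <> 0 ->
  rsum (fun m => c m * recur_sol n c q x (i + m)) (S n) = q i.
Proof. intros Hn cn; simpl; rewrite recur_sol_step by auto; field; auto. Qed.

Lemma Rabs_rsum (f : nat -> R) (n : nat) :
  Rabs (rsum f n) <= rsum (fun i => Rabs (f i)) n.
Proof.
induction n as [|n IH]; simpl; [rewrite Rabs_R0; lra|].
eapply Rle_trans; [apply Rabs_triang|lra].
Qed.

Lemma rsum_le (f g : nat -> R) (n : nat) :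
  (forall i, (i < n)%nat -> f i <= g i) -> rsum f n <= rsum g n.
Proof.
induction n as [|n IH]; simpl; intros H; [lra|].
apply Rplus_le_compat; auto.
Qed.

Lemma rsum_pos (f : nat -> R) (n : nat) :
  (forall i, (i < n)%nat -> 0 <= f i) -> 0 <= rsum f n.
Proof.
intros H; rewrite <- (rsum_eq0 (fun _ => 0) n) by auto; now apply rsum_le.
Qed.

Lemma rsum_term_le (f : nat -> R) (n j : nat) :
  (forall i, (i < n)%nat -> 0 <= f i) -> (j < n)%nat -> f j <= rsum f n.
Proof.
induction n as [|n IH]; simpl; intros H Hj; [lia|].
assert (0 <= f n) by auto.
assert (0 <= rsum f n) by (apply rsum_pos; auto).
destruct (Nat.eq_dec j n) as [->|Hn]; [lra|].
assert (f j <= rsum f n) by (apply IH; auto; lia); lra.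
Qed.

Lemma recur_sol_bounded (n : nat) (c q x : nat -> R) : (0 < n)%nat -> c n <> 0 ->
  exp_bounded q -> exp_bounded (recur_sol n c q x).
Proof.
intros Hn cn (C & K & C0 & K1 & Hq).
set (s := rsum (fun m => Rabs (c m)) n).
assert (s0 : 0 <= s) by (apply rsum_pos; intros; apply Rabs_pos).
set (X := rsum (fun m => Rabs (x m)) n).
assert (X0 : 0 <= X) by (apply rsum_pos; intros; apply Rabs_pos).
assert (cp : 0 < Rabs (c n)) by (apply Rabs_pos_lt; auto).
(* The recurrence expresses c n times the next entry by the source and the preceding entries. In 1 +
   s, the 1 pays for the source and s for the entries, all bounded by the same power of L; the
   constant C + X below also covers the initial values. *)
set (L := Rmax K ((1 + s) / Rabs (c n))).
assert (LK : K <= L) by apply Rmax_l.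
assert (Ls : (1 + s) <= L * Rabs (c n)).
{ apply Rle_div_l; [exact cp|apply Rmax_r]. }
exists (C + X), L; split; [lra|split; [lra|intros i]].
induction i as [i IH] using (well_founded_induction Wf_nat.lt_wf).
destruct (Nat.lt_ge_cases i n) as [Hi|Hi].
- rewrite recur_sol_init by auto.
  assert (Rabs (x i) <= X).
  { apply (rsum_term_le (fun m => Rabs (x m))); auto; intros; apply Rabs_pos. }
  assert (1 <= L ^ i) by (apply pow_R1_Rle; lra).
  nra.
- replace i with (i - n + n)%nat in * by lia; set (k := (i - n)%nat) in *.
  rewrite recur_sol_step by auto.
  unfold Rdiv; rewrite Rabs_mult, Rabs_inv.
  apply Rle_div_l; [exact cp|].
  set (B := (C + X) * L ^ (k + (n - 1))).
  assert (B0 : 0 <= B) by (apply Rmult_le_pos; [lra|apply pow_le; lra]).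
  assert (B1 : Rabs (q k) <= B).
  { eapply Rle_trans; [apply Hq|].
    apply Rmult_le_compat; [lra|apply pow_le; lra|lra|].
    apply Rle_trans with (L ^ k); [apply pow_incr; lra|].
    apply Rle_pow; [lra|lia]. }
  assert (B2 : Rabs (rsum (fun m => c m * recur_sol n c q x (k + m)) n) <= s * B).
  { eapply Rle_trans; [apply Rabs_rsum|].
    unfold s; rewrite Rmult_comm, <- rsum_scal; apply rsum_le; intros m Hm.
    rewrite Rabs_mult, Rmult_comm; apply Rmult_le_compat_r; [apply Rabs_pos|].
    eapply Rle_trans; [apply IH; lia|].
    apply Rmult_le_compat_l; [lra|apply Rle_pow; [lra|lia]]. }
  assert (B3 : (C + X) * L ^ (k + n) = L * B).
  { unfold B; replace (k + n)%nat with (S (k + (n - 1))) by lia; simpl; ring. }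
  rewrite B3; unfold Rminus.
  eapply Rle_trans; [apply Rabs_triang|]; rewrite Rabs_Ropp.
  nra.
Qed.

Definition odd_ext (e : nat -> R) (n : nat) : R :=
  if Nat.odd n then e (Nat.div2 n) else 0.

Lemma odd_ext_odd (e : nat -> R) (i : nat) : odd_ext e (2 * i + 1) = e i.
Proof.
unfold odd_ext; rewrite Nat.odd_odd; f_equal.
replace (2 * i + 1)%nat with (S (2 * i)) by lia; apply Nat.div2_succ_double.
Qed.

Lemma odd_ext_odd_seq (e : nat -> R) : odd_seq (odd_ext e).
Proof. intros i; unfold odd_ext; now rewrite Nat.odd_even. Qed.

Lemma exp_bounded_odd_ext (e : nat -> R) : exp_bounded e -> exp_bounded (odd_ext e).
Proof.
intros (C & K & C0 & K1 & H); exists C, K; repeat split; auto; intros n.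
assert (P := pow_le K n ltac:(lra)).
unfold odd_ext; destruct (Nat.odd n).
- eapply Rle_trans; [apply H|].
  apply Rmult_le_compat_l; [auto|apply Rle_pow; auto].
  apply Nat.div2_decr; lia.
- rewrite Rabs_R0; nra.
Qed.

Lemma exp_bounded_odd_part (q : nat -> R) :
  exp_bounded q -> exp_bounded (fun i => q (2 * i + 1)%nat).
Proof.
intros (C & K & C0 & K1 & H); exists (C * K), (K * K).
split; [nra|split; [nra|intros i]].
eapply Rle_trans; [apply H|].
rewrite pow_add, pow_mult; replace (K ^ 2) with (K * K) by ring; simpl; lra.
Qed.

(** The equation for derivatives at 0, that the sum of c m w (i + 2 m) be q i, does not mix
    parities. The odd entries satisfy a recurrence of order [n] with free initial values [x]; the
    even ones are 0. *)
Definition ode_sol (n : nat) (c q x : nat -> R) : nat -> R :=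
  odd_ext (recur_sol n c (fun i => q (2 * i + 1)%nat) x).

Lemma ode_sol_bounded (n : nat) (c q x : nat -> R) : (0 < n)%nat -> c n <> 0 ->
  exp_bounded q -> exp_bounded (ode_sol n c q x).
Proof.
intros; apply exp_bounded_odd_ext, recur_sol_bounded, exp_bounded_odd_part; auto.
Qed.

Lemma ode_sol_eq (n : nat) (c q x : nat -> R) (y : R) : (0 < n)%nat -> c n <> 0 ->
  exp_bounded q -> odd_seq q ->
  even_comb (S n) c (egf (ode_sol n c q x)) y = egf q 0 y.
Proof.
intros Hn cn Hq oq; apply even_comb_egf; [now apply ode_sol_bounded|].
intros i; unfold ode_sol; destruct (Nat.Even_or_Odd i) as [[k ->]|[k ->]].
- rewrite oq; apply rsum_eq0; intros m _.
  replace (2 * k + 2 * m)%nat with (2 * (k + m))%nat by lia.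
  rewrite odd_ext_odd_seq; ring.
- rewrite <- (recur_sol_eq n c (fun i => q (2 * i + 1)%nat) x k Hn cn).
  apply rsum_ext; intros m _.
  replace (2 * k + 1 + 2 * m)%nat with (2 * (k + m) + 1)%nat by lia.
  now rewrite odd_ext_odd.
Qed.

Lemma exp_bounded_0 : exp_bounded (fun _ => 0).
Proof.
exists 0, 1; split; [lra|split; [lra|]]; intros; rewrite Rabs_R0; lra.
Qed.

Lemma egf_0 (i : nat) (x : R) : egf (fun _ => 0) i x = 0.
Proof.
unfold egf; transitivity (PSeries (fun _ => 0) x); [|apply PSeries_const_0].
apply PSeries_ext; intros; unfold Rdiv; ring.
Qed.

Definition kronecker (i j : nat) : R := if Nat.eqb i j then 1 else 0.

Lemma rsum_kronecker (x : nat -> R) (n j : nat) : (j < n)%nat ->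
  rsum (fun i => x i * kronecker i j) n = x j.
Proof.
induction n as [|n IH]; intros Hj; [lia|]; simpl; unfold kronecker at 2.
destruct (Nat.eqb_spec n j) as [->|Hn].
- rewrite rsum_eq0; [ring|intros i Hi; unfold kronecker].
  replace (Nat.eqb i j) with false; [ring|symmetry; apply Nat.eqb_neq; lia].
- rewrite IH by lia; ring.
Qed.

(* The n free odd derivatives at 0 are mapped linearly to the n boundary values;
   by uniqueness the map is injective, hence onto. *)
Lemma navier_solve (h : R) (n : nat) (c q : nat -> R) :
  0 < h -> (0 < n)%nat -> c n <> 0 -> (forall i, (n < i)%nat -> c i = 0) ->
  (forall a, a < 0 -> rsum (fun i => c i * a ^ i) (S n) <> 0) ->
  exp_bounded q -> odd_seq q ->
  exists w, exp_bounded w /\ odd_seq w /\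
    (forall x, even_comb (S n) c (egf w) x = egf q 0 x) /\
    (forall i, (i < n)%nat -> egf w (2 * i) h = 0).
Proof.
intros hp Hn cn c0 croot Hq oq.
set (p := ode_sol n c q (fun _ => 0)).
set (s := fun k => ode_sol n c (fun _ => 0) (kronecker k)).
assert (Hp : exp_bounded p) by now apply ode_sol_bounded.
assert (Hs : forall k, exp_bounded (s k)).
{ intros; apply ode_sol_bounded; auto; apply exp_bounded_0. }
set (comb := fun (x : nat -> R) i => rsum (fun k => x k * s k i) n).
assert (Hc : forall x, exp_bounded (comb x)) by (intros; apply exp_bounded_rsum; auto).
assert (oc : forall x, odd_seq (comb x)).
{ intros x i; unfold comb; apply rsum_eq0; intros k _.
  unfold s, ode_sol; rewrite odd_ext_odd_seq; ring. }
assert (Ac : forall x y, even_comb (S n) c (egf (comb x)) y = 0).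
{ intros x y; rewrite <- (egf_0 0 y); apply even_comb_egf; [apply Hc|].
  intros i; unfold comb.
  rewrite (rsum_ext _ (fun m => rsum (fun k => x k * (c m * s k (i + 2 * m)%nat)) n))
    by (intros; rewrite <- rsum_scal; apply rsum_ext; intros; ring).
  rewrite (rsum_swap (fun m k => x k * (c m * s k (i + 2 * m)%nat))).
  apply rsum_eq0; intros k _; rewrite rsum_scal.
  assert (E := recur_sol_eq n c (fun _ => 0) (kronecker k)).
  destruct (Nat.Even_or_Odd i) as [[j ->]|[j ->]].
  - rewrite rsum_eq0; [ring|intros m _].
    replace (2 * j + 2 * m)%nat with (2 * (j + m))%nat by lia.
    unfold s, ode_sol; rewrite odd_ext_odd_seq; ring.
  - rewrite (rsum_ext _ (fun m => c m * recur_sol n c (fun _ => 0) (kronecker k) (j + m)%nat)).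
    + rewrite E by auto; ring.
    + intros m _; unfold s, ode_sol.
      replace (2 * j + 1 + 2 * m)%nat with (2 * (j + m) + 1)%nat by lia.
      now rewrite odd_ext_odd. }
destruct (square_system_surjective n (fun k j => egf (s k) (2 * j) h))
  with (b := fun j => - egf p (2 * j) h) as [x Hx].
- intros x Hx j Hj.
  assert (bc : forall i, (i < n)%nat -> egf (comb x) (2 * i) h = 0).
  { intros i Hi; unfold comb; rewrite egf_rsum by auto; apply Hx, Hi. }
  destruct (element_unique h n c (egf (comb x)) 0) as [Z _]; auto.
  + intros i y _; apply tower_egf; auto.
  + rewrite egf_at_0; apply (oc x 0%nat).
  + intros i Hi; rewrite (egf_odd _ _ _ (oc x)), bc, egf_at_0, (oc x i) by auto; lra.
  (* The Kronecker initial values make the unknown x j the derivative of order 2 j + 1 at 0 of the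
     combination. *)
  + specialize (Z (2 * j + 1)%nat 0); rewrite egf_at_0 in Z; unfold comb in Z.
    rewrite <- Z by (unfold between; lra).
    rewrite <- (rsum_kronecker x n j Hj); apply rsum_ext; intros k Hk.
    unfold s, ode_sol; rewrite odd_ext_odd, recur_sol_init; auto.
- exists (fun i => 1 * p i + 1 * comb x i).
  split; [now apply exp_bounded_comb|split; [|split]].
  + intros i; rewrite (oc x i); unfold p, ode_sol; rewrite odd_ext_odd_seq; ring.
  + intros y; transitivity (1 * even_comb (S n) c (egf p) y
      + 1 * even_comb (S n) c (egf (comb x)) y).
    * rewrite <- even_comb_lin; apply rsum_ext; intros; now rewrite egf_comb.
    * rewrite Ac; unfold p; rewrite ode_sol_eq by auto; ring.
  + intros i Hi; rewrite egf_comb by auto; unfold comb.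
    rewrite egf_rsum, Hx by auto; ring.
Qed.

(** * Polynomials as towers *)

(** A tower that reaches zero is that of a polynomial; no coefficients are stored and the degree
    bound stays existential. *)
Definition poly_tower (phi : nat -> R -> R) : Prop :=
  tower (fun _ => True) phi /\ exists N, forall x, phi N x = 0.

Lemma poly_tower_zero_from (phi : nat -> R -> R) (N : nat) :
  tower (fun _ => True) phi -> (forall x, phi N x = 0) ->
  forall k x, phi (k + N)%nat x = 0.
Proof.
intros Ht HN; induction k as [|k IH]; [exact HN|intros x].
apply (is_derive_zero_on (phi (k + N)%nat) x (x + 1) x); [lra|lra|intros; apply IH|].
apply (Ht (k + N)%nat x I).
Qed.

Lemma poly_tower_comb (a b : R) (phi psi : nat -> R -> R) :
  poly_tower phi -> poly_tower psi ->
  poly_tower (fun i x => a * phi i x + b * psi i x).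
Proof.
intros [H [N HN]] [H' [N' HN']]; split; [now apply tower_comb|].
exists (N + N')%nat; intros x.
rewrite (poly_tower_zero_from psi N') by auto.
rewrite Nat.add_comm, (poly_tower_zero_from phi N) by auto; ring.
Qed.

Lemma poly_tower_0 : poly_tower (fun _ _ => 0).
Proof.
split; [intros i x _; apply (is_derive_const 0)|exists O; auto].
Qed.

Lemma poly_tower_ext (phi psi : nat -> R -> R) :
  (forall i x, phi i x = psi i x) -> poly_tower phi -> poly_tower psi.
Proof.
intros E [H [N HN]]; split.
- intros i x Hx; rewrite <- E; apply (is_derive_ext (phi i)); [apply E|now apply H].
- exists N; intros; rewrite <- E; apply HN.
Qed.

Lemma poly_tower_rsum (n : nat) (a : nat -> R) (phi : nat -> nat -> R -> R) :
  (forall k, (k < n)%nat -> poly_tower (phi k)) ->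
  poly_tower (fun i x => rsum (fun k => a k * phi k i x) n).
Proof.
induction n as [|n IH]; intros H; [exact poly_tower_0|].
apply (poly_tower_ext (fun i x => 1 * rsum (fun k => a k * phi k i x) n + a n * phi n i x)).
- intros; simpl; ring.
- apply (poly_tower_comb 1 (a n) (fun i x => rsum (fun k => a k * phi k i x) n)); auto.
Qed.

Lemma poly_tower_drop (k : nat) (phi : nat -> R -> R) :
  poly_tower phi -> poly_tower (fun i x => phi (i + k)%nat x).
Proof.
intros [H [N HN]]; split; [now apply tower_drop|exists N; intros x].
rewrite Nat.add_comm; now apply poly_tower_zero_from.
Qed.

Lemma poly_tower_shift (a : R) (phi : nat -> R -> R) :
  poly_tower phi -> poly_tower (fun i x => phi i (x + a)).
Proof.
intros [H [N HN]]; split; [intros i x _|exists N; auto].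
apply (is_derive_ext (fun y => phi i (1 * y + a))); [intros; now rewrite Rmult_1_l|].
apply is_derive_eq with (1 * phi (S i) (1 * x + a)); [|now rewrite !Rmult_1_l].
apply is_derive_affine, H, I.
Qed.

(** Reduces identities between towers to level 0, where explicit formulas are available. *)
Lemma tower_level0 (phi psi : nat -> R -> R) :
  tower (fun _ => True) phi -> tower (fun _ => True) psi ->
  (forall x, phi O x = psi O x) -> forall i x, phi i x = psi i x.
Proof.
intros H H' H0 i x.
assert (Z := tower_zero_on (x - 1) (x + 1) (fun i x => 1 * phi i x + (-1) * psi i x)
  ltac:(lra)).
enough (1 * phi i x + (-1) * psi i x = 0) by lra.
apply Z; [|intros; rewrite H0; ring|unfold between; lra].
intros j y _; now apply (tower_comb (fun _ => True)).
Qed.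

(* Rolle: a function with arbitrarily large zeros has a derivative with arbitrarily large zeros. *)
Lemma poly_tower_many_zeros (phi : nat -> R -> R) :
  poly_tower phi -> (forall B, exists x, B < x /\ phi O x = 0) ->
  forall x, phi O x = 0.
Proof.
intros [Ht [N HN]]; revert phi Ht HN; induction N as [|N IH]; intros phi Ht HN Hz.
{ exact HN. }
assert (Z1 : forall x, phi 1%nat x = 0).
{ apply (IH (fun i x => phi (i + 1)%nat x)).
  - now apply tower_drop.
  - intros; rewrite Nat.add_1_r; apply HN.
  - intros B; destruct (Hz B) as (x & Bx & x0), (Hz x) as (y & xy & y0).
    destruct (MVT_gen (phi O) x y (phi 1%nat)) as (z & Hz1 & Ez).
    + intros; apply Ht; exact I.
    + intros z _; apply derivable_continuous_pt; exists (phi 1%nat z).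
      apply is_derive_Reals, Ht, I.
    + rewrite Rmin_left in Hz1 by lra; exists z; split; [lra|simpl].
      rewrite x0, y0 in Ez; nra. }
intros x; destruct (Hz x) as (y & xy & y0); rewrite <- y0; symmetry.
apply (derive_zero_const (phi O) (phi 1%nat) x y); [|intros; apply Z1|lra].
intros; apply Ht; exact I.
Qed.

(** * Central differences and the Stirling polynomials *)

(** With D = d/dx, [cdiff2] is delta^2 = 4 sinh^2 (h D / 2) and [cmean] is mu delta = sinh (h D). *)
Definition cdiff2 (h : R) (f : R -> R) (x : R) : R := f (x + h) - 2 * f x + f (x - h).
Definition cmean (h : R) (f : R -> R) (x : R) : R := (f (x + h) - f (x - h)) / 2.

Lemma poly_tower_cdiff2 (h : R) (phi : nat -> R -> R) :
  poly_tower phi -> poly_tower (fun i => cdiff2 h (phi i)).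
Proof.
intros H.
apply (poly_tower_ext (fun i x =>
  1 * (1 * phi i (x + h) + (-2) * phi i x) + 1 * phi i (x + - h))).
- intros; unfold cdiff2, Rminus; ring.
- apply (poly_tower_comb 1 1 (fun i x => 1 * phi i (x + h) + (-2) * phi i x)
    (fun i x => phi i (x + - h))); [|now apply poly_tower_shift].
  apply (poly_tower_comb 1 (-2) (fun i x => phi i (x + h))); [|exact H].
  now apply poly_tower_shift.
Qed.

Lemma poly_tower_cmean (h : R) (phi : nat -> R -> R) :
  poly_tower phi -> poly_tower (fun i => cmean h (phi i)).
Proof.
intros H.
apply (poly_tower_ext (fun i x => (1/2) * phi i (x + h) + (-1/2) * phi i (x + - h))).
- intros; unfold cmean, Rminus; field.
- apply (poly_tower_comb _ _ (fun i x => phi i (x + h)) (fun i x => phi i (x + - h)));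
    now apply poly_tower_shift.
Qed.

(** This is sinh^2 (h D) = z + z^2 / 4 for z = 4 sinh^2 (h D / 2). *)
Lemma cmean_cmean (h : R) (f : R -> R) (x : R) :
  cmean h (cmean h f) x = cdiff2 h f x + cdiff2 h (cdiff2 h f) x / 4.
Proof.
unfold cmean, cdiff2.
replace (x + h - h) with x by ring; replace (x - h + h) with x by ring; field.
Qed.

Lemma cdiff2_rsum (h : R) (a : nat -> R) (f : nat -> R -> R) (n : nat) (x : R) :
  cdiff2 h (fun y => rsum (fun k => a k * f k y) n) x
  = rsum (fun k => a k * cdiff2 h (f k) x) n.
Proof.
induction n as [|n IH]; simpl; [unfold cdiff2; ring|].
rewrite <- IH; unfold cdiff2; ring.
Qed.

Lemma cmean_rsum (h : R) (a : nat -> R) (f : nat -> R -> R) (n : nat) (x : R) :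
  cmean h (fun y => rsum (fun k => a k * f k y) n) x
  = rsum (fun k => a k * cmean h (f k) x) n.
Proof.
induction n as [|n IH]; simpl; [unfold cmean; field|].
rewrite <- IH; unfold cmean; field.
Qed.

Lemma cdiff2_ext (h : R) (f g : R -> R) (x : R) :
  (forall y, f y = g y) -> cdiff2 h f x = cdiff2 h g x.
Proof. intros E; unfold cdiff2; now rewrite !E. Qed.

(** Leibniz rule for x phi; at level 0 the factor [INR 0] cancels the term with the default
    [pred 0]. *)
Definition mul_x (phi : nat -> R -> R) (i : nat) (x : R) : R :=
  x * phi i x + INR i * phi (pred i) x.

Lemma poly_tower_mul_x (phi : nat -> R -> R) : poly_tower phi -> poly_tower (mul_x phi).
Proof.
intros [H [N HN]]; split.
- intros i x _; unfold mul_x.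
  apply is_derive_eq with ((1 * phi i x + x * phi (S i) x) + INR i * phi i x).
  + apply (is_derive_plus (V := R_NormedModule)).
    * apply (is_derive_mult (fun y => y) (phi i)); [apply (is_derive_id x)|now apply H|].
      intros; apply Rmult_comm.
    * destruct i as [|i].
      -- apply (is_derive_ext (fun _ => 0)); [intros; simpl; ring|].
         apply is_derive_eq with 0; [apply (is_derive_const 0)|simpl; ring].
      -- apply is_derive_scal, (H i x I).
  + rewrite S_INR; simpl pred; ring.
- exists (S N); intros x; unfold mul_x; simpl pred.
  rewrite (poly_tower_zero_from phi N H HN 1), HN; ring.
Qed.

(* The coefficient of z^k in sinh (y D) / sinh (h D), where z = 4 sinh^2 (h D / 2). *)
Fixpoint stirling_odd (h : R) (k : nat) : nat -> R -> R :=
  match k with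
  | O => fun i x => match i with O => x / h | 1%nat => / h | _ => 0 end
  | S k' => fun i x =>
      (mul_x (mul_x (stirling_odd h k')) i x
        - (INR k * h) ^ 2 * stirling_odd h k' i x)
      / (h ^ 2 * (2 * INR k) * (2 * INR k + 1))
  end.

(* The coefficient of z^k in cosh (y D). *)
Definition stirling_even (h : R) (k i : nat) : R -> R := cmean h (stirling_odd h k i).

Lemma poly_tower_stirling_odd (h : R) (k : nat) : poly_tower (stirling_odd h k).
Proof.
induction k as [|k IH].
- split; [intros [|[|i]] x _; simpl|exists 2%nat; auto].
  + apply (is_derive_ext (fun y => / h * y)); [intros; apply Rmult_comm|].
    apply is_derive_eq with (/ h * 1); [|ring].
    apply is_derive_scal, (is_derive_id x).
  + apply (is_derive_const (/ h)).
  + apply (is_derive_const 0).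
- set (N := / (h ^ 2 * (2 * INR (S k)) * (2 * INR (S k) + 1))).
  apply (poly_tower_ext (fun i x => N * mul_x (mul_x (stirling_odd h k)) i x
           + (- N * (INR (S k) * h) ^ 2) * stirling_odd h k i x)).
  + intros; cbn [stirling_odd]; unfold Rdiv; fold N; ring.
  + apply poly_tower_comb; [|exact IH]; now do 2 apply poly_tower_mul_x.
Qed.

Lemma poly_tower_stirling_even (h : R) (k : nat) : poly_tower (stirling_even h k).
Proof. apply poly_tower_cmean, poly_tower_stirling_odd. Qed.

(** Iterated, this is the product x (x^2 - h^2) ... (x^2 - (k h)^2) / ((2k + 1)! h^(2k + 1)) for
    index k. *)
Lemma stirling_odd_S (h : R) (k : nat) (x : R) :
  stirling_odd h (S k) O x = stirling_odd h k O x * (x ^ 2 - (INR (S k) * h) ^ 2)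
    / (h ^ 2 * (2 * INR (S k)) * (2 * INR (S k) + 1)).
Proof. cbn [stirling_odd]; unfold mul_x; cbn [INR pred]; unfold Rdiv; ring. Qed.

Lemma stirling_odd_opp (h : R) (k : nat) (x : R) :
  stirling_odd h k O (- x) = - stirling_odd h k O x.
Proof.
induction k as [|k IH]; [simpl; unfold Rdiv; ring|].
rewrite !stirling_odd_S, IH; unfold Rdiv; ring.
Qed.

Lemma stirling_den (h : R) (k : nat) : h <> 0 ->
  h <> 0 /\ INR (S k) <> 0 /\ 2 * INR (S k) + 1 <> 0.
Proof. intros hn; rewrite S_INR; assert (Q := pos_INR k); repeat split; auto; lra. Qed.

(** The zeros -(k + 1) h, ..., (k + 1) h move one step to the left: those of [stirling_odd h k]
    remain, and two are added beyond its left end. *)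
Lemma stirling_odd_shift (h : R) (k : nat) (x : R) : h <> 0 ->
  stirling_odd h (S k) O (x + h)
  = stirling_odd h k O x * (x + INR (S k) * h) * (x + (INR (S k) + 1) * h)
    / (h ^ 2 * (2 * INR (S k)) * (2 * INR (S k) + 1)).
Proof.
intros hn; induction k as [|k IH].
- rewrite stirling_odd_S; simpl; field; auto.
- rewrite stirling_odd_S, IH, (stirling_odd_S h k x).
  assert (D := stirling_den h k hn); assert (D' := stirling_den h (S k) hn).
  rewrite (S_INR (S k)) in *; field; tauto.
Qed.

Lemma stirling_odd_shift_minus (h : R) (k : nat) (x : R) : h <> 0 ->
  stirling_odd h (S k) O (x - h)
  = stirling_odd h k O x * (x - INR (S k) * h) * (x - (INR (S k) + 1) * h)
    / (h ^ 2 * (2 * INR (S k)) * (2 * INR (S k) + 1)).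
Proof.
intros hn; replace (x - h) with (- (- x + h)) by ring.
rewrite stirling_odd_opp, stirling_odd_shift, stirling_odd_opp by auto.
unfold Rdiv; ring.
Qed.

Lemma cdiff2_stirling_odd_0 (h : R) (i : nat) (x : R) : h <> 0 ->
  cdiff2 h (stirling_odd h 0 i) x = 0.
Proof. intros hn; unfold cdiff2; destruct i as [|[|i]]; simpl; field; auto. Qed.

(** In generating functions, delta^2 multiplies sinh (x D) by z. Here the values at x + h, x and x -
    h share the factor [stirling_odd h k], and the remaining quadratics combine to the common
    denominator. *)
Lemma cdiff2_stirling_odd (h : R) (k i : nat) (x : R) : h <> 0 ->
  cdiff2 h (stirling_odd h (S k) i) x = stirling_odd h k i x.
Proof.
intros hn.
apply (tower_level0 (fun i => cdiff2 h (stirling_odd h (S k) i)) (stirling_odd h k)).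
- apply poly_tower_cdiff2, poly_tower_stirling_odd.
- apply poly_tower_stirling_odd.
- clear x; intros x; unfold cdiff2.
  rewrite stirling_odd_shift, stirling_odd_shift_minus, stirling_odd_S by auto.
  assert (D := stirling_den h k hn); field; tauto.
Qed.

Lemma cdiff2_cmean (h : R) (f : R -> R) (x : R) :
  cdiff2 h (cmean h f) x = cmean h (cdiff2 h f) x.
Proof.
unfold cmean, cdiff2.
replace (x + h - h) with x by ring; replace (x - h + h) with x by ring; field.
Qed.

Lemma cmean_ext (h : R) (f g : R -> R) (x : R) :
  (forall y, f y = g y) -> cmean h f x = cmean h g x.
Proof. intros E; unfold cmean; now rewrite !E. Qed.

Lemma cdiff2_stirling_even_0 (h : R) (i : nat) (x : R) : h <> 0 ->
  cdiff2 h (stirling_even h 0 i) x = 0.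
Proof.
intros hn; unfold stirling_even; rewrite cdiff2_cmean.
rewrite (cmean_ext h _ (fun _ => 0)) by (intros; now apply cdiff2_stirling_odd_0).
unfold cmean; field.
Qed.

Lemma cdiff2_stirling_even (h : R) (k i : nat) (x : R) : h <> 0 ->
  cdiff2 h (stirling_even h (S k) i) x = stirling_even h k i x.
Proof.
intros hn; unfold stirling_even; rewrite cdiff2_cmean.
apply cmean_ext; intros; now apply cdiff2_stirling_odd.
Qed.

(** The operator mu delta takes cosh (x D) to sinh (h D) sinh (x D), which is z + z^2 / 4 times sinh
    (x D) / sinh (h D); multiplication by z is [gamma_times]. *)
Lemma cmean_stirling_even (h : R) (k i : nat) (x : R) : h <> 0 ->
  cmean h (stirling_even h k i) x
  = gamma_times (fun k' => stirling_odd h k' i x) k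
    + gamma_times (gamma_times (fun k' => stirling_odd h k' i x)) k / 4.
Proof.
intros hn; unfold stirling_even; rewrite cmean_cmean.
destruct k as [|[|k]]; simpl gamma_times.
- rewrite (cdiff2_ext h (cdiff2 h _) (fun _ => 0)) by (intros; now apply cdiff2_stirling_odd_0).
  rewrite cdiff2_stirling_odd_0 by auto; unfold cdiff2; field.
- rewrite (cdiff2_ext h (cdiff2 h _) (stirling_odd h 0 i)) by (intros; now apply cdiff2_stirling_odd).
  rewrite cdiff2_stirling_odd_0, cdiff2_stirling_odd by auto; reflexivity.
- rewrite (cdiff2_ext h (cdiff2 h _) (stirling_odd h (S k) i)) by (intros; now apply cdiff2_stirling_odd).
  rewrite !cdiff2_stirling_odd by auto; reflexivity.
Qed.

Lemma stirling_odd_at_0 (h : R) (k : nat) : stirling_odd h k O 0 = 0.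
Proof. assert (E := stirling_odd_opp h k 0); rewrite Ropp_0 in E; lra. Qed.

Lemma stirling_odd_at_h (h : R) (k : nat) : h <> 0 ->
  stirling_odd h k O h = kronecker k 0.
Proof.
intros hn; destruct k as [|k]; [simpl; unfold kronecker; simpl; field; auto|].
replace h with (0 + h) at 2 by ring.
rewrite stirling_odd_shift, stirling_odd_at_0 by auto; unfold kronecker; simpl; unfold Rdiv; ring.
Qed.

Lemma stirling_even_at_0 (h : R) (k : nat) : h <> 0 ->
  stirling_even h k O 0 = kronecker k 0.
Proof.
intros hn; unfold stirling_even, cmean.
replace (0 - h) with (- h) by ring; rewrite Rplus_0_l, stirling_odd_opp, stirling_odd_at_h by auto.
field.
Qed.

(** * Parity and expansions in Stirling polynomials *)

Definition parity (s : R) (phi : nat -> R -> R) : Prop :=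
  forall x, phi O (- x) = s * phi O x.

Lemma parity_level (s : R) (phi : nat -> R -> R) :
  tower (fun _ => True) phi -> parity s phi ->
  forall i x, phi i (- x) = s * (-1) ^ i * phi i x.
Proof.
intros Ht Hs i x.
assert (E := tower_level0 (fun i x => (-1) ^ i * phi i (-1 * x + 0)) (fun i x => s * phi i x + 0 * phi i x)).
assert (M : (-1) ^ i * (-1) ^ i = 1).
{ rewrite <- Rpow_mult_distr; replace (-1 * -1) with 1 by ring; apply pow1. }
transitivity ((-1) ^ i * ((-1) ^ i * phi i (-1 * x + 0))).
- replace (-1 * x + 0) with (- x) by ring; rewrite <- Rmult_assoc, M; ring.
- rewrite E; [ring| | |].
  + apply (tower_affine (fun _ => True)); auto.
  + apply tower_comb; auto.
  + intros y; replace (-1 * y + 0) with (- y) by ring; rewrite Hs; ring.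
Qed.

Lemma parity_stirling_odd (h : R) (k : nat) : parity (-1) (stirling_odd h k).
Proof. intros x; rewrite stirling_odd_opp; ring. Qed.

Lemma parity_stirling_even (h : R) (k : nat) : parity 1 (stirling_even h k).
Proof.
intros x; unfold stirling_even, cmean.
replace (- x + h) with (- (x - h)) by ring; replace (- x - h) with (- (x + h)) by ring.
rewrite !stirling_odd_opp; field.
Qed.

(** The three-term recurrence carries the zeros at 0 and h to all positive multiples of h, too many
    for a nonzero polynomial. *)
Lemma appell_zero (h : R) (G : nat -> R -> R) : 0 < h -> poly_tower G ->
  G O 0 = 0 -> G O h = 0 -> (forall x, cdiff2 h (G O) x = 0) ->
  forall i x, G i x = 0.
Proof.
intros hp HG G0 Gh Gd.
assert (Z : forall m, G O (INR m * h) = 0 /\ G O (INR (S m) * h) = 0).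
{ induction m as [|m [IH IH']].
  - simpl; rewrite Rmult_0_l, Rmult_1_l; auto.
  - split; [exact IH'|].
    specialize (Gd (INR (S m) * h)); unfold cdiff2 in Gd.
    replace (INR (S m) * h - h) with (INR m * h) in Gd by (rewrite S_INR; ring).
    replace (INR (S m) * h + h) with (INR (S (S m)) * h) in Gd
      by (rewrite (S_INR (S m)); ring).
    lra. }
assert (A0 : forall x, G O x = 0).
{ apply poly_tower_many_zeros; auto; intros B.
  destruct (INR_unbounded (B / h)) as [m Hm]; exists (INR m * h); split.
  - apply Rmult_lt_reg_r with (/ h); [now apply Rinv_0_lt_compat|].
    rewrite Rmult_assoc, Rinv_r, Rmult_1_r by lra; exact Hm.
  - apply Z. }
apply (tower_level0 G (fun _ _ => 0)); [apply HG|apply poly_tower_0|exact A0].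
Qed.

(** An Appell sequence with delta^2 in place of the derivative: formally, the generating function in
    z is an eigenfunction of delta^2 for the eigenvalue z. The bound [K] admits finite sequences
    such as the delta^(2(K - k)) of a polynomial. *)
Definition central_appell (h : R) (K : nat) (F : nat -> nat -> R -> R) : Prop :=
  (forall k, (k <= K)%nat -> poly_tower (F k)) /\
  (forall x, cdiff2 h (F O O) x = 0) /\
  (forall k x, (k < K)%nat -> cdiff2 h (F (S k) O) x = F k O x).

Lemma central_appell_le (h : R) (K K' : nat) (F : nat -> nat -> R -> R) :
  (K' <= K)%nat -> central_appell h K F -> central_appell h K' F.
Proof.
intros le (H & H0 & HS); split; [|split]; auto; intros; [apply H|apply HS]; lia.
Qed.

Lemma central_appell_stirling_odd (h : R) (K : nat) : h <> 0 ->
  central_appell h K (stirling_odd h).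
Proof.
intros hn; split; [|split]; intros.
- apply poly_tower_stirling_odd.
- now apply cdiff2_stirling_odd_0.
- now apply cdiff2_stirling_odd.
Qed.

Lemma central_appell_stirling_even (h : R) (K : nat) : h <> 0 ->
  central_appell h K (stirling_even h).
Proof.
intros hn; split; [|split]; intros.
- apply poly_tower_stirling_even.
- now apply cdiff2_stirling_even_0.
- now apply cdiff2_stirling_even.
Qed.

(** By induction on K, delta^2 annihilates the difference of the two sides; this difference also has
    parity s and vanishes at t, so the first hypothesis applies. The pair (s, t) is (1, 0) for even
    and (-1, h) for odd sequences. *)
Lemma stirling_expansion (h t s : R) (B F : nat -> nat -> R -> R) (K : nat) :
  (forall G, poly_tower G -> parity s G -> (forall x, cdiff2 h (G O) x = 0) ->
     G O t = 0 -> forall i x, G i x = 0) ->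
  central_appell h K B -> (forall k, parity s (B k)) ->
  (forall k, B k O t = kronecker k 0) ->
  central_appell h K F -> (forall k, (k <= K)%nat -> parity s (F k)) ->
  forall i x, F K i x = rsum (fun k => F (K - k)%nat O t * B k i x) (S K).
Proof.
intros Hzero HB BE Bt.
induction K as [K IH] using (well_founded_induction Wf_nat.lt_wf); intros HF FE i x.
assert (HB' := HB); destruct HB' as (Bp & B0 & BS).
assert (HF' := HF); destruct HF' as (Fp & F0 & FS).
set (T := fun i x => rsum (fun k => F (K - k)%nat O t * B k i x) (S K)).
enough (1 * F K i x + (-1) * T i x = 0) by (fold (T i x); lra).
revert i x; apply (Hzero (fun i x => 1 * F K i x + (-1) * T i x)).
- apply poly_tower_comb; [now apply Fp|].
  apply (poly_tower_rsum (S K) (fun k => F (K - k)%nat O t) B).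
  intros; apply Bp; lia.
- intros x; rewrite (FE K) by lia; unfold T.
  rewrite (rsum_ext (fun k => F (K - k)%nat O t * B k O (- x))
    (fun k => s * (F (K - k)%nat O t * B k O x))) by (intros; rewrite BE; ring).
  rewrite rsum_scal; ring.
- intros y; transitivity (cdiff2 h (F K O) y - cdiff2 h (T O) y); [unfold cdiff2; ring|].
  unfold T; rewrite (cdiff2_rsum h (fun k => F (K - k)%nat O t) (fun k => B k O)).
  rewrite rsum_head, B0, Rmult_0_r, Rplus_0_l.
  destruct K as [|K]; [rewrite F0; simpl; ring|].
  rewrite FS, (IH K ltac:(lia)) by
    (solve [apply (central_appell_le h (S K)); auto | intros; apply FE; lia | lia]).
  apply Rminus_diag_eq, rsum_ext; intros k Hk; now rewrite BS.
- unfold T; rewrite rsum_head, Bt, Nat.sub_0_r, rsum_eq0 by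
    (intros; rewrite Bt; unfold kronecker; simpl; ring).
  unfold kronecker; simpl; ring.
Qed.

Lemma even_expansion (h : R) (F : nat -> nat -> R -> R) (K : nat) :
  0 < h -> central_appell h K F -> (forall k, (k <= K)%nat -> parity 1 (F k)) ->
  forall i x, F K i x
    = rsum (fun k => F (K - k)%nat O 0 * stirling_even h k i x) (S K).
Proof.
intros hp HF FE; apply (stirling_expansion h 0 1); auto.
- intros G Gp Gpar Gd G0; apply (appell_zero h); auto.
  (* For an even G with G 0 = 0, the second difference at 0 is 2 G h. *)
  specialize (Gd 0); unfold cdiff2 in Gd; rewrite Rplus_0_l, G0 in Gd.
  replace (0 - h) with (- h) in Gd by ring; rewrite Gpar in Gd; lra.
- apply central_appell_stirling_even; lra.
- apply parity_stirling_even.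
- intros; apply stirling_even_at_0; lra.
Qed.

Lemma odd_expansion (h : R) (F : nat -> nat -> R -> R) (K : nat) :
  0 < h -> central_appell h K F -> (forall k, (k <= K)%nat -> parity (-1) (F k)) ->
  forall i x, F K i x
    = rsum (fun k => F (K - k)%nat O h * stirling_odd h k i x) (S K).
Proof.
intros hp HF FE; apply (stirling_expansion h h (-1)); auto.
- intros G Gp Gpar Gd Gh; apply (appell_zero h); auto.
  assert (E := Gpar 0); rewrite Ropp_0 in E; lra.
- apply central_appell_stirling_odd; lra.
- apply parity_stirling_odd.
- intros; apply stirling_odd_at_h; lra.
Qed.

(** * Differential operators on the Stirling polynomials *)

Definition diff_op (n : nat) (coef : nat -> R) (ord : nat -> nat)
    (phi : nat -> R -> R) (i : nat) (x : R) : R :=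
  rsum (fun m => coef m * phi (i + ord m)%nat x) n.

Lemma poly_tower_diff_op (n : nat) (coef : nat -> R) (ord : nat -> nat) (phi : nat -> R -> R) :
  poly_tower phi -> poly_tower (diff_op n coef ord phi).
Proof.
intros H; apply (poly_tower_rsum n coef (fun m i x => phi (i + ord m)%nat x)).
intros; now apply poly_tower_drop.
Qed.

Lemma central_appell_level (h : R) (K : nat) (F : nat -> nat -> R -> R) :
  central_appell h K F ->
  (forall i x, cdiff2 h (F O i) x = 0) /\
  (forall k i x, (k < K)%nat -> cdiff2 h (F (S k) i) x = F k i x).
Proof.
intros (Hp & H0 & HS); split.
- apply (tower_level0 (fun i => cdiff2 h (F O i)) (fun _ _ => 0));
    [apply poly_tower_cdiff2, Hp; lia|apply poly_tower_0|exact H0].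
- intros k i x Hk; revert i x.
  apply (tower_level0 (fun i => cdiff2 h (F (S k) i)) (F k));
    [apply poly_tower_cdiff2, Hp; lia|apply Hp; lia|intros; now apply HS].
Qed.

Lemma central_appell_diff_op (h : R) (K n : nat) (coef : nat -> R) (ord : nat -> nat)
    (F : nat -> nat -> R -> R) :
  central_appell h K F -> central_appell h K (fun k => diff_op n coef ord (F k)).
Proof.
intros H; destruct (central_appell_level h K F H) as [L0 LS]; destruct H as (Hp & _ & _).
split; [intros; now apply poly_tower_diff_op, Hp|split].
- intros x; unfold diff_op; rewrite (cdiff2_rsum h coef (fun m => F O (0 + ord m)%nat)).
  apply rsum_eq0; intros; rewrite L0; ring.
- intros k x Hk; unfold diff_op; rewrite (cdiff2_rsum h coef (fun m => F (S k) (0 + ord m)%nat)).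
  apply rsum_ext; intros; now rewrite LS.
Qed.

Lemma parity_diff_op_even (s : R) (n : nat) (coef : nat -> R) (ord : nat -> nat) (phi : nat -> R -> R) :
  tower (fun _ => True) phi -> (forall m, Nat.Even (ord m)) ->
  parity s phi -> parity s (diff_op n coef ord phi).
Proof.
intros Ht He Hs x; unfold diff_op; rewrite <- rsum_scal; apply rsum_ext; intros m _.
rewrite (parity_level s phi) by auto.
destruct (He m) as [k ->]; rewrite Nat.add_0_l, pow_1_even; ring.
Qed.

Lemma parity_diff_op_odd (s : R) (n : nat) (coef : nat -> R) (ord : nat -> nat) (phi : nat -> R -> R) :
  tower (fun _ => True) phi -> (forall m, Nat.Odd (ord m)) ->
  parity s phi -> parity (- s) (diff_op n coef ord phi).
Proof.
intros Ht He Hs x; unfold diff_op; rewrite <- rsum_scal; apply rsum_ext; intros m _.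
rewrite (parity_level s phi) by auto.
destruct (He m) as [k ->]; rewrite Nat.add_0_l, pow_add, pow_1_even; ring.
Qed.

Lemma diff_op_stirling_even (h : R) (n : nat) (coef : nat -> R) (ord : nat -> nat) (k i : nat) (x : R) :
  diff_op n coef ord (stirling_even h k) i x = cmean h (diff_op n coef ord (stirling_odd h k) i) x.
Proof.
unfold diff_op; now rewrite (cmean_rsum h coef (fun m => stirling_odd h k (i + ord m)%nat)).
Qed.

Lemma cmean_odd_at_0 (h : R) (phi : nat -> R -> R) :
  parity (-1) phi -> cmean h (phi O) 0 = phi O h.
Proof.
intros H; unfold cmean; rewrite Rplus_0_l; replace (0 - h) with (- h) by ring.
rewrite H; field.
Qed.

(* With z = 4 sinh^2 (h D / 2): the coefficient of z^k in the operator itself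
   if it is even, and in its quotient by sinh (h D) if it is odd. *)
Definition even_coef (h : R) (n : nat) (coef : nat -> R) (ord : nat -> nat) (k : nat) : R :=
  diff_op n coef ord (stirling_even h k) O 0.
Definition odd_coef (h : R) (n : nat) (coef : nat -> R) (ord : nat -> nat) (k : nat) : R :=
  diff_op n coef ord (stirling_odd h k) O 0.

(** The identity A cosh (y D) = A(D) cosh (y D), written as a convolution of coefficients of powers
    of z. *)
Lemma even_op_stirling_even (h : R) (n : nat) (coef : nat -> R) (ord : nat -> nat) (k i : nat) (x : R) :
  0 < h -> (forall m, Nat.Even (ord m)) ->
  diff_op n coef ord (stirling_even h k) i x
  = rsum (fun j => even_coef h n coef ord (k - j) * stirling_even h j i x) (S k).
Proof.
intros hp He.
apply (even_expansion h (fun k => diff_op n coef ord (stirling_even h k))); auto.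
- apply central_appell_diff_op, central_appell_stirling_even; lra.
- intros; apply parity_diff_op_even; auto.
  + apply poly_tower_stirling_even.
  + apply parity_stirling_even.
Qed.

(** The odd expansion reads its coefficients at h. They agree with [even_coef] because an odd
    function at h equals its mu delta at 0, and mu delta turns [stirling_odd] into
    [stirling_even]. *)
Lemma even_op_stirling_odd (h : R) (n : nat) (coef : nat -> R) (ord : nat -> nat) (k i : nat) (x : R) :
  0 < h -> (forall m, Nat.Even (ord m)) ->
  diff_op n coef ord (stirling_odd h k) i x
  = rsum (fun j => even_coef h n coef ord (k - j) * stirling_odd h j i x) (S k).
Proof.
intros hp He.
assert (Hpar : forall k, parity (-1) (diff_op n coef ord (stirling_odd h k))).
{ intros; apply parity_diff_op_even; auto.
  - apply poly_tower_stirling_odd.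
  - apply parity_stirling_odd. }
rewrite (odd_expansion h (fun k => diff_op n coef ord (stirling_odd h k)) k hp); auto.
- apply rsum_ext; intros j _; unfold even_coef.
  now rewrite diff_op_stirling_even, (cmean_odd_at_0 h _ (Hpar _)).
- apply central_appell_diff_op, central_appell_stirling_odd; lra.
Qed.

Lemma odd_op_stirling_odd (h : R) (n : nat) (coef : nat -> R) (ord : nat -> nat) (k i : nat) (x : R) :
  0 < h -> (forall m, Nat.Odd (ord m)) ->
  diff_op n coef ord (stirling_odd h k) i x
  = rsum (fun j => odd_coef h n coef ord (k - j) * stirling_even h j i x) (S k).
Proof.
intros hp He.
apply (even_expansion h (fun k => diff_op n coef ord (stirling_odd h k))); auto.
- apply central_appell_diff_op, central_appell_stirling_odd; lra.
- intros k' _; replace 1 with (- (-1)) by ring; apply parity_diff_op_odd; auto.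
  + apply poly_tower_stirling_odd.
  + apply parity_stirling_odd.
Qed.

(** B(D) sinh (y D) is B(D) / sinh (h D) times sinh^2 (h D) times sinh (y D) / sinh (h D); the
    middle factor is z + z^2 / 4. *)
Lemma odd_op_stirling_even (h : R) (n : nat) (coef : nat -> R) (ord : nat -> nat) (k i : nat) (x : R) :
  0 < h -> (forall m, Nat.Odd (ord m)) ->
  let b := odd_coef h n coef ord in
  diff_op n coef ord (stirling_even h k) i x
  = rsum (fun j => (gamma_times b (k - j) + gamma_times (gamma_times b) (k - j) / 4)
                   * stirling_odd h j i x) (S k).
Proof.
intros hp He b; assert (hn : h <> 0) by lra.
assert (Hpar : forall k, parity (-1) (diff_op n coef ord (stirling_even h k))).
{ intros; replace (-1) with (- (1)) by ring; apply parity_diff_op_odd; auto.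
  - apply poly_tower_stirling_even.
  - apply parity_stirling_even. }
rewrite (odd_expansion h (fun k => diff_op n coef ord (stirling_even h k)) k hp); auto.
- apply rsum_ext; intros j _; f_equal.
  rewrite <- (cmean_odd_at_0 h _ (Hpar _)); set (m := (k - j)%nat).
  unfold diff_op at 1; rewrite (cmean_rsum h coef (fun p => stirling_even h m (0 + ord p)%nat)).
  rewrite (rsum_ext _ (fun p => coef p * (gamma_times (fun k' => stirling_odd h k' (0 + ord p)%nat 0) m
    + gamma_times (gamma_times (fun k' => stirling_odd h k' (0 + ord p)%nat 0)) m / 4)))
    by (intros; now rewrite cmean_stirling_even).
  unfold b, odd_coef, diff_op; destruct m as [|[|m]]; cbn [gamma_times].
  + rewrite rsum_eq0; [field|intros; field].
  + unfold Rdiv; rewrite Rmult_0_l, Rplus_0_r; apply rsum_ext; intros; ring.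
  + unfold Rdiv; rewrite (Rmult_comm _ (/ 4)), <- rsum_scal, <- rsum_plus.
    apply rsum_ext; intros; ring.
- apply central_appell_diff_op, central_appell_stirling_even; lra.
Qed.

(** * Polynomial sources and the fields of order epsilon *)

Lemma poly_tower_zero_jet (phi : nat -> R -> R) :
  poly_tower phi -> (forall i, phi i 0 = 0) -> forall x, phi O x = 0.
Proof.
intros [Ht [N HN]]; revert phi Ht HN; induction N as [|N IH]; intros phi Ht HN H0; [exact HN|].
assert (Z1 : forall x, phi 1%nat x = 0).
{ apply (IH (fun i x => phi (i + 1)%nat x)); [now apply tower_drop| |intros; apply H0].
  intros; rewrite Nat.add_1_r; apply HN. }
assert (C : forall a b, a <= b -> phi O b = phi O a).
{ intros a b ab; apply (derive_zero_const (phi O) (phi 1%nat) a b);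
    [intros; apply Ht; exact I|intros; apply Z1|lra]. }
intros x; rewrite <- (H0 O); destruct (Rle_dec 0 x); [apply C; lra|symmetry; apply C; lra].
Qed.

Lemma exp_bounded_jet (phi : nat -> R -> R) :
  poly_tower phi -> exp_bounded (fun n => phi n 0).
Proof.
intros [Ht [N HN]]; exists (rsum (fun n => Rabs (phi n 0)) N), 1.
split; [apply rsum_pos; intros; apply Rabs_pos|split; [lra|intros n]].
rewrite pow1, Rmult_1_r; destruct (Nat.lt_ge_cases n N).
- apply (rsum_term_le (fun n => Rabs (phi n 0))); auto; intros; apply Rabs_pos.
- replace n with (n - N + N)%nat by lia.
  rewrite (poly_tower_zero_from phi N), Rabs_R0 by auto.
  apply rsum_pos; intros; apply Rabs_pos.
Qed.

(** Presents a polynomial source as an entire series, the form of the right-hand side in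
    [navier_solve]. *)
Lemma egf_jet (phi : nat -> R -> R) (x : R) :
  poly_tower phi -> egf (fun n => phi n 0) O x = phi O x.
Proof.
intros H; assert (He := exp_bounded_jet phi H).
enough (1 * egf (fun n => phi n 0) O x + (-1) * phi O x = 0) by lra.
revert x; apply (poly_tower_zero_jet (fun i x => 1 * egf (fun n => phi n 0) i x + (-1) * phi i x)).
- destruct H as [Ht [N HN]]; split; [apply tower_comb; auto; now apply tower_egf|].
  exists N; intros x; rewrite HN.
  replace (egf (fun n => phi n 0) N x) with 0; [ring|].
  rewrite <- (egf_0 0 x); unfold egf; apply PSeries_ext; intros m.
  now rewrite (poly_tower_zero_from phi N).
- intros i; rewrite egf_at_0; ring.
Qed.

Lemma odd_seq_jet (phi : nat -> R -> R) :
  poly_tower phi -> parity (-1) phi -> odd_seq (fun n => phi n 0).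
Proof.
intros [Ht _] Hp i; assert (E := parity_level (-1) phi Ht Hp (2 * i) 0).
rewrite Ropp_0, pow_1_even in E; lra.
Qed.

(** Write Z = gamma delta^2. At order epsilon the cosh terms of the time derivative cancel those of
    B v; the sinh terms carry the factor (gamma mu delta)^2 - sinh^2 (h D) = -(1 - gamma) Z. Hence w
    = -(1 - gamma) z, where z solves A z = A(D) z + Z (B(D) / sinh (h D)) (sinh (y D) / sinh (h D)).
    The equation below is its order Z^k, with the factor Z absorbed in [b]; the sums stop before k
    since in the application a 0 = b 0 = 0. *)
Lemma navier_family (h : R) (n : nat) (c : nat -> R) (a b : nat -> R) :
  0 < h -> (0 < n)%nat -> c n <> 0 -> (forall i, (n < i)%nat -> c i = 0) ->
  (forall s, s < 0 -> rsum (fun i => c i * s ^ i) (S n) <> 0) ->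
  forall K, exists z : nat -> nat -> R, forall k, (k < K)%nat ->
    exp_bounded (z k) /\ odd_seq (z k) /\
    (forall i, (i < n)%nat -> egf (z k) (2 * i) h = 0) /\
    (forall x, even_comb (S n) c (egf (z k)) x
       = rsum (fun j => a (k - j)%nat * egf (z j) O x) k
         + rsum (fun j => b (k - j)%nat * stirling_odd h j O x) k).
Proof.
intros hp Hn cn c0 croot; induction K as [|K [z Hz]].
{ exists (fun _ _ => 0); intros; lia. }
set (q := fun i => 1 * rsum (fun j => a (K - j)%nat * z j i) K
                 + 1 * rsum (fun j => b (K - j)%nat * stirling_odd h j i 0) K).
assert (E1 : exp_bounded (fun i => rsum (fun j => a (K - j)%nat * z j i) K)).
{ apply exp_bounded_rsum; intros; now apply Hz. }
assert (E2 : exp_bounded (fun i => rsum (fun j => b (K - j)%nat * stirling_odd h j i 0) K)).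
{ apply (exp_bounded_rsum (fun j i => stirling_odd h j i 0)).
  intros; apply exp_bounded_jet, poly_tower_stirling_odd. }
destruct (navier_solve h n c q) as (w & Hw & ow & Aw & bw); auto.
- now apply exp_bounded_comb.
- intros i; unfold q; rewrite !rsum_eq0; [ring| |].
  + intros j _; rewrite (odd_seq_jet (stirling_odd h j)); [ring| |].
    * apply poly_tower_stirling_odd.
    * apply parity_stirling_odd.
  + intros j Hj; destruct (Hz j Hj) as (_ & oz & _); rewrite oz; ring.
- exists (fun k => if Nat.eqb k K then w else z k); intros k Hk.
  assert (lower : forall (f : nat -> R) x, rsum (fun j => f (k - j)%nat
      * egf (if Nat.eqb j K then w else z j) O x) k
      = rsum (fun j => f (k - j)%nat * egf (z j) O x) k).
  { intros f x; apply rsum_ext; intros j Hj.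
    replace (Nat.eqb j K) with false; [reflexivity|symmetry; apply Nat.eqb_neq; lia]. }
  destruct (Nat.eqb_spec k K) as [->|kn].
  + repeat split; auto; intros x; rewrite Aw, lower; unfold q.
    rewrite egf_comb, (egf_rsum z), (egf_rsum (fun j i => stirling_odd h j i 0)), !Rmult_1_l; auto.
    * f_equal; apply rsum_ext; intros j _; rewrite egf_jet; [reflexivity|].
      apply poly_tower_stirling_odd.
    * intros; apply exp_bounded_jet, poly_tower_stirling_odd.
    * intros; now apply Hz.
  + destruct (Hz k ltac:(lia)) as (H1 & H2 & H3 & H4); repeat split; auto.
    intros x; now rewrite H4, lower.
Qed.

(** * Linear functions of the grid values and the chain rule *)

Definition grid_linear (phi : grid -> R) : Prop :=
  forall (a b : R) (u v : grid),
    phi (fun i => a * u i + b * v i) = a * phi u + b * phi v.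

Lemma list_Rsum_map_ext {A : Type} (f g : A -> R) (l : list A) :
  (forall t, In t l -> f t = g t) -> list_Rsum (map f l) = list_Rsum (map g l).
Proof. intros H; f_equal; now apply map_ext_in. Qed.

Lemma list_Rsum_map_comb {A : Type} (a b : R) (f g : A -> R) (l : list A) :
  list_Rsum (map (fun t => a * f t + b * g t) l)
  = a * list_Rsum (map f l) + b * list_Rsum (map g l).
Proof. induction l as [|t l IH]; simpl; [ring|rewrite IH; ring]. Qed.

Lemma list_Rsum_map_scal {A : Type} (a : R) (f : A -> R) (l : list A) :
  list_Rsum (map (fun t => a * f t) l) = a * list_Rsum (map f l).
Proof. induction l as [|t l IH]; simpl; [ring|rewrite IH; ring]. Qed.

Lemma list_Rsum_map_0 {A : Type} (f : A -> R) (l : list A) :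
  (forall t, In t l -> f t = 0) -> list_Rsum (map f l) = 0.
Proof.
induction l as [|t l IH]; simpl; intros H; [reflexivity|].
rewrite IH, H; auto; ring.
Qed.

Lemma list_Rsum_map_pos {A : Type} (f : A -> R) (l : list A) :
  (forall t, 0 <= f t) -> 0 <= list_Rsum (map f l).
Proof.
intros H; induction l as [|t l IH]; simpl; [lra|specialize (H t); lra].
Qed.

Lemma list_Rsum_map_term_le {A : Type} (f : A -> R) (l : list A) (t : A) :
  (forall t, 0 <= f t) -> In t l -> f t <= list_Rsum (map f l).
Proof.
intros H; induction l as [|s l IH]; simpl; [tauto|].
assert (P := list_Rsum_map_pos f l H); assert (Q := H s).
intros [->|Ht]; [lra|specialize (IH Ht); lra].
Qed.

Lemma list_Rsum_app (l l' : list R) : list_Rsum (l ++ l') = list_Rsum l + list_Rsum l'.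
Proof. induction l as [|a l IH]; simpl; [ring|rewrite IH; ring]. Qed.

Lemma diffop_apply_linear (G : diffop) (j : Z) : grid_linear (fun u => diffop_apply G u j).
Proof.
intros a b u v; unfold diffop_apply; rewrite <- list_Rsum_map_comb.
apply list_Rsum_map_ext; intros; ring.
Qed.

Lemma grid_linear_scal (phi : grid -> R) (a : R) (u : grid) :
  grid_linear phi -> phi (fun i => a * u i) = a * phi u.
Proof.
intros H; transitivity (a * phi u + 0 * phi u); [|ring].
rewrite <- H; f_equal; apply functional_extensionality; intros; ring.
Qed.

Lemma grid_linear_plus (phi : grid -> R) (u v : grid) :
  grid_linear phi -> phi (fun i => u i + v i) = phi u + phi v.
Proof.
intros H; transitivity (1 * phi u + 1 * phi v); [|ring].
rewrite <- H; f_equal; apply functional_extensionality; intros; ring.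
Qed.

(** The differentiability estimate in direction t W is homogeneous in t for a linear [phi], so
    division by t bounds the difference by eps A / (A + 1) < eps. The choice t = del / (A + 1) keeps
    t W below del on the stencil, and A + 1 covers A = 0. *)
Lemma chain_rule_linear (r : nat) (j : Z) (phi : grid -> R) (G : diffop) (u : grid) :
  grid_linear phi -> grid_differentiable r j phi ->
  chain_rule r j phi G u = phi (diffop_apply G u).
Proof.
intros Hl Hd; set (W := diffop_apply G u).
set (A := list_Rsum (map (fun i => Rabs (W i)) (stencil r j))).
assert (A0 : 0 <= A) by (apply list_Rsum_map_pos; intros; apply Rabs_pos).
symmetry; apply cond_eq; intros eps He.
assert (He' : 0 < eps / (A + 1)) by (apply Rdiv_lt_0_compat; lra).
destruct (Hd u (eps / (A + 1)) He') as (del & Hdel & HU).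
set (t := del / (A + 1)).
assert (t0 : 0 < t) by (apply Rdiv_lt_0_compat; lra).
specialize (HU (fun i => t * W i)).
rewrite (grid_linear_plus phi u) in HU by auto.
rewrite (grid_linear_scal phi t W) in HU by auto.
rewrite (list_Rsum_map_ext (fun i => grid_partial phi u i * (t * W i))
           (fun i => t * (grid_partial phi u i * W i))) in HU by (intros; ring).
rewrite (list_Rsum_map_ext (fun i => Rabs (t * W i)) (fun i => t * Rabs (W i))) in HU
  by (intros; rewrite Rabs_mult, (Rabs_pos_eq t); lra).
rewrite !list_Rsum_map_scal in HU; fold A in HU.
change (list_Rsum (map (fun i => grid_partial phi u i * W i) (stencil r j)))
  with (chain_rule r j phi G u) in HU.
replace (phi u + t * phi W - phi u - t * chain_rule r j phi G u)
  with (t * (phi W - chain_rule r j phi G u)) in HU by ring.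
rewrite Rabs_mult, (Rabs_pos_eq t) in HU by lra.
assert (HU' : t * Rabs (phi W - chain_rule r j phi G u) <= eps / (A + 1) * (t * A)).
{ apply HU; intros i Hi; rewrite Rabs_mult, (Rabs_pos_eq t) by lra.
  assert (Rabs (W i) <= A).
  { apply (list_Rsum_map_term_le (fun i => Rabs (W i))); auto; intros; apply Rabs_pos. }
  apply Rle_lt_trans with (t * A); [apply Rmult_le_compat_l; lra|].
  unfold t; rewrite <- (Rmult_1_r del) at 2; unfold Rdiv; rewrite Rmult_assoc.
  apply Rmult_lt_compat_l; [auto|].
  apply Rmult_lt_reg_l with (A + 1); [lra|].
  rewrite <- Rmult_assoc, Rinv_r, Rmult_1_l by lra; lra. }
apply Rmult_lt_reg_l with t; [auto|].
apply Rle_lt_trans with (1 := HU').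
replace (eps / (A + 1) * (t * A)) with (t * (eps * (A / (A + 1)))) by (field; lra).
apply Rmult_lt_compat_l; [auto|].
rewrite <- (Rmult_1_r eps) at 2; apply Rmult_lt_compat_l; [auto|].
apply Rmult_lt_reg_r with (A + 1); [lra|].
unfold Rdiv; rewrite Rmult_assoc, Rinv_l by lra; lra.
Qed.

Lemma in_stencil (r : nat) (j i : Z) :
  In i (stencil r j) <-> (Z.abs (i - j) <= Z.of_nat r)%Z.
Proof.
unfold stencil; rewrite in_map_iff; split.
- intros (n & <- & Hn); apply in_seq in Hn; lia.
- intros H; exists (Z.to_nat (i - j + Z.of_nat r)); split; [lia|apply in_seq; lia].
Qed.

Lemma NoDup_stencil (r : nat) (j : Z) : NoDup (stencil r j).
Proof.
apply Injective_map_NoDup; [intros a b H; lia|apply seq_NoDup].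
Qed.

Definition grid_unit (i : Z) : grid := fun k => if Z.eqb k i then 1 else 0.

Lemma list_Rsum_grid_unit (f : Z -> R) (l : list Z) (k : Z) : NoDup l -> In k l ->
  list_Rsum (map (fun i => f i * grid_unit i k) l) = f k.
Proof.
induction l as [|i l IH]; simpl; intros Hn Hk; [tauto|].
inversion Hn as [|? ? ni nl]; subst; unfold grid_unit at 1.
destruct (Z.eqb_spec k i) as [->|ki].
- rewrite list_Rsum_map_0; [ring|].
  intros m Hm; unfold grid_unit.
  destruct (Z.eqb_spec i m) as [->|]; [contradiction|ring].
- rewrite IH; auto; [ring|destruct Hk; congruence].
Qed.

Lemma grid_linear_list (phi : grid -> R) (f : Z -> R) (e : Z -> grid) (l : list Z) :
  grid_linear phi ->
  phi (fun k => list_Rsum (map (fun i => f i * e i k) l))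
  = list_Rsum (map (fun i => f i * phi (e i)) l).
Proof.
intros H; induction l as [|i l IH]; simpl.
- assert (Z := grid_linear_scal phi 0 (fun _ => 0) H).
  rewrite Rmult_0_l in Z; etransitivity; [|exact Z]; f_equal.
  apply functional_extensionality; intros; ring.
- rewrite <- IH, <- (grid_linear_scal phi (f i) (e i)) by auto.
  now rewrite <- (grid_linear_plus phi).
Qed.

Lemma grid_partial_linear (phi : grid -> R) (u : grid) (i : Z) :
  grid_linear phi -> grid_partial phi u i = phi (grid_unit i).
Proof.
intros H; unfold grid_partial.
rewrite (Derive_ext _ (fun s => phi u + (s - u i) * phi (grid_unit i))).
- apply is_derive_unique; auto_derive; [auto|ring].
- intros s; rewrite <- (grid_linear_scal phi (s - u i)), <- (grid_linear_plus phi) by auto.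
  f_equal; apply functional_extensionality; intros k.
  unfold grid_update, grid_unit; destruct (Z.eqb_spec k i) as [->|]; ring.
Qed.

(** A perturbation may be replaced by its truncation to the stencil, a finite sum of unit fields, so
    the remainder is exactly 0. *)
Lemma grid_differentiable_linear (r : nat) (j : Z) (phi : grid -> R) :
  grid_linear phi ->
  (forall u, (forall i, (Z.abs (i - j) <= Z.of_nat r)%Z -> u i = 0) -> phi u = 0) ->
  grid_differentiable r j phi.
Proof.
intros Hl Hloc u eps He; exists 1; split; [lra|intros U _].
rewrite (grid_linear_plus phi u U) by auto.
rewrite (list_Rsum_map_ext _ (fun i => U i * phi (grid_unit i)))
  by (intros; rewrite grid_partial_linear by auto; ring).
rewrite <- (grid_linear_list phi) by auto.
set (V := fun k => list_Rsum (map (fun i => U i * grid_unit i k) (stencil r j))).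
assert (E : 1 * phi U + (-1) * phi V = 0).
{ rewrite <- Hl; apply Hloc; intros i Hi; unfold V.
  rewrite list_Rsum_grid_unit; [ring|apply NoDup_stencil|now apply in_stencil]. }
replace (phi u + phi U - phi u - phi V) with 0 by lra.
rewrite Rabs_R0; apply Rmult_le_pos; [lra|].
apply list_Rsum_map_pos; intros; apply Rabs_pos.
Qed.

Lemma chain_rule_null (r : nat) (j : Z) (phi : grid -> R) (G : diffop) (u : grid) :
  (forall i, diffop_apply G u i = 0) -> chain_rule r j phi G u = 0.
Proof. intros H; apply list_Rsum_map_0; intros; rewrite H; ring. Qed.

(** Two models may have different radii and different lists for the same operator; both sides are
    the value of [phi'] at the field G u. *)
Lemma chain_rule_eq (r r' : nat) (j : Z) (phi phi' : grid -> R) (G G' : diffop) (u : grid) :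
  (forall v, phi v = phi' v) -> grid_linear phi' ->
  grid_differentiable r j phi -> grid_differentiable r' j phi' ->
  (forall i, diffop_apply G u i = diffop_apply G' u i) ->
  chain_rule r j phi G u = chain_rule r' j phi' G' u.
Proof.
intros E Hl Hd Hd' HG; apply functional_extensionality in E; subst phi.
rewrite !chain_rule_linear by auto; f_equal; now apply functional_extensionality.
Qed.

(** * Uniqueness of the model *)

(** Values of [c] outside 1, ..., M are arbitrary; setting them to 0 makes [c] the coefficient
    sequence of a polynomial without constant term. *)
Definition cut (M : nat) (c : nat -> R) (i : nat) : R :=
  if andb (Nat.leb 1 i) (Nat.leb i M) then c i else 0.

Lemma rsum_cut (n M : nat) (c f : nat -> R) :
  (forall i, (n < i)%nat -> cut M c i = 0) ->
  rsum (fun i => cut M c i * f i) (S n) = sum_n_m (fun m => c m * f m) 1 M.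
Proof.
intros H; rewrite sum_n_m_rsum.
transitivity (rsum (fun i => cut M c i * f i) (S M)).
- assert (G : forall a b, (a <= b)%nat ->
    (forall i, (a <= i < b)%nat -> cut M c i = 0) ->
    rsum (fun i => cut M c i * f i) b = rsum (fun i => cut M c i * f i) a).
  { intros a b ab; induction ab as [|b ab IH]; intros Z; [reflexivity|].
    simpl; rewrite Z, IH; [ring| |lia]; intros; apply Z; lia. }
  destruct (Nat.le_ge_cases n M).
  + symmetry; apply G; [lia|intros; apply H; lia].
  + apply G; [lia|intros i Hi; unfold cut].
    replace (Nat.leb i M) with false; [now rewrite Bool.andb_false_r|].
    symmetry; apply Nat.leb_gt; lia.
- rewrite rsum_head; replace (cut M c 0) with 0 by reflexivity.
  rewrite Rmult_0_l, Rplus_0_l; apply rsum_ext; intros i Hi.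
  unfold cut; replace (Nat.leb (S i) M) with true; [reflexivity|].
  symmetry; apply Nat.leb_le; lia.
Qed.

(** [M] only bounds the order, since top coefficients may vanish; the actual order is 2 n. The last
    clause is dissipativity at a = - alpha^2. *)
Definition half_order (M : nat) (c : nat -> R) (n : nat) : Prop :=
  (0 < n)%nat /\ cut M c n <> 0 /\ (forall i, (n < i)%nat -> cut M c i = 0) /\
  (forall a, a < 0 -> rsum (fun i => cut M c i * a ^ i) (S n) <> 0).

Lemma half_order_exists (M : nat) (c : nat -> R) :
  dissipative M c -> exists n, half_order M c n.
Proof.
intros Hd.
assert (big : forall i, (M < i)%nat -> cut M c i = 0).
{ intros i Hi; unfold cut.
  replace (Nat.leb i M) with false; [now rewrite Bool.andb_false_r|].
  symmetry; apply Nat.leb_gt; lia. }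
assert (search : forall K, (forall i, (K < i)%nat -> cut M c i = 0) ->
  (exists n, cut M c n <> 0 /\ (forall i, (n < i)%nat -> cut M c i = 0)) \/
  (forall i, cut M c i = 0)).
{ induction K as [|K IH]; intros HK.
  - right; intros [|i]; [reflexivity|apply HK; lia].
  - destruct (Req_dec (cut M c (S K)) 0) as [E|E].
    + apply IH; intros i Hi; destruct (Nat.eq_dec i (S K)) as [->|]; [auto|apply HK; lia].
    + left; exists (S K); auto. }
destruct (search M big) as [(n & cn & Hn)|all0].
- exists n; split; [|split; [|split]]; auto.
  + destruct n; [|lia]; exfalso; apply cn; reflexivity.
  + intros a Ha; rewrite (rsum_cut n M c (fun i => a ^ i)) by auto.
    assert (S := Hd (sqrt (- a))).
    rewrite pow2_sqrt, Ropp_involutive in S by lra.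
    assert (sqrt (- a) <> 0) by (assert (0 < sqrt (- a)) by (apply sqrt_lt_R0; lra); lra).
    specialize (S H); lra.
- exfalso; assert (S := Hd 1 ltac:(lra)).
  rewrite <- (rsum_cut M M c (fun i => (- (1 ^ 2)) ^ i)), rsum_eq0 in S by
    (auto; intros; rewrite all0; ring).
  lra.
Qed.

Lemma half_order_below (M : nat) (c : nat -> R) (n i : nat) :
  half_order M c n -> (i < n)%nat -> below_order M c i.
Proof.
intros (_ & cn & Hn & _) Hi; exists n; unfold cut in cn.
destruct (Nat.leb 1 n); [|simpl in cn; lra].
destruct (Nat.leb_spec n M); [|simpl in cn; lra]; split; [lia|exact cn].
Qed.

Lemma below_half_order (M : nat) (c : nat -> R) (n i : nat) :
  half_order M c n -> below_order M c i -> (i < n)%nat.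
Proof.
intros (_ & _ & Hn & _) (m & Hm & cm).
destruct (Nat.lt_ge_cases i n); auto; exfalso; apply cm.
rewrite <- (Hn m) by lia; unfold cut.
replace (Nat.leb 1 m) with true by (symmetry; apply Nat.leb_le; lia).
replace (Nat.leb m M) with true by (symmetry; apply Nat.leb_le; lia); reflexivity.
Qed.

Lemma even_op_comb (M n : nat) (c : nat -> R) (f : R -> R) (x : R) : half_order M c n ->
  even_op M c f x = even_comb (S n) (cut M c) (Derive_n f) x.
Proof.
intros (_ & _ & Hn & _); unfold even_comb, even_op.
now rewrite (rsum_cut n M c (fun m => Derive_n f (2 * m) x)).
Qed.

Lemma gridpoint_plus (h : R) (i j : Z) : gridpoint h (i + j) = gridpoint h i + gridpoint h j.
Proof. unfold gridpoint; rewrite plus_IZR; ring. Qed.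

Lemma in_element_offset (h : R) (j : Z) (x : R) :
  in_element h j (x + gridpoint h j) <-> between (- h) h x.
Proof.
unfold in_element, between; replace (x + gridpoint h j - gridpoint h j) with x by ring.
split; [intros H; now apply Rabs_le_between|intros H; now apply Rabs_le_between].
Qed.

(** [element_unique] for the difference of the fields, moved to the origin. The constant [g] will be
    the difference of the two evolutions, so fields and evolutions are identified together. *)
Lemma field_unique (h : R) (M n : nat) (c : nat -> R) (j : Z) (f1 f2 : R -> R) (g : R) :
  0 < h -> half_order M c n ->
  (forall x, in_element h j x -> forall i, ex_derive_n f1 i x) ->
  (forall x, in_element h j x -> forall i, ex_derive_n f2 i x) ->
  f1 (gridpoint h j) = f2 (gridpoint h j) ->
  (forall i s, (i < n)%nat -> (s = 1%Z \/ s = (-1)%Z) ->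
     Derive_n f1 (2 * i) (gridpoint h (j + s)) - Derive_n f1 (2 * i) (gridpoint h j)
     = Derive_n f2 (2 * i) (gridpoint h (j + s)) - Derive_n f2 (2 * i) (gridpoint h j)) ->
  (forall x, in_element h j x -> even_op M c f1 x - even_op M c f2 x = g) ->
  (forall i x, in_element h j x -> Derive_n f1 i x = Derive_n f2 i x) /\ g = 0.
Proof.
intros hp Hn S1 S2 E0 Ebc Eeq; set (xj := gridpoint h j) in *.
assert (Hn' := Hn); destruct Hn' as (n0 & cn & cbig & croot).
set (phi := fun i x => 1 * Derive_n f1 i (x + xj) + (-1) * Derive_n f2 i (x + xj)).
assert (HT : forall f, (forall x, in_element h j x -> forall i, ex_derive_n f i x) ->
   tower (between (- h) h) (fun i x => Derive_n f i (x + xj))).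
{ intros f Sf i x Hx; apply in_element_offset with (j := j) in Hx.
  apply (is_derive_ext (fun y => Derive_n f i (1 * y + xj))); [intros; now rewrite Rmult_1_l|].
  apply is_derive_eq with (1 * Derive_n f (S i) (1 * x + xj)); [|now rewrite !Rmult_1_l].
  apply is_derive_affine, Derive_correct; rewrite Rmult_1_l; exact (Sf _ Hx (S i)). }
destruct (element_unique h n (cut M c) phi g) as [Z gz]; auto.
- apply (tower_comb _ 1 (-1) (fun i x => Derive_n f1 i (x + xj))
    (fun i x => Derive_n f2 i (x + xj))); auto.
- unfold phi; rewrite Rplus_0_l; simpl; rewrite E0; ring.
- intros i Hi; unfold phi; rewrite Rplus_0_l; split.
  + specialize (Ebc i 1%Z Hi (or_introl eq_refl)); rewrite gridpoint_plus in Ebc.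
    replace (gridpoint h j + gridpoint h 1) with (h + xj) in Ebc
      by (unfold xj, gridpoint; ring); lra.
  + specialize (Ebc i (-1)%Z Hi (or_intror eq_refl)); rewrite gridpoint_plus in Ebc.
    replace (gridpoint h j + gridpoint h (-1)) with (- h + xj) in Ebc
      by (unfold xj, gridpoint; ring); lra.
- intros x Hx; unfold even_comb, phi.
  rewrite (even_comb_lin (S n) (cut M c) 1 (-1) (Derive_n f1) (Derive_n f2) (x + xj) (x + xj)).
  rewrite <- !even_op_comb by auto; rewrite <- (Eeq (x + xj)); [ring|].
  now apply in_element_offset.
- split; [|exact gz]; intros i x Hx.
  specialize (Z i (x - xj)); unfold phi in Z.
  replace (x - xj + xj) with x in Z by ring.
  assert (between (- h) h (x - xj)).
  { apply (in_element_offset h j); now replace (x - xj + gridpoint h j) with x by (unfold xj; ring). }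
  specialize (Z H); lra.
Qed.

(** All derivatives are compared, because at the ends of an element [Derive_n] also sees values
    outside it. *)
Definition same_fields (h : R) (y1 y2 : Z -> grid -> R -> R) : Prop :=
  forall (j : Z) (u : grid) (i : nat) (x : R), in_element h j x ->
    Derive_n (y1 j u) i x = Derive_n (y2 j u) i x.

Definition same_ops (G1 G2 : diffop) : Prop :=
  forall (u : grid) (j : Z), diffop_apply G1 u j = diffop_apply G2 u j.

Lemma in_element_center (h : R) (j : Z) : 0 < h -> in_element h j (gridpoint h j).
Proof.
intros; unfold in_element; replace (gridpoint h j - gridpoint h j) with 0 by ring.
rewrite Rabs_R0; lra.
Qed.

(** Coupling carries a factor gamma, so the jump of the order k field is determined by the fields of
    order k - 1. *)
Lemma same_fields_bc (h : R) (l k n : nat) (y1 y2 : nat -> Z -> grid -> R -> R) (j s : Z) (u : grid) :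
  0 < h -> (k < l)%nat -> (s = 1%Z \/ s = (-1)%Z) ->
  (forall p, (p < k)%nat -> same_fields h (y1 p) (y2 p)) ->
  internal_bc h l y1 n -> internal_bc h l y2 n ->
  Derive_n (y1 k j u) n (gridpoint h (j + s)) - Derive_n (y1 k j u) n (gridpoint h j)
  = Derive_n (y2 k j u) n (gridpoint h (j + s)) - Derive_n (y2 k j u) n (gridpoint h j).
Proof.
intros hp Hk Hs IH B1 B2; rewrite (B1 k j s u Hk Hs), (B2 k j s u Hk Hs).
destruct k as [|k]; cbn [gamma_times]; [ring|].
rewrite (IH k ltac:(lia) j u n), (IH k ltac:(lia) (j + s)%Z u n);
  [ring|now apply in_element_center|now apply in_element_center].
Qed.

Section Uniqueness.

Context {h : R} {l M N : nat} {c d : nat -> R} {E1 E2 : expansion}.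
Context (hpos : 0 < h) (Adiss : dissipative M c)
  (H1 : centre_manifold_model h l M c N d E1) (H2 : centre_manifold_model h l M c N d E2).
Context
  (lin_v : forall k j x, (k < l)%nat -> in_element h j x -> grid_linear (fun u => vfield E2 k j u x))
  (lin_w : forall k j x, (k < l)%nat -> in_element h j x -> grid_linear (fun u => wfield E2 k j u x))
  (g0 : forall u j, diffop_apply (gop E2 0) u j = 0).

Lemma chain_rule_neutral (E : expansion) (G : diffop) (j : Z) (u : grid) (x : R) :
  (0 < l)%nat -> centre_manifold_model h l M c N d E -> in_element h j x ->
  chain_rule (radius E) j (fun u' => vfield E 0 j u' x) G u = diffop_apply G u j.
Proof.
intros lp H Hx.
assert (Eq : forall u', vfield E 0 j u' x = u' j) by (intros; now apply (cmm_neutral _ _ _ _ _ _ _ H)).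
rewrite chain_rule_linear; [now rewrite Eq| |].
- intros a b v w; now rewrite !Eq.
- destruct (cmm_regular_v _ _ _ _ _ _ _ H 0%nat lp) as (_ & D & _); now apply D.
Qed.

Lemma bc_below (E : expansion) (n i : nat) : half_order M c n -> (i < n)%nat ->
  centre_manifold_model h l M c N d E ->
  internal_bc h l (vfield E) (2 * i) /\ internal_bc h l (wfield E) (2 * i).
Proof.
intros Hn Hi H; destruct i as [|i].
- split; [apply (cmm_internal_v _ _ _ _ _ _ _ H)|apply (cmm_internal_w _ _ _ _ _ _ _ H)].
- apply (cmm_closure _ _ _ _ _ _ _ H); [lia|now apply (half_order_below M c n)].
Qed.

(** In the order k equation g^k enters only through the neutral field u_j, as a constant in x; the
    product of v^k with g^0 drops out as g^0 = 0. The other products have lower orders and agree by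
    induction, which also carries linearity in the grid values from [E2] to [E1]. What is left is A
    of the field difference equal to a constant. *)
Lemma model_unique_v (k : nat) : (k < l)%nat ->
  same_fields h (vfield E1 k) (vfield E2 k) /\ same_ops (gop E1 k) (gop E2 k).
Proof.
destruct (half_order_exists M c Adiss) as [n Hn].
induction k as [k IH] using (well_founded_induction Wf_nat.lt_wf); intros Hk.
assert (lp : (0 < l)%nat) by lia.
assert (R1 := cmm_regular_v _ _ _ _ _ _ _ H1 k Hk); destruct R1 as (S1 & _).
assert (R2 := cmm_regular_v _ _ _ _ _ _ _ H2 k Hk); destruct R2 as (S2 & _).
assert (key : forall j u,
  (forall i x, in_element h j x ->
     Derive_n (vfield E1 k j u) i x = Derive_n (vfield E2 k j u) i x) /\
  diffop_apply (gop E1 k) u j - diffop_apply (gop E2 k) u j = 0).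
{ intros j u; apply (field_unique h M n c j); auto.
  - destruct (cmm_amplitude _ _ _ _ _ _ _ H1 k j u Hk) as [-> _].
    now destruct (cmm_amplitude _ _ _ _ _ _ _ H2 k j u Hk) as [-> _].
  - intros i s Hi Hs; apply (same_fields_bc h l k (2 * i) (vfield E1) (vfield E2)); auto.
    + intros p Hp; now apply IH; [|lia].
    + now apply (bc_below E1 n i Hn Hi).
    + now apply (bc_below E2 n i Hn Hi).
  - intros x Hx.
    rewrite <- (cmm_pde_gamma _ _ _ _ _ _ _ H1 k j u x Hk Hx).
    rewrite <- (cmm_pde_gamma _ _ _ _ _ _ _ H2 k j u x Hk Hx).
    rewrite !sum_n_rsum, !rsum_head, !Nat.sub_0_r, !chain_rule_neutral by auto.
    destruct k as [|k]; [simpl; ring|]; cbn [rsum]; rewrite !Nat.sub_diag.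
    rewrite (chain_rule_null _ _ _ (gop E2 0)) by auto.
    rewrite (chain_rule_null _ _ _ (gop E1 0)).
    2: { intros i; rewrite <- (g0 u i); now apply (IH 0%nat); lia. }
    rewrite (rsum_ext (fun i => chain_rule (radius E1) j (fun u' => vfield E1 (S i) j u' x)
                          (gop E1 (S k - S i)) u)
      (fun i => chain_rule (radius E2) j (fun u' => vfield E2 (S i) j u' x)
                          (gop E2 (S k - S i)) u)); [ring|].
    intros i Hi; apply chain_rule_eq.
    + intros v; now apply (IH (S i) ltac:(lia) ltac:(lia)) with (i := 0%nat).
    + apply lin_v; [lia|auto].
    + apply (cmm_regular_v _ _ _ _ _ _ _ H1 (S i)); [lia|auto].
    + apply (cmm_regular_v _ _ _ _ _ _ _ H2 (S i)); [lia|auto].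
    + apply (IH (S k - S i)%nat); lia. }
split; intros j u; [now apply key|].
destruct (key u j); lra.
Qed.

(** The same elimination for w^k and f^k; the terms B v^k cancel since all derivatives of the two
    v^k agree. *)
Lemma model_unique_w (k : nat) : (k < l)%nat ->
  same_fields h (wfield E1 k) (wfield E2 k) /\ same_ops (fop E1 k) (fop E2 k).
Proof.
destruct (half_order_exists M c Adiss) as [n Hn].
induction k as [k IH] using (well_founded_induction Wf_nat.lt_wf); intros Hk.
assert (lp : (0 < l)%nat) by lia.
assert (R1 := cmm_regular_w _ _ _ _ _ _ _ H1 k Hk); destruct R1 as (S1 & _).
assert (R2 := cmm_regular_w _ _ _ _ _ _ _ H2 k Hk); destruct R2 as (S2 & _).
assert (key : forall j u,
  (forall i x, in_element h j x ->
     Derive_n (wfield E1 k j u) i x = Derive_n (wfield E2 k j u) i x) /\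
  diffop_apply (fop E1 k) u j - diffop_apply (fop E2 k) u j = 0).
{ intros j u; apply (field_unique h M n c j); auto.
  - destruct (cmm_amplitude _ _ _ _ _ _ _ H1 k j u Hk) as [_ ->].
    now destruct (cmm_amplitude _ _ _ _ _ _ _ H2 k j u Hk) as [_ ->].
  - intros i s Hi Hs; apply (same_fields_bc h l k (2 * i) (wfield E1) (wfield E2)); auto.
    + intros p Hp; now apply IH; [|lia].
    + now apply (bc_below E1 n i Hn Hi).
    + now apply (bc_below E2 n i Hn Hi).
  - intros x Hx.
    assert (P1 := cmm_pde_eps_gamma _ _ _ _ _ _ _ H1 k j u x Hk Hx).
    assert (P2 := cmm_pde_eps_gamma _ _ _ _ _ _ _ H2 k j u x Hk Hx).
    assert (OE : odd_op N d (vfield E1 k j u) x = odd_op N d (vfield E2 k j u) x).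
    { unfold odd_op; rewrite !sum_n_m_rsum; apply rsum_ext; intros i _; f_equal.
      now apply model_unique_v. }
    rewrite sum_n_rsum, rsum_plus, rsum_head, Nat.sub_0_r, chain_rule_neutral in P1, P2 by auto.
    cbn [rsum] in P1, P2; rewrite Nat.sub_diag in P1, P2.
    rewrite (chain_rule_null _ _ _ (gop E2 0)) in P2 by auto.
    rewrite (chain_rule_null _ _ _ (gop E1 0)) in P1
      by (intros i; rewrite <- (g0 u i); now apply (model_unique_v 0)).
    assert (T1 : rsum (fun i => chain_rule (radius E1) j (fun u' => vfield E1 (S i) j u' x)
                          (fop E1 (k - S i)) u) k
       = rsum (fun i => chain_rule (radius E2) j (fun u' => vfield E2 (S i) j u' x)
                          (fop E2 (k - S i)) u) k).
    { apply rsum_ext; intros i Hi; apply chain_rule_eq.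
      - intros v; now apply (model_unique_v (S i) ltac:(lia)) with (i := 0%nat).
      - apply lin_v; [lia|auto].
      - apply (cmm_regular_v _ _ _ _ _ _ _ H1 (S i)); [lia|auto].
      - apply (cmm_regular_v _ _ _ _ _ _ _ H2 (S i)); [lia|auto].
      - apply (IH (k - S i)%nat); lia. }
    assert (T2 : rsum (fun i => chain_rule (radius E1) j (fun u' => wfield E1 i j u' x)
                          (gop E1 (k - i)) u) k
       = rsum (fun i => chain_rule (radius E2) j (fun u' => wfield E2 i j u' x)
                          (gop E2 (k - i)) u) k).
    { apply rsum_ext; intros i Hi; apply chain_rule_eq.
      - intros v; now apply (IH i ltac:(lia) ltac:(lia)) with (i := 0%nat).
      - apply lin_w; [lia|auto].
      - apply (cmm_regular_w _ _ _ _ _ _ _ H1 i); [lia|auto].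
      - apply (cmm_regular_w _ _ _ _ _ _ _ H2 i); [lia|auto].
      - apply (model_unique_v (k - i)%nat); lia. }
    rewrite T1, T2 in P1; lra. }
split; intros j u; [now apply key|].
destruct (key u j); lra.
Qed.

End Uniqueness.

(** * Difference operators *)

Definition diffop_comp (G H : diffop) : diffop :=
  concat (map (fun t => map (fun s => (fst t * fst s, (snd t + snd s)%Z)) H) G).

Lemma diffop_apply_comp (G H : diffop) (u : grid) (j : Z) :
  diffop_apply (diffop_comp G H) u j = diffop_apply G (diffop_apply H u) j.
Proof.
unfold diffop_comp; induction G as [|[a n] G IH]; [reflexivity|].
unfold diffop_apply in *; simpl; rewrite map_app, list_Rsum_app, IH; f_equal.
rewrite map_map, <- list_Rsum_map_scal; apply list_Rsum_map_ext.
intros [b m] _; simpl; rewrite Z.add_assoc; ring.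
Qed.

Lemma diffop_apply_sum (g : nat -> diffop) (l : nat) (u : grid) (j : Z) :
  diffop_apply (diffop_sum g l) u j = rsum (fun k => diffop_apply (g k) u j) l.
Proof.
unfold diffop_sum; induction l as [|l IH]; [reflexivity|].
rewrite seq_S, map_app, concat_app; unfold diffop_apply in *.
rewrite map_app, list_Rsum_app, IH; simpl; now rewrite app_nil_r.
Qed.

Lemma diffop_apply_shift (G : diffop) (u : grid) (i j : Z) :
  diffop_apply G (shift j u) i = diffop_apply G u (i + j).
Proof.
apply list_Rsum_map_ext; intros; unfold shift; do 2 f_equal; lia.
Qed.

Fixpoint delta2_pow (k : nat) : diffop :=
  match k with
  | O => [(1, 0%Z)]
  | S k' => diffop_comp [(1, 1%Z); (-2, 0%Z); (1, (-1)%Z)] (delta2_pow k')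
  end.

(* mu delta^(2k-1); the zero operator for k = 0. *)
Definition mu_delta (k : nat) : diffop :=
  match k with
  | O => []
  | S k' => diffop_comp [(1 / 2, 1%Z); (- (1 / 2), (-1)%Z)] (delta2_pow k')
  end.

Definition delta2 (k : nat) (u : grid) : grid := diffop_apply (delta2_pow k) u.
Definition mudelta (k : nat) (u : grid) : grid := diffop_apply (mu_delta k) u.

Lemma delta2_0 (u : grid) (j : Z) : delta2 0 u j = u j.
Proof. unfold delta2, diffop_apply; simpl; rewrite Z.add_0_r; ring. Qed.

Lemma delta2_S (k : nat) (u : grid) (j : Z) :
  delta2 (S k) u j = delta2 k u (j + 1)%Z - 2 * delta2 k u j + delta2 k u (j - 1)%Z.
Proof.
unfold delta2; cbn [delta2_pow]; rewrite diffop_apply_comp.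
unfold diffop_apply at 1; simpl; rewrite Z.add_0_r; unfold Z.sub; simpl; ring.
Qed.

Lemma mudelta_0 (u : grid) (j : Z) : mudelta 0 u j = 0.
Proof. reflexivity. Qed.

Lemma mudelta_S (k : nat) (u : grid) (j : Z) :
  mudelta (S k) u j = (delta2 k u (j + 1)%Z - delta2 k u (j - 1)%Z) / 2.
Proof.
unfold mudelta, delta2; cbn [mu_delta]; rewrite diffop_apply_comp.
unfold diffop_apply at 1; simpl; unfold Z.sub; simpl; field.
Qed.

Lemma delta2_delta2 (p q : nat) (u : grid) (j : Z) :
  delta2 p (delta2 q u) j = delta2 (p + q) u j.
Proof.
revert j; induction p as [|p IH]; intros j; [apply delta2_0|].
simpl Nat.add; rewrite !delta2_S, !IH; ring.
Qed.

Lemma mudelta_delta2 (p q : nat) (u : grid) (j : Z) :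
  mudelta (S p) (delta2 q u) j = mudelta (S (p + q)) u j.
Proof. rewrite !mudelta_S, !delta2_delta2; reflexivity. Qed.

Lemma delta2_mudelta (p q : nat) (u : grid) (j : Z) :
  delta2 p (mudelta (S q) u) j = mudelta (S (p + q)) u j.
Proof.
revert j; induction p as [|p IH]; intros j; [apply delta2_0|].
rewrite delta2_S, !IH; simpl Nat.add; rewrite !mudelta_S, !delta2_S.
replace (j + 1 - 1)%Z with j by lia; replace (j - 1 + 1)%Z with j by lia; field.
Qed.

Lemma mudelta_mudelta (p q : nat) (u : grid) (j : Z) :
  mudelta (S p) (mudelta (S q) u) j = delta2 (S (p + q)) u j + delta2 (S (S (p + q))) u j / 4.
Proof.
rewrite mudelta_S, !delta2_mudelta, !mudelta_S, (delta2_S (S (p + q))), !delta2_S.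
replace (j + 1 - 1)%Z with j by lia; replace (j - 1 + 1)%Z with j by lia; field.
Qed.

Lemma delta2_local (k : nat) (u : grid) (j : Z) :
  (forall i, (Z.abs (i - j) <= Z.of_nat k)%Z -> u i = 0) -> delta2 k u j = 0.
Proof.
revert j; induction k as [|k IH]; intros j H; [rewrite delta2_0; apply H; lia|].
rewrite delta2_S, !IH; [ring| | |]; intros i Hi; apply H; lia.
Qed.

Lemma mudelta_local (k : nat) (u : grid) (j : Z) :
  (forall i, (Z.abs (i - j) <= Z.of_nat k)%Z -> u i = 0) -> mudelta k u j = 0.
Proof.
destruct k as [|k]; intros H; [reflexivity|].
rewrite mudelta_S, !delta2_local; [field| |]; intros i Hi; apply H; lia.
Qed.

Lemma grid_linear_delta2 (k : nat) (j : Z) : grid_linear (fun u => delta2 k u j).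
Proof. apply diffop_apply_linear. Qed.

Lemma grid_linear_mudelta (k : nat) (j : Z) : grid_linear (fun u => mudelta k u j).
Proof. apply diffop_apply_linear. Qed.

Lemma Derive_n_tower (phi : nat -> R -> R) (a : R) :
  tower (fun _ => True) phi -> forall n x,
  Derive_n (fun y => phi O (y - a)) n x = phi n (x - a) /\
  ex_derive_n (fun y => phi O (y - a)) n x.
Proof.
intros H.
assert (D : forall n x, is_derive (fun y => phi n (y - a)) x (phi (S n) (x - a))).
{ intros n x; apply (is_derive_ext (fun y => phi n (1 * y + - a))).
  - intros; f_equal; ring.
  - apply is_derive_eq with (1 * phi (S n) (1 * x + - a)).
    + apply is_derive_affine, H, I.
    + rewrite Rmult_1_l; f_equal; ring. }
assert (E : forall n x, Derive_n (fun y => phi O (y - a)) n x = phi n (x - a)).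
{ induction n as [|n IH]; intros x; [reflexivity|]; cbn [Derive_n].
  rewrite (Derive_ext _ (fun y => phi n (y - a))) by auto.
  apply is_derive_unique, D. }
intros n x; split; [apply E|]; destruct n as [|n]; [exact I|]; cbn [ex_derive_n].
apply (ex_derive_ext (fun y => phi n (y - a))); [intros; now rewrite E|].
eexists; apply D.
Qed.

(** * The model *)

Definition even_orders (m : nat) : nat := (2 * m)%nat.
Definition odd_orders (m : nat) : nat := (2 * m + 1)%nat.

Lemma even_ordersP (m : nat) : Nat.Even (even_orders m).
Proof. now exists m. Qed.

Lemma odd_ordersP (m : nat) : Nat.Odd (odd_orders m).
Proof. now exists m. Qed.

(* The order gamma^k part of cosh (y D) u_j + gamma mu delta (sinh (y D) / sinh (h D)) u_j. *)
Definition v_tower (h : R) (k : nat) (j : Z) (u : grid) (i : nat) (y : R) : R :=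
  delta2 k u j * stirling_even h k i y
  + mudelta k u j * gamma_times (fun k' => stirling_odd h k' i y) k.

(* The order gamma^k part of - (1 - gamma) sum_k gamma^k delta^(2k) z_k. *)
Definition w_tower (z : nat -> nat -> R) (k : nat) (j : Z) (u : grid) (i : nat) (y : R) : R :=
  - delta2 k u j * egf (z k) i y
  + gamma_times (fun k' => delta2 k' u j) k * gamma_times (fun k' => egf (z k') i y) k.

Definition model (h : R) (l : nat) (a b : nat -> R) (z : nat -> nat -> R) : expansion := {|
  radius := l;
  vfield := fun k j u x => v_tower h k j u O (x - gridpoint h j);
  wfield := fun k j u x => w_tower z k j u O (x - gridpoint h j);
  gop := fun k => diffop_comp [(a k, 0%Z)] (delta2_pow k);
  fop := fun k => diffop_comp [(gamma_times b k, 0%Z)] (mu_delta k)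
|}.

Lemma diffop_apply_scaled (a : R) (G : diffop) (u : grid) (j : Z) :
  diffop_apply (diffop_comp [(a, 0%Z)] G) u j = a * diffop_apply G u j.
Proof.
rewrite diffop_apply_comp; unfold diffop_apply at 1; simpl; rewrite Z.add_0_r; ring.
Qed.

Lemma gop_model (h : R) (l : nat) (a b : nat -> R) (z : nat -> nat -> R) (k : nat) (u : grid) :
  diffop_apply (gop (model h l a b z) k) u = fun i => a k * delta2 k u i.
Proof. apply functional_extensionality; intros; apply diffop_apply_scaled. Qed.

Lemma fop_model (h : R) (l : nat) (a b : nat -> R) (z : nat -> nat -> R) (k : nat) (u : grid) :
  diffop_apply (fop (model h l a b z) k) u = fun i => gamma_times b k * mudelta k u i.
Proof. apply functional_extensionality; intros; apply diffop_apply_scaled. Qed.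

Lemma v_linear (h : R) (k : nat) (j : Z) (i : nat) (y : R) :
  grid_linear (fun u => v_tower h k j u i y).
Proof.
intros a b u v; unfold v_tower.
rewrite (grid_linear_delta2 k j a b u v), (grid_linear_mudelta k j a b u v); ring.
Qed.

Lemma w_linear (z : nat -> nat -> R) (k : nat) (j : Z) (i : nat) (y : R) :
  grid_linear (fun u => w_tower z k j u i y).
Proof.
intros a b u v; unfold w_tower.
rewrite (grid_linear_delta2 k j a b u v).
destruct k as [|k]; cbn [gamma_times]; [|rewrite (grid_linear_delta2 k j a b u v)]; ring.
Qed.

Lemma tower_v (h : R) (k : nat) (j : Z) (u : grid) : tower (fun _ => True) (v_tower h k j u).
Proof.
apply tower_comb; [apply poly_tower_stirling_even|destruct k as [|k]].
- apply poly_tower_0.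
- apply poly_tower_stirling_odd.
Qed.

Lemma tower_w (z : nat -> nat -> R) (k : nat) (j : Z) (u : grid) :
  (forall k', (k' <= k)%nat -> exp_bounded (z k')) ->
  tower (fun _ => True) (w_tower z k j u).
Proof.
intros Hz; apply tower_comb; [apply tower_egf; auto|destruct k as [|k]].
- apply poly_tower_0.
- apply tower_egf; auto.
Qed.

(** * Boundary conditions of the explicit fields *)

Lemma gridpoint_diff (h : R) (j s : Z) : gridpoint h (j + s) - gridpoint h j = IZR s * h.
Proof. rewrite gridpoint_plus; unfold gridpoint; ring. Qed.

Lemma gamma_times_ext (f g : nat -> R) (k : nat) :
  (forall k', (k' < k)%nat -> f k' = g k') -> gamma_times f k = gamma_times g k.
Proof. destruct k; simpl; auto. Qed.

Lemma even_level_opp (s : R) (phi : nat -> R -> R) (i : nat) (x : R) :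
  tower (fun _ => True) phi -> parity s phi -> phi (2 * i)%nat (- x) = s * phi (2 * i)%nat x.
Proof. intros Ht Hs; rewrite (parity_level s phi Ht Hs), pow_1_even; ring. Qed.

(** Rests on delta^2 / 2 + s mu delta = E^s - 1 for s = 1, -1. The first term comes from the value
    of [stirling_even] at h, which by evenness exceeds that at 0 by half its second difference; the
    second from [stirling_odd] at h, which equals [stirling_even] at 0. The argument holds for every
    even derivative. *)
Lemma v_internal_bc (h : R) (l i : nat) : 0 < h ->
  internal_bc h l (fun k j u x => v_tower h k j u O (x - gridpoint h j)) (2 * i).
Proof.
intros hp k j s u Hk Hs; assert (hn : h <> 0) by lra; cbv beta zeta.
set (V := fun k j y => v_tower h k j u (2 * i) y).
assert (D : forall k j x, Derive_n (fun x => v_tower h k j u O (x - gridpoint h j)) (2 * i) x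
   = V k j (x - gridpoint h j)).
{ intros; apply (Derive_n_tower (v_tower h k0 j0 u)), tower_v. }
rewrite !D, gridpoint_diff, Rminus_diag.
rewrite (gamma_times_ext _ (fun k' => V k' j 0)) by (intros; rewrite D, Rminus_diag; auto).
rewrite (gamma_times_ext (fun k' => Derive_n _ _ (gridpoint h (j + s)))
  (fun k' => V k' (j + s)%Z 0)) by (intros; rewrite D, Rminus_diag; auto).
assert (PQ : forall k, tower (fun _ => True) (stirling_even h k) /\
                       tower (fun _ => True) (stirling_odd h k)).
{ intros; split; [apply poly_tower_stirling_even|apply poly_tower_stirling_odd]. }
assert (Q0 : forall k, stirling_odd h k (2 * i) 0 = 0).
{ intros k0; assert (E := even_level_opp (-1) (stirling_odd h k0) i 0 (proj2 (PQ k0))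
    (parity_stirling_odd h k0)); rewrite Ropp_0 in E; lra. }
assert (Qm : forall k x, stirling_odd h k (2 * i) (- x) = - stirling_odd h k (2 * i) x).
{ intros; rewrite (even_level_opp (-1)); [ring|apply PQ|apply parity_stirling_odd]. }
assert (Pm : forall k x, stirling_even h k (2 * i) (- x) = stirling_even h k (2 * i) x).
{ intros; rewrite (even_level_opp 1); [ring|apply PQ|apply parity_stirling_even]. }
assert (Qh : forall k, stirling_odd h k (2 * i) h = stirling_even h k (2 * i) 0).
{ intros k0; unfold stirling_even, cmean; rewrite Rplus_0_l.
  replace (0 - h) with (- h) by ring; rewrite Qm; field. }
assert (V0 : forall k j, V k j 0 = delta2 k u j * stirling_even h k (2 * i) 0).
{ intros k0 j0; unfold V, v_tower; destruct k0; cbn [gamma_times]; rewrite ?Q0; ring. }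
rewrite (gamma_times_ext (fun k' => V k' j 0) _ k (fun k' _ => V0 k' j)).
rewrite (gamma_times_ext (fun k' => V k' (j + s)%Z 0) _ k (fun k' _ => V0 k' (j + s)%Z)).
rewrite V0.
assert (Vs : V k j (IZR s * h) = delta2 k u j * stirling_even h k (2 * i) h
   + IZR s * mudelta k u j * gamma_times (fun k' => stirling_even h k' (2 * i) 0) k).
{ unfold V, v_tower; destruct Hs as [-> | ->].
  - rewrite Rmult_1_l.
    rewrite (gamma_times_ext _ (fun k' => stirling_even h k' (2 * i) 0)) by auto; ring.
  - replace (-1 * h) with (- h) by ring; rewrite Pm.
    rewrite (gamma_times_ext _ (fun k' => - stirling_even h k' (2 * i) 0))
      by (intros; rewrite Qm, Qh; auto).
    destruct k; cbn [gamma_times]; ring. }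
rewrite Vs.
assert (Ph : forall k, stirling_even h k (2 * i) h = stirling_even h k (2 * i) 0
   + gamma_times (fun k' => stirling_even h k' (2 * i) 0) k / 2).
{ intros k0.
  assert (C : cdiff2 h (stirling_even h k0 (2 * i)) 0
    = gamma_times (fun k' => stirling_even h k' (2 * i) 0) k0).
  { destruct k0; [now apply cdiff2_stirling_even_0|now apply cdiff2_stirling_even]. }
  unfold cdiff2 in C; rewrite Rplus_0_l in C; replace (0 - h) with (- h) in C by ring.
  rewrite Pm in C; lra. }
rewrite Ph; destruct k as [|k]; cbn [gamma_times]; [rewrite mudelta_0; field|].
rewrite delta2_S, mudelta_S; destruct Hs as [-> | ->].
- field.
- replace (j + -1)%Z with (j - 1)%Z by lia; field.
Qed.

Lemma egf_even_at_0 (w : nat -> R) (i : nat) : odd_seq w -> egf w (2 * i) 0 = 0.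
Proof. intros H; now rewrite egf_at_0. Qed.

Lemma w_zero (z : nat -> nat -> R) (k : nat) (j : Z) (u : grid) (i : nat) (y : R) :
  (forall k', (k' <= k)%nat -> egf (z k') i y = 0) -> w_tower z k j u i y = 0.
Proof.
intros H; unfold w_tower; rewrite H by auto.
destruct k; cbn [gamma_times]; [ring|rewrite H by auto; ring].
Qed.

(** By oddness and the Navier conditions the even derivatives in question vanish at all three grid
    points, so every term is 0. *)
Lemma w_internal_bc (h : R) (l i : nat) (z : nat -> nat -> R) :
  (forall k, (k < l)%nat -> exp_bounded (z k) /\ odd_seq (z k) /\ egf (z k) (2 * i) h = 0) ->
  internal_bc h l (fun k j u x => w_tower z k j u O (x - gridpoint h j)) (2 * i).
Proof.
intros Hz k j s u Hk Hs; cbv beta zeta.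
assert (D : forall k j x, (k < l)%nat ->
  Derive_n (fun x => w_tower z k j u O (x - gridpoint h j)) (2 * i) x
   = w_tower z k j u (2 * i) (x - gridpoint h j)).
{ intros k0 j0 x Hk0; apply (Derive_n_tower (w_tower z k0 j0 u)), tower_w.
  intros; apply Hz; lia. }
assert (Z0 : forall k j, (k < l)%nat -> w_tower z k j u (2 * i) 0 = 0).
{ intros; apply w_zero; intros; apply egf_even_at_0, Hz; lia. }
rewrite !D, gridpoint_diff, Rminus_diag, Z0 by auto.
rewrite (gamma_times_ext _ (fun _ => 0)) by (intros; rewrite D, Rminus_diag, Z0 by lia; auto).
rewrite (gamma_times_ext (fun k' => Derive_n _ _ (gridpoint h (j + s))) (fun _ => 0))
  by (intros; rewrite D, Rminus_diag, Z0 by lia; auto).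
rewrite w_zero; [ring|intros k' Hk'].
destruct (Hz k' ltac:(lia)) as (_ & oz & bz); destruct Hs as [-> | ->].
- now rewrite Rmult_1_l.
- replace (-1 * h) with (- h) by ring; rewrite egf_odd, bz by auto; ring.
Qed.

(** * Field equations of the explicit model *)

Lemma even_op_v (h : R) (M n : nat) (c : nat -> R) (k : nat) (j : Z) (u : grid) (x : R) :
  half_order M c n ->
  even_op M c (fun x => v_tower h k j u O (x - gridpoint h j)) x
  = even_comb (S n) (cut M c) (v_tower h k j u) (x - gridpoint h j).
Proof.
intros Hn; rewrite (even_op_comb M n) by auto; apply rsum_ext; intros m _; f_equal.
apply (Derive_n_tower (v_tower h k j u)), tower_v.
Qed.

Lemma even_op_w (h : R) (M n : nat) (c : nat -> R) (z : nat -> nat -> R) (k : nat) (j : Z) (u : grid) (x : R) :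
  half_order M c n -> (forall k', (k' <= k)%nat -> exp_bounded (z k')) ->
  even_op M c (fun x => w_tower z k j u O (x - gridpoint h j)) x
  = even_comb (S n) (cut M c) (w_tower z k j u) (x - gridpoint h j).
Proof.
intros Hn Hz; rewrite (even_op_comb M n) by auto; apply rsum_ext; intros m _; f_equal.
now apply (Derive_n_tower (w_tower z k j u)), tower_w.
Qed.

Definition odd_coefs (d : nat -> R) (m : nat) : R := d (S m).

Lemma odd_op_v (h : R) (N : nat) (d : nat -> R) (k : nat) (j : Z) (u : grid) (x : R) :
  odd_op N d (fun x => v_tower h k j u O (x - gridpoint h j)) x
  = diff_op N (odd_coefs d) odd_orders (v_tower h k j u) O (x - gridpoint h j).
Proof.
unfold odd_op; rewrite sum_n_m_rsum; apply rsum_ext; intros m _.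
unfold odd_coefs; f_equal.
replace (2 * S m - 1)%nat with (0 + odd_orders m)%nat by (unfold odd_orders; lia).
apply (Derive_n_tower (v_tower h k j u)), tower_v.
Qed.

(** The polynomial of index 0 is the constant 1, which A annihilates; hence g^0 = 0. *)
Lemma even_coef_0 (h : R) (n M : nat) (c : nat -> R) : h <> 0 ->
  even_coef h n (cut M c) even_orders 0 = 0.
Proof.
intros hn; apply rsum_eq0; intros [|m] _; [unfold cut; simpl; ring|].
replace (0 + even_orders (S m))%nat with (S (S (2 * m))) by (unfold even_orders; lia).
unfold stirling_even, cmean; cbn [stirling_odd]; unfold Rminus, Rdiv; ring.
Qed.

Lemma rsum_gamma_times_conv (a f : nat -> R) (k : nat) :
  rsum (fun p => a (k - p)%nat * gamma_times f p) (S k)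
  = gamma_times (fun k' => rsum (fun p => a (k' - p)%nat * f p) (S k')) k.
Proof.
rewrite rsum_head; destruct k as [|k]; [simpl; ring|].
cbn [gamma_times]; rewrite Rmult_0_r, Rplus_0_l; now apply rsum_ext.
Qed.

Lemma rsum_conv_gamma_times (b f : nat -> R) (k : nat) :
  rsum (fun p => gamma_times b (k - p)%nat * f p) (S k)
  = gamma_times (fun k' => rsum (fun p => b (k' - p)%nat * f p) (S k')) k.
Proof.
destruct k as [|k]; [simpl; ring|].
change (rsum (fun p => gamma_times b (S k - p)%nat * f p) (S k)
  + gamma_times b (S k - S k) * f (S k)
  = rsum (fun p => b (k - p)%nat * f p) (S k)).
rewrite Nat.sub_diag; cbn [gamma_times]; rewrite Rmult_0_l, Rplus_0_r.
apply rsum_ext; intros p Hp; now replace (S k - p)%nat with (S (k - p)) by lia.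
Qed.

(** The powers of delta add up to the same total for every p, so they come out of the convolution
    over p. *)
Lemma v_delta2 (h : R) (p k : nat) (j : Z) (u : grid) (y : R) : (p <= k)%nat ->
  v_tower h p j (delta2 (k - p) u) O y
  = delta2 k u j * stirling_even h p O y
    + mudelta k u j * gamma_times (fun k' => stirling_odd h k' O y) p.
Proof.
intros Hp; unfold v_tower; rewrite delta2_delta2.
replace (p + (k - p))%nat with k by lia; destruct p as [|p]; cbn [gamma_times]; [ring|].
rewrite mudelta_delta2; now replace (S (p + (k - S p))) with k by lia.
Qed.

Lemma w_delta2 (z : nat -> nat -> R) (p k : nat) (j : Z) (u : grid) (y : R) : (p <= k)%nat ->
  w_tower z p j (delta2 (k - p) u) O y
  = - delta2 k u j * egf (z p) O y
    + gamma_times (fun k' => delta2 k' u j) k * gamma_times (fun k' => egf (z k') O y) p.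
Proof.
intros Hp; unfold w_tower; rewrite delta2_delta2.
replace (p + (k - p))%nat with k by lia; destruct p as [|p]; cbn [gamma_times]; [ring|].
rewrite delta2_delta2; destruct k as [|k]; [lia|]; cbn [gamma_times].
now replace (p + (S k - S p))%nat with k by lia.
Qed.

(** The factor stays on both sides: it is 0 at p = k, where [mudelta 0] is the zero operator and the
    brackets need not agree. The quarter comes from (mu delta)^2 = delta^2 + delta^4 / 4. *)
Lemma v_mudelta (h : R) (b : nat -> R) (p k : nat) (j : Z) (u : grid) (y : R) : (p <= k)%nat ->
  gamma_times b (k - p) * v_tower h p j (mudelta (k - p) u) O y
  = gamma_times b (k - p) *
    (mudelta k u j * stirling_even h p O y
     + (gamma_times (fun k' => delta2 k' u j) k + delta2 k u j / 4)
       * gamma_times (fun k' => stirling_odd h k' O y) p).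
Proof.
intros Hp; destruct (k - p)%nat as [|q] eqn:E; cbn [gamma_times]; [ring|f_equal].
unfold v_tower; rewrite delta2_mudelta.
replace (S (p + q)) with k by lia; destruct p as [|p]; cbn [gamma_times]; [ring|].
rewrite mudelta_mudelta.
replace (S (S (p + q))) with k by lia.
destruct k as [|k]; [lia|]; cbn [gamma_times]; now replace (S (p + q)) with k by lia.
Qed.

Lemma model_regular_v (h : R) (l : nat) :
  regular_family h l l (fun k j u x => v_tower h k j u O (x - gridpoint h j)).
Proof.
intros k Hk; split; [|split].
- intros j u x _ n; apply (Derive_n_tower (v_tower h k j u)), tower_v.
- intros j x _; apply grid_differentiable_linear; [apply v_linear|].
  intros u Hu; unfold v_tower; rewrite delta2_local, mudelta_local; [ring| |];
    intros; apply Hu; lia.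
- intros j u x; unfold v_tower, delta2, mudelta.
  rewrite !diffop_apply_shift, Z.add_0_l.
  now replace (x - gridpoint h j - gridpoint h 0) with (x - gridpoint h j) by (unfold gridpoint; ring).
Qed.

Lemma model_regular_w (h : R) (l : nat) (z : nat -> nat -> R) :
  (forall k, (k < l)%nat -> exp_bounded (z k)) ->
  regular_family h l l (fun k j u x => w_tower z k j u O (x - gridpoint h j)).
Proof.
intros Hz k Hk; split; [|split].
- intros j u x _ n; apply (Derive_n_tower (w_tower z k j u)), tower_w.
  intros; apply Hz; lia.
- intros j x _; apply grid_differentiable_linear; [apply w_linear|].
  intros u Hu; unfold w_tower; rewrite delta2_local by (intros; apply Hu; lia).
  rewrite (gamma_times_ext (fun k' => delta2 k' u j) (fun _ => 0))
    by (intros; apply delta2_local; intros; apply Hu; lia).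
  destruct k; cbn [gamma_times]; ring.
- intros j u x; unfold w_tower, delta2.
  rewrite (gamma_times_ext (fun k' => diffop_apply (delta2_pow k') (shift j u) 0)
    (fun k' => diffop_apply (delta2_pow k') u j))
    by (intros; now rewrite diffop_apply_shift, Z.add_0_l).
  rewrite diffop_apply_shift, Z.add_0_l.
  now replace (x - gridpoint h j - gridpoint h 0) with (x - gridpoint h j) by (unfold gridpoint; ring).
Qed.

(** Convolutions are products of generating functions, and [gamma_times] is moved across them. At
    order gamma^k both sides have the common factors delta^(2k) and mu delta^(2k-1); at order
    epsilon the [stirling_even] terms cancel and [z] absorbs the [stirling_odd] ones. *)
Lemma model_exists (h : R) (l M : nat) (c : nat -> R) (N : nat) (d : nat -> R) (n : nat) :
  0 < h -> half_order M c n ->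
  exists z, centre_manifold_model h l M c N d
    (model h l (even_coef h (S n) (cut M c) even_orders)
       (odd_coef h N (odd_coefs d) odd_orders) z).
Proof.
intros hp Hn; assert (hn : h <> 0) by lra.
set (a := even_coef h (S n) (cut M c) even_orders).
set (b := odd_coef h N (odd_coefs d) odd_orders).
assert (Hn' := Hn); destruct Hn' as (n0 & cn & cbig & croot).
destruct (navier_family h n (cut M c) a (gamma_times b) hp n0 cn cbig croot l) as [z Hz].
exists z.
assert (a0 : a 0%nat = 0) by now apply even_coef_0.
assert (Hv := model_regular_v h l).
assert (Hw : regular_family h l l (fun k j u x => w_tower z k j u O (x - gridpoint h j))).
{ apply model_regular_w; intros; now apply Hz. }
split; auto.
- intros j u x _; simpl; unfold v_tower; rewrite delta2_0, mudelta_0; cbn [gamma_times].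
  unfold stirling_even, cmean; simpl; field; auto.
- intros k j u x Hk Hx; simpl vfield; simpl radius.
  set (y := x - gridpoint h j).
  rewrite (even_op_v h M n) by auto; fold y.
  rewrite sum_n_rsum.
  rewrite (rsum_ext _ (fun p => delta2 k u j * (a (k - p)%nat * stirling_even h p O y)
     + mudelta k u j * (a (k - p)%nat * gamma_times (fun k' => stirling_odd h k' O y) p))).
  2: { intros p Hp; rewrite chain_rule_linear; [|apply v_linear|now apply Hv; [lia|]].
       rewrite gop_model, (grid_linear_scal (fun v => v_tower h p j v O y)) by apply v_linear.
       fold a; rewrite v_delta2 by lia; ring. }
  rewrite rsum_plus, !rsum_scal, rsum_gamma_times_conv.
  assert (AP := even_op_stirling_even h (S n) (cut M c) even_orders k 0 y hp even_ordersP).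
  fold a in AP; rewrite <- AP.
  symmetry; etransitivity;
    [exact (even_comb_lin (S n) (cut M c) (delta2 k u j) (mudelta k u j) (stirling_even h k)
       (fun i y => gamma_times (fun k' => stirling_odd h k' i y) k) y y)|symmetry].
  f_equal; f_equal.
  destruct k as [|k]; cbn [gamma_times].
  + symmetry; apply rsum_eq0; intros; ring.
  + symmetry; apply (even_op_stirling_odd h (S n) (cut M c) even_orders k 0 y hp even_ordersP).
- intros k j u x Hk Hx; simpl vfield; simpl wfield; simpl radius.
  set (y := x - gridpoint h j).
  rewrite (even_op_w h M n) by (auto; intros; apply Hz; lia); rewrite odd_op_v; fold y.
  rewrite sum_n_rsum.
  set (C' := gamma_times (fun k' => delta2 k' u j) k).
  set (Q' := gamma_times (fun k' => stirling_odd h k' O y)).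
  set (Z' := gamma_times (fun k' => egf (z k') O y)).
  rewrite (rsum_ext _ (fun p =>
     (mudelta k u j * (gamma_times b (k - p) * stirling_even h p O y)
      + (C' + delta2 k u j / 4) * (gamma_times b (k - p) * Q' p))
     + ((- delta2 k u j) * (a (k - p)%nat * egf (z p) O y) + C' * (a (k - p)%nat * Z' p)))).
  2: { intros p Hp; rewrite !chain_rule_linear;
         [|apply w_linear|now apply Hw; [lia|]|apply v_linear|now apply Hv; [lia|]].
       rewrite gop_model, fop_model.
       rewrite (grid_linear_scal (fun v => v_tower h p j v O y)) by apply v_linear.
       rewrite (grid_linear_scal (fun v => w_tower z p j v O y)) by apply w_linear.
       fold a b; rewrite v_mudelta, w_delta2 by lia; fold C'; unfold Q', Z'; ring. }
  rewrite !rsum_plus, !rsum_scal.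
  (* The sums in [navier_family] are completed by their terms p = k, which vanish with [a 0] and
     [gamma_times b 0]. *)
  assert (AZ : forall k, (k < l)%nat -> even_comb (S n) (cut M c) (egf (z k)) y
     = rsum (fun p => a (k - p)%nat * egf (z p) O y) (S k)
       + rsum (fun p => gamma_times b (k - p) * stirling_odd h p O y) (S k)).
  { intros k0 Hk0; destruct (Hz k0 Hk0) as (_ & _ & _ & ->).
    cbn [rsum]; rewrite !Nat.sub_diag, a0; cbn [gamma_times]; ring. }
  assert (AW : even_comb (S n) (cut M c) (w_tower z k j u) y
     = - delta2 k u j * even_comb (S n) (cut M c) (egf (z k)) y
       + C' * gamma_times (fun k' => even_comb (S n) (cut M c) (egf (z k')) y) k).
  { unfold w_tower; fold C'.
    destruct k as [|k]; cbn [gamma_times]; [|apply even_comb_lin].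
    etransitivity;
      [exact (even_comb_lin (S n) (cut M c) (- delta2 0 u j) C' (egf (z 0%nat)) (fun _ _ => 0) y y)|].
    f_equal; f_equal; apply rsum_eq0; intros; ring. }
  assert (BV : diff_op N (odd_coefs d) odd_orders (v_tower h k j u) O y
     = delta2 k u j * diff_op N (odd_coefs d) odd_orders (stirling_even h k) O y
       + mudelta k u j * gamma_times
           (fun k' => diff_op N (odd_coefs d) odd_orders (stirling_odd h k') O y) k).
  { unfold diff_op, v_tower.
    rewrite (rsum_ext _ (fun m => delta2 k u j * (odd_coefs d m * stirling_even h k (0 + odd_orders m)%nat y)
      + mudelta k u j * (odd_coefs d m * gamma_times (fun k' => stirling_odd h k' (0 + odd_orders m)%nat y) k)))
      by (intros; ring).
    rewrite rsum_plus, !rsum_scal; do 2 f_equal.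
    destruct k; cbn [gamma_times]; [apply rsum_eq0; intros; ring|reflexivity]. }
  rewrite AW, BV, AZ by auto.
  rewrite (odd_op_stirling_even h N (odd_coefs d) odd_orders k 0 y hp odd_ordersP); fold b.
  rewrite (gamma_times_ext _ _ k (fun k' Hk' => AZ k' (Nat.lt_trans _ _ _ Hk' Hk))).
  rewrite (rsum_ext (fun p => (gamma_times b (k - p) + gamma_times (gamma_times b) (k - p) / 4)
             * stirling_odd h p O y)
     (fun p => gamma_times b (k - p) * stirling_odd h p O y
         + / 4 * (gamma_times (gamma_times b) (k - p) * stirling_odd h p O y)))
    by (intros; field).
  rewrite (rsum_plus (fun p => gamma_times b (k - p) * stirling_odd h p O y)
     (fun p => / 4 * (gamma_times (gamma_times b) (k - p) * stirling_odd h p O y))), rsum_scal.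
  unfold Q', Z'.
  rewrite (rsum_gamma_times_conv (gamma_times b) (fun k' => stirling_odd h k' O y)).
  rewrite (rsum_gamma_times_conv a (fun k' => egf (z k') O y)).
  rewrite (rsum_conv_gamma_times (gamma_times b) (fun p => stirling_odd h p O y)).
  rewrite (rsum_conv_gamma_times b (fun p => stirling_even h p O y)).
  rewrite (gamma_times_ext
    (fun k' => diff_op N (odd_coefs d) odd_orders (stirling_odd h k') O y)
    (fun k' => rsum (fun p => b (k' - p)%nat * stirling_even h p O y) (S k')) k)
    by (intros k' _; apply (odd_op_stirling_odd h N (odd_coefs d) odd_orders k' 0 y hp odd_ordersP)).
  (* What remains is linear in the sums; [change] states the equality over [R] itself for
     [field]. *)
  destruct k as [|k]; cbn [gamma_times]; 
    match goal with |- @eq _ ?s ?t => change (@eq R s t) end; field.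
- intros k j u Hk; simpl; rewrite Rminus_diag; split.
  + unfold v_tower; rewrite stirling_even_at_0 by auto.
    destruct k as [|k]; cbn [gamma_times]; rewrite ?stirling_odd_at_0; unfold kronecker; simpl;
      rewrite ?delta2_0; ring.
  + apply w_zero; intros k' Hk'; apply (egf_even_at_0 (z k') 0), Hz; lia.
- apply (v_internal_bc h l 0 hp).
- apply (w_internal_bc h l 0); intros k Hk; destruct (Hz k Hk) as (H1 & H2 & H3 & _).
  repeat split; auto; exact (H3 0%nat n0).
- intros i _ Hi; apply (below_half_order M c n i Hn) in Hi; split.
  + apply (v_internal_bc h l i hp).
  + apply (w_internal_bc h l i); intros k Hk; destruct (Hz k Hk) as (H1 & H2 & H3 & _).
    repeat split; auto.
Qed.

(** * Consistency *)

(** Derivatives of x^s / s!; beyond order s the truncated subtraction would give 1, so the test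
    returns 0. *)
Definition monomial (s i : nat) (x : R) : R :=
  if Nat.leb i s then x ^ (s - i) / INR (fact (s - i)) else 0.

Lemma poly_tower_monomial (s : nat) : poly_tower (monomial s).
Proof.
split.
- intros i x _; unfold monomial.
  destruct (Nat.leb_spec i s) as [Hi|Hi].
  + destruct (Nat.leb_spec (S i) s) as [Hi'|Hi'].
    * replace (s - i)%nat with (S (s - S i)) by lia; generalize (s - S i)%nat; intros m.
      apply is_derive_eq with (INR (S m) * x ^ m / INR (fact (S m))).
      -- apply (is_derive_ext (fun y => / INR (fact (S m)) * y ^ S m)); [intros; apply Rmult_comm|].
         apply is_derive_eq with (/ INR (fact (S m)) * (INR (S m) * 1 * x ^ pred (S m))).
         ++ apply is_derive_scal, (is_derive_pow (fun y => y)), (is_derive_id x).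
         ++ simpl pred; unfold Rdiv; ring.
      -- rewrite fact_simpl, mult_INR; field; split; [apply INR_fact_neq_0|apply not_0_INR; lia].
    * replace (s - i)%nat with O by lia.
      replace (Nat.leb (S i) s) with false by (symmetry; apply Nat.leb_gt; lia).
      apply (is_derive_const (1 / INR (fact 0))).
  + replace (Nat.leb (S i) s) with false by (symmetry; apply Nat.leb_gt; lia).
    apply (is_derive_const 0).
- exists (S s); intros x; unfold monomial.
  now replace (Nat.leb (S s) s) with false by (symmetry; apply Nat.leb_gt; lia).
Qed.

Lemma monomial_at_0 (s i : nat) : monomial s i 0 = if Nat.eqb s i then 1 else 0.
Proof.
unfold monomial; destruct (Nat.eqb_spec s i) as [->|Hs].
- rewrite Nat.leb_refl, Nat.sub_diag; simpl; field.
- destruct (Nat.leb_spec i s); [|reflexivity].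
  rewrite pow_i by lia; unfold Rdiv; ring.
Qed.

Lemma parity_monomial (s : nat) : parity ((-1) ^ s) (monomial s).
Proof.
intros x; unfold monomial; simpl Nat.leb; rewrite Nat.sub_0_r.
replace (- x) with (-1 * x) by ring; rewrite Rpow_mult_distr; unfold Rdiv; ring.
Qed.

Lemma derive_zero_eq (f f' : R -> R) :
  (forall x, is_derive f x (f' x)) -> (forall x, f' x = 0) -> forall x y, f x = f y.
Proof.
intros Hd H0.
assert (C : forall x y, x <= y -> f y = f x).
{ intros x y xy; apply (derive_zero_const f f' x y); auto; lra. }
intros x y; destruct (Rle_dec x y); [symmetry|]; apply C; lra.
Qed.

(** [phi N] is affine, so its increments over the steps from x - h to x and from x to x + h
    agree. *)
Lemma cdiff2_degree (h : R) (phi : nat -> R -> R) (N : nat) :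
  tower (fun _ => True) phi -> (forall x, phi (S (S N)) x = 0) ->
  forall x, cdiff2 h (phi N) x = 0.
Proof.
intros Ht H0 x.
assert (C : forall x y, phi (S N) x = phi (S N) y).
{ apply (derive_zero_eq _ (phi (S (S N)))); auto; intros; now apply Ht. }
assert (D : phi N (1 * x + h) - phi N x = phi N (1 * (x - h) + h) - phi N (x - h)).
{ apply (derive_zero_eq (fun y => phi N (1 * y + h) - phi N y)
    (fun y => 1 * phi (S N) (1 * y + h) - phi (S N) y)).
  - intros y; apply (is_derive_minus (V := R_NormedModule)); [apply is_derive_affine|];
      now apply Ht.
  - intros y; rewrite (C (1 * y + h) y); ring. }
unfold cdiff2.
replace (1 * x + h) with (x + h) in D by ring.
replace (1 * (x - h) + h) with x in D by ring; lra.
Qed.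

Definition cdiff2_pow (h : R) (k : nat) (phi : nat -> R -> R) (i : nat) : R -> R :=
  Nat.iter k (cdiff2 h) (phi i).

Lemma poly_tower_cdiff2_pow (h : R) (k : nat) (phi : nat -> R -> R) :
  poly_tower phi -> poly_tower (cdiff2_pow h k phi).
Proof.
intros H; induction k as [|k IH]; [exact H|].
exact (poly_tower_cdiff2 h (cdiff2_pow h k phi) IH).
Qed.

Lemma cdiff2_pow_degree (h : R) (k : nat) (phi : nat -> R -> R) (N : nat) :
  poly_tower phi -> (forall x, phi (N + 2 * k)%nat x = 0) ->
  forall x, cdiff2_pow h k phi N x = 0.
Proof.
intros Hp; revert N; induction k as [|k IH]; intros N H0 x.
- rewrite Nat.add_0_r in H0; apply H0.
- apply (cdiff2_degree h (cdiff2_pow h k phi)).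
  + now apply poly_tower_cdiff2_pow.
  + intros y; apply IH; intros z; rewrite <- (H0 z); f_equal; lia.
Qed.

Lemma parity_cdiff2_pow (h s : R) (k : nat) (phi : nat -> R -> R) :
  parity s phi -> parity s (cdiff2_pow h k phi).
Proof.
intros H; induction k as [|k IH]; [exact H|].
intros x; change (cdiff2 h (cdiff2_pow h k phi O) (- x) = s * cdiff2 h (cdiff2_pow h k phi O) x).
unfold cdiff2.
replace (- x + h) with (- (x - h)) by ring; replace (- x - h) with (- (x + h)) by ring.
rewrite !IH; ring.
Qed.

(** In reverse order the powers of delta^2 on a polynomial of degree below 2 (K + 1) form such a
    sequence, with [phi] last; its expansion is Stirling's interpolation formula. *)
Lemma central_appell_cdiff2_pow (h : R) (K : nat) (phi : nat -> R -> R) :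
  poly_tower phi -> (forall x, phi (2 * S K)%nat x = 0) ->
  central_appell h K (fun k => cdiff2_pow h (K - k) phi).
Proof.
intros Hp H0; split; [|split].
- intros; now apply poly_tower_cdiff2_pow.
- intros x; rewrite Nat.sub_0_r; exact (cdiff2_pow_degree h (S K) phi 0 Hp H0 x).
- intros k x Hk; replace (K - k)%nat with (S (K - S k)) by lia; reflexivity.
Qed.

Lemma delta2_sample (h : R) (phi : nat -> R -> R) (k : nat) (j : Z) :
  delta2 k (fun i => phi O (IZR i * h)) j = cdiff2_pow h k phi O (IZR j * h).
Proof.
revert j; induction k as [|k IH]; intros j; [now rewrite delta2_0|].
rewrite delta2_S, !IH, plus_IZR, minus_IZR.
change (cdiff2_pow h (S k) phi O (IZR j * h)) with (cdiff2 h (cdiff2_pow h k phi O) (IZR j * h)).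
unfold cdiff2; rewrite Rmult_plus_distr_r, Rmult_minus_distr_r, Rmult_1_l; ring.
Qed.

Lemma mudelta_sample (h : R) (phi : nat -> R -> R) (k : nat) (j : Z) :
  mudelta (S k) (fun i => phi O (IZR i * h)) j = cmean h (cdiff2_pow h k phi O) (IZR j * h).
Proof.
rewrite mudelta_S, !delta2_sample, plus_IZR, minus_IZR; unfold cmean.
now rewrite Rmult_plus_distr_r, Rmult_minus_distr_r, Rmult_1_l.
Qed.

(** The coefficient of D^s is the value at 0 on x^s / s!, so consistency becomes exactness on
    monomials. *)
Lemma diffop_symbol_sample (h : R) (G : diffop) (s : nat) :
  diffop_symbol h G s = diffop_apply G (fun i => monomial s O (IZR i * h)) 0.
Proof.
apply list_Rsum_map_ext; intros t _; rewrite Z.add_0_l.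
unfold monomial; simpl Nat.leb; now rewrite Nat.sub_0_r.
Qed.

Lemma even_symbol_monomial (M n : nat) (c : nat -> R) (s : nat) : half_order M c n ->
  diff_op (S n) (cut M c) even_orders (monomial s) O 0 = even_symbol M c s.
Proof.
intros (_ & _ & Hn & _); unfold diff_op.
rewrite (rsum_cut n M c (fun m => monomial s (0 + even_orders m)%nat 0)) by auto.
unfold even_symbol; apply sum_n_m_ext; intros m; rewrite Nat.add_0_l, monomial_at_0.
unfold even_orders; destruct (Nat.eqb s (2 * m)); [apply Rmult_1_r|apply Rmult_0_r].
Qed.

Lemma odd_symbol_monomial (N : nat) (d : nat -> R) (s : nat) :
  diff_op N (odd_coefs d) odd_orders (monomial s) O 0 = odd_symbol N d s.
Proof.
unfold odd_symbol; rewrite sum_n_m_rsum; apply rsum_ext; intros m _.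
rewrite Nat.add_0_l, monomial_at_0; unfold odd_orders, odd_coefs.
replace (2 * S m - 1)%nat with (2 * m + 1)%nat by lia.
destruct (Nat.eqb s (2 * m + 1)); ring.
Qed.

(** Stirling's formula, exact below degree 2 l, is differentiated term by term at 0. *)
Lemma even_coef_exact (h : R) (l n : nat) (coef : nat -> R) (ord : nat -> nat) (phi : nat -> R -> R) :
  0 < h -> (forall m, Nat.Even (ord m)) -> poly_tower phi -> parity 1 phi ->
  (forall x, phi (2 * l)%nat x = 0) ->
  rsum (fun k => even_coef h n coef ord k * cdiff2_pow h k phi O 0) l
  = diff_op n coef ord phi O 0.
Proof.
intros hp Ho Hp Hpar H0; destruct l as [|l].
{ symmetry; apply rsum_eq0; intros m _.
  now rewrite Nat.add_0_l, <- (Nat.add_0_r (ord m)), (poly_tower_zero_from phi 0), Rmult_0_r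
    by (auto; apply Hp). }
assert (E := even_expansion h (fun k => cdiff2_pow h (l - k) phi) l hp
  (central_appell_cdiff2_pow h l phi Hp H0)
  (fun k _ => parity_cdiff2_pow h 1 (l - k) phi Hpar)).
cbv beta in E; rewrite Nat.sub_diag in E.
unfold diff_op.
rewrite (rsum_ext (fun m => coef m * phi (0 + ord m)%nat 0)
  (fun m => rsum (fun k => coef m *
     (cdiff2_pow h (l - (l - k)) phi O 0 * stirling_even h k (0 + ord m)%nat 0)) (S l))).
2: { intros m _; rewrite rsum_scal; f_equal; apply E. }
rewrite (rsum_swap (fun m k => coef m *
     (cdiff2_pow h (l - (l - k)) phi O 0 * stirling_even h k (0 + ord m)%nat 0))).
apply rsum_ext; intros k Hk; unfold even_coef, diff_op.
replace (l - (l - k))%nat with k by lia.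
rewrite Rmult_comm, <- rsum_scal; apply rsum_ext; intros; ring.
Qed.

(** The odd Stirling formula has the coefficients delta^(2k) phi (h), which for odd [phi] are the mu
    delta^(2k+1) phi (0). *)
Lemma odd_coef_exact (h : R) (l n : nat) (coef : nat -> R) (ord : nat -> nat) (phi : nat -> R -> R) :
  0 < h -> poly_tower phi -> parity (-1) phi ->
  (forall x, phi (2 * l)%nat x = 0) ->
  rsum (fun k => odd_coef h n coef ord k * cmean h (cdiff2_pow h k phi O) 0) l
  = diff_op n coef ord phi O 0.
Proof.
intros hp Hp Hpar H0; destruct l as [|l].
{ symmetry; apply rsum_eq0; intros m _.
  now rewrite Nat.add_0_l, <- (Nat.add_0_r (ord m)), (poly_tower_zero_from phi 0), Rmult_0_r
    by (auto; apply Hp). }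
assert (E := odd_expansion h (fun k => cdiff2_pow h (l - k) phi) l hp
  (central_appell_cdiff2_pow h l phi Hp H0)
  (fun k _ => parity_cdiff2_pow h (-1) (l - k) phi Hpar)).
cbv beta in E; rewrite Nat.sub_diag in E.
unfold diff_op.
rewrite (rsum_ext (fun m => coef m * phi (0 + ord m)%nat 0)
  (fun m => rsum (fun k => coef m *
     (cdiff2_pow h (l - (l - k)) phi O h * stirling_odd h k (0 + ord m)%nat 0)) (S l))).
2: { intros m _; rewrite rsum_scal; f_equal; apply E. }
rewrite (rsum_swap (fun m k => coef m *
     (cdiff2_pow h (l - (l - k)) phi O h * stirling_odd h k (0 + ord m)%nat 0))).
apply rsum_ext; intros k Hk; unfold odd_coef, diff_op.
replace (l - (l - k))%nat with k by lia.
rewrite (cmean_odd_at_0 h (cdiff2_pow h k phi)) by now apply parity_cdiff2_pow.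
rewrite Rmult_comm, <- rsum_scal; apply rsum_ext; intros; ring.
Qed.

Lemma monomial_vanish (s m : nat) (x : R) : (s < m)%nat -> monomial s m x = 0.
Proof.
intros H; unfold monomial.
now replace (Nat.leb m s) with false by (symmetry; apply Nat.leb_gt; lia).
Qed.

Lemma pow_m1_odd (m : nat) : (-1) ^ (2 * m + 1) = -1.
Proof. rewrite pow_add, pow_1_even; ring. Qed.

Lemma consistent_even (h : R) (M n : nat) (c : nat -> R) (l s : nat) :
  0 < h -> half_order M c n -> (s < 2 * l)%nat ->
  rsum (fun k => even_coef h (S n) (cut M c) even_orders k
                 * delta2 k (fun i => monomial s O (IZR i * h)) 0%Z) l
  = even_symbol M c s.
Proof.
intros hp Hn Hs; rewrite <- (even_symbol_monomial M n) by auto.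
rewrite (rsum_ext _ (fun k => even_coef h (S n) (cut M c) even_orders k
                 * cdiff2_pow h k (monomial s) O 0))
  by (intros; now rewrite delta2_sample, Rmult_0_l).
assert (Hpar := parity_monomial s).
destruct (Nat.Even_or_Odd s) as [[m ->]|[m ->]].
- rewrite pow_1_even in Hpar.
  apply even_coef_exact; auto using even_ordersP, poly_tower_monomial.
  intros; now apply monomial_vanish.
- rewrite pow_m1_odd in Hpar; transitivity 0; [|symmetry].
  + apply rsum_eq0; intros k _.
    assert (E := parity_cdiff2_pow h (-1) k _ Hpar 0); rewrite Ropp_0 in E.
    replace (cdiff2_pow h k (monomial (2 * m + 1)) O 0) with 0 by lra; ring.
  + apply rsum_eq0; intros i _; rewrite monomial_at_0; unfold even_orders.
    replace (Nat.eqb (2 * m + 1) (0 + 2 * i)) with false; [ring|].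
    symmetry; apply Nat.eqb_neq; lia.
Qed.

(** The term of order gamma^0 is 0, so l - 1 terms remain, exact on odd degrees below 2 (l - 1).
    Even degrees vanish by parity, including s = 2 l - 2, which is the last one below the bound. *)
Lemma consistent_odd (h : R) (N : nat) (d : nat -> R) (l s : nat) :
  0 < h -> (s < 2 * l - 1)%nat ->
  rsum (fun k => gamma_times (odd_coef h N (odd_coefs d) odd_orders) k
                 * mudelta k (fun i => monomial s O (IZR i * h)) 0%Z) l
  = odd_symbol N d s.
Proof.
intros hp Hs; rewrite <- odd_symbol_monomial.
destruct l as [|l]; [lia|]; rewrite rsum_head; cbn [gamma_times]; rewrite Rmult_0_l, Rplus_0_l.
rewrite (rsum_ext _ (fun k => odd_coef h N (odd_coefs d) odd_orders k
                 * cmean h (cdiff2_pow h k (monomial s) O) 0))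
  by (intros; now rewrite mudelta_sample, Rmult_0_l).
assert (Hpar := parity_monomial s).
destruct (Nat.Even_or_Odd s) as [[m ->]|[m ->]].
- rewrite pow_1_even in Hpar; transitivity 0; [|symmetry].
  + apply rsum_eq0; intros k _; unfold cmean; rewrite Rplus_0_l.
    replace (0 - h) with (- h) by ring.
    rewrite (parity_cdiff2_pow h 1 k _ Hpar); field.
  + apply rsum_eq0; intros i _; rewrite monomial_at_0; unfold odd_orders.
    replace (Nat.eqb (2 * m) (0 + (2 * i + 1))) with false; [ring|].
    symmetry; apply Nat.eqb_neq; lia.
- rewrite pow_m1_odd in Hpar.
  apply odd_coef_exact; auto using poly_tower_monomial.
  intros; apply monomial_vanish; lia.
Qed.

Theorem theorem3 (h : R) (l : nat) (M : nat) (c : nat -> R)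
    (N : nat) (d : nat -> R)
    (hpos : 0 < h) (lpos : (1 <= l)%nat) (Adiss : dissipative M c) :
  (exists E : expansion, centre_manifold_model h l M c N d E) /\
  (forall E : expansion, centre_manifold_model h l M c N d E ->
     consistent h M c N d
       (diffop_sum (gop E) l) (diffop_sum (fop E) l)
       (2 * l) (2 * l - 1)).
Proof.
destruct (half_order_exists M c Adiss) as [n Hn].
destruct (model_exists h l M c N d n hpos Hn) as [z Hz].
split; [eexists; exact Hz|intros E HE].
(* Linearity and g^0 = 0 are checked on the explicit model alone; uniqueness then gives [E] the same
   difference operators at every order below [l]. *)
assert (lin_v : forall k j x, (k < l)%nat -> in_element h j x ->
  grid_linear (fun u => vfield (model h l (even_coef h (S n) (cut M c) even_orders)
       (odd_coef h N (odd_coefs d) odd_orders) z) k j u x)) by (intros; apply v_linear).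
assert (lin_w : forall k j x, (k < l)%nat -> in_element h j x ->
  grid_linear (fun u => wfield (model h l (even_coef h (S n) (cut M c) even_orders)
       (odd_coef h N (odd_coefs d) odd_orders) z) k j u x)) by (intros; apply w_linear).
assert (g0 : forall u j, diffop_apply (gop (model h l (even_coef h (S n) (cut M c) even_orders)
       (odd_coef h N (odd_coefs d) odd_orders) z) 0) u j = 0).
{ intros u j; rewrite gop_model, even_coef_0 by lra; ring. }
split; intros s Hs; apply Rminus_diag_eq; rewrite diffop_symbol_sample, diffop_apply_sum.
- rewrite <- (consistent_even h M n c l s hpos Hn Hs); apply rsum_ext; intros k Hk.
  destruct (model_unique_v hpos Adiss HE Hz lin_v g0 k Hk) as [_ ->].
  now rewrite gop_model.
- rewrite <- (consistent_odd h N d l s hpos Hs); apply rsum_ext; intros k Hk.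
  destruct (model_unique_w hpos Adiss HE Hz lin_v lin_w g0 k Hk) as [_ ->].
  now rewrite fop_model.
Qed.
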